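(* Let $\Omega\subset\mathbb{R}^2$ be a compact convex set with nonempty interior, let $M>0$, and let $u$ be a minimizer of $$F(v)=\iint_\Omega \frac{1}{1+|\nabla v(x_1,x_2)|^2}\,dx_1\,dx_2$$ in the class of all concave functions $v:\Omega\to\mathbb{R}$ with $0\le v\le M$. Let $C_u=\{(x,z): x\in\Omega,\ 0\le z\le u(x)\}\subset\mathbb{R}^3$. Then every ridge point of $C_u$ with horizontal edge lies either on the boundary of the upper level set $C_u\cap\{z=M\}$ or on the boundary of the zero level set $C_u\cap\{z=0\}$.
   Context: Points of $\mathbb{R}^3$ are written $(x,z)$ with $x\in\mathbb{R}^2$, $z\in\mathbb{R}$; the plane $\{z=0\}$ is horizontal. A boundary point $r_0$ of a convex body (compact convex set with nonempty interior) $C\subset\mathbb{R}^3$ is a ridge point if the tangent cone to $C$ at $r_0$ is a (proper) dihedral angle, i.e. the intersection of two closed half-spaces whose boundary planes pass through $r_0$ and are distinct and non-parallel; the edge of the dihedral angle is the line of intersection of these two planes. The ridge point has horizontal edge if this line is parallel to the plane $\{z=0\}$. The boundaries of the level sets $C_u\cap\{z=M\}$ and $C_u\cap\{z=0\}$ are taken within the planes $\{z=M\}$ and $\{z=0\}$, respectively (so if $C_u\cap\{z=M\}$ is a line segment, its boundary is the whole segment). *)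

(* Defs.v *)
From mathcomp Require Import all_boot all_order all_algebra.
From mathcomp Require Import all_classical all_reals all_analysis.

Set Implicit Arguments.
Unset Strict Implicit.
Unset Printing Implicit Defensive.

Import Order.TTheory GRing.Theory Num.Theory.
Import numFieldNormedType.Exports.

Local Open Scope classical_set_scope.
Local Open Scope ring_scope.

(* The plane is R * R and space is (R * R) * R, a point
   being written (x, z).  The norm of these product types is the sup norm; it
   only serves to define the topology, Euclidean quantities are explicit. *)

Definition boundary {T : topologicalType} (A : set T) : set T :=
  closure A `\` interior A.

Section Resistance.
Context {R : realType}.
Implicit Types (Omega : set (R * R)) (u v : R * R -> R) (M : R).

Definition grad v (x : R * R) : R * R :=
  ('D_((1, 0) : R * R) v x, 'D_((0, 1) : R * R) v x).

(* Functions on Omega are total functions whose values outside Omega are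
   ignored.  A concave v is differentiable at almost every point of Omega, and
   at interior points its gradient depends on the values in Omega only; the
   default values that 'D takes elsewhere sit on a null set. *)
Definition resistance Omega v : \bar R :=
  (\int[(@lebesgue_measure R) \x (@lebesgue_measure R)]_(x in Omega)
     (1 / (1 + ((grad v x).1 ^+ 2 + (grad v x).2 ^+ 2)))%R%:E)%E.

Definition concave_function Omega v : Prop :=
  convex_function Omega (fun x => - v x).

Definition admissible Omega M v : Prop :=
  concave_function Omega v /\ forall x, Omega x -> 0 <= v x <= M.

Definition minimizer Omega M u : Prop :=
  admissible Omega M u /\
  forall v, admissible Omega M v -> (resistance Omega u <= resistance Omega v)%E.

Definition hypograph Omega u : set ((R * R) * R) :=
  [set r | Omega r.1 /\ 0 <= r.2 <= u r.1].

End Resistance.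

Section RidgePoints.
Context {R : realType}.
Implicit Types (C K E A : set ((R * R) * R)) (n p r : (R * R) * R).

Definition dot p q : R := p.1.1 * q.1.1 + p.1.2 * q.1.2 + p.2 * q.2.

Definition tangent_cone C r : set ((R * R) * R) :=
  closure [set q | exists t p, [/\ 0 <= t, C p & q = r + t *: (p - r)]].

Definition half_space r n : set ((R * R) * R) := [set p | dot n (p - r) <= 0].

Definition bounding_plane r n : set ((R * R) * R) :=
  [set p | dot n (p - r) = 0].

(* K is a proper dihedral angle at r with edge E.  Two planes through r are
   distinct exactly when they are not parallel, that is, when their normals
   are not proportional. *)
Definition dihedral_angle r K E : Prop :=
  exists n1 n2,
    [/\ n1 != 0 /\ n2 != 0,
        forall k : R, n2 != k *: n1,
        K = half_space r n1 `&` half_space r n2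
      & E = bounding_plane r n1 `&` bounding_plane r n2].

(* C is not required to be closed: C_u = hypograph Omega u need not be, since a
   concave function may fail to be upper semicontinuous on the boundary of its
   domain.  A closed C contains its boundary, so that C r is then implied. *)
Definition ridge_point C r E : Prop :=
  [/\ C r, boundary C r & dihedral_angle r (tangent_cone C r) E].

(* A line is parallel to {z = 0} when z is constant along it. *)
Definition horizontal E : Prop := forall p q, E p -> E q -> p.2 = q.2.

Definition level_set C (h : R) : set ((R * R) * R) := C `&` [set r | r.2 = h].

(* Boundary of A, a subset of {z = h}, within that plane, which is identified
   with R * R by x |-> (x, h). *)
Definition plane_boundary (h : R) A : set ((R * R) * R) :=
  [set r | r.2 = h /\ boundary [set x : R * R | A (x, h)] r.1].

End RidgePoints.

(* Main.v *)
(* Let (x0, z0) be a ridge point with horizontal edge.  If the level set at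
   height z0 contained a neighbourhood of x0, both faces of the dihedral angle
   would be horizontal; this settles z0 = 0 and z0 = M.  If 0 < z0 < M, then
   z0 = u(x0), and up to a rotation the two faces bound u - z0 by - a t and - b t,
   where t is the first coordinate of x - x0, a < b and b > 0 (b being any large
   number when the second face is vertical).

   If a <= 0, then u <= z0 < M.  The competitor M u / z0 has no larger
   resistance, so minimality forces grad u = 0 almost everywhere, and a
   nonconstant affine function does better.

   If 0 < a and b < 1, replace u by the infimum v of the affine functions above
   u whose gradient avoids a lens-shaped open set Z near the segment joining
   the two slopes.  In Z the integrand exceeds an affine function of d1 u, while
   grad v lies outside Z, where the integrand is at most that function.
   Integrating along lines shows that v does not increase the resistance, and
   v(x0) > u(x0) yields a strict decrease.

   If b >= 1, cut the graph with the plane z = z0 - e - c t with a < c < b and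
   c a + c^2 > 1.  The cap cut off has width O(e) across the edge and length L
   along it with L / e unbounded as e tends to 0.  In the cap the integrand
   exceeds its value on the cutting plane by a linear term, which integrates to
   O(e^2), plus a positive multiple of |d1 u + c|, which integrates to at least
   a constant times e L.  So cutting lowers the resistance for small e.

   In both cases Fubini reduces the comparison to the fundamental theorem of
   calculus for one-dimensional concave functions, whose one-sided derivatives
   are measurable and coincide almost everywhere with the gradient. *)

Require Import Defs.
From mathcomp Require Import all_boot all_order all_algebra.
From mathcomp Require Import all_classical all_reals all_analysis.
From mathcomp Require Import measurable_realfun ring lra.
Import Order.TTheory GRing.Theory Num.Theory.
Import numFieldNormedType.Exports.
Local Open Scope classical_set_scope.
Local Open Scope ring_scope.

Set Implicit Arguments.
Unset Strict Implicit.
Unset Printing Implicit Defensive.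

(** * Monotone derivatives on an interval *)

Section supergradient_integral.
Context {R : realType}.
Notation leb := (@lebesgue_measure R).
Implicit Types (h g E : R -> R) (a b : R).

(** The threshold 1 comes from [1 / (1 + p^2) - (1 - p / 2) = p (1 - p)^2 / (2 (1 + p^2))]: on
    slopes [0 < p < 1] the integrand lies above its chord, which is moreover tangent at 1, so mixing
    slopes along the chord helps. Once [b >= 1] the tangent at a slope [c] takes over; the excess
    over it is a positive multiple of [(p - c)^2 (2 c p + c^2 - 1)], and [c a + c^2 > 1] makes the
    last factor positive for [p >= a / 2].

    The linear term of each comparison integrates to boundary values along lines, and these are the
    obstacle: [x0] may lie on the boundary of [Omega], where [u] may be discontinuous. Raising
    controls them because slopes below -1 stay allowed, which closes the gap between the two graphs
    at the right end of each slice. Cutting controls them by one interior point up the slope: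
    segments from it to the cap show that all slices of the cap, except those within O(e) of its two
    ends, start inside [Omega] on the cutting plane. At [x0] itself only the tangent cone is used,
    through nearby points of the body, never a gradient. *)

Lemma constant_of_modulus g E a b : a <= b ->
  (forall s t, a <= s -> s <= t -> t <= b ->
    `|E t - E s| <= (g s - g t) * (t - s)) ->
  E b = E a.
Proof.
move=> ab H.
suff K n : `|E b - E a| <= (g a - g b) * (b - a) / n.+1%:R.
  apply/eqP; rewrite -subr_eq0 -normr_eq0; apply/eqP/le_anti.
  rewrite normr_ge0 andbT; apply/ler_addgt0Pl => e e0; rewrite addr0.
  set B := (g a - g b) * (b - a) in K *.
  have B0 : 0 <= B by apply: le_trans (H a b _ _ _).
  have [n Bn] : exists n : nat, B / e <= n.+1%:R.
    by exists (Num.truncn (B / e)); apply/ltW/truncnS_gt.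
  apply: (le_trans (K n)); rewrite ler_pdivrMr ?ltr0n// mulrC.
  by rewrite -ler_pdivrMr.
(* Over the uniform partition the factors [g s - g t] telescope, leaving one factor of the mesh
   [d]. *)
set d := (b - a) / n.+1%:R.
have d0 : 0 <= d by rewrite divr_ge0// subr_ge0.
have dn : d *+ n.+1 = b - a by rewrite -mulr_natr divfK// pnatr_eq0.
have Kk k : (k <= n.+1)%N ->
    `|E (a + d *+ k) - E a| <= (g a - g (a + d *+ k)) * d.
  elim: k => [|k IH] kn; first by rewrite mulr0n addr0 !subrr normr0 mul0r.
  have h1 : a <= a + d *+ k by rewrite lerDl mulrn_wge0.
  have h2 : a + d *+ k <= a + d *+ k.+1 by rewrite lerD2l ler_wpMn2l.
  have h3 : a + d *+ k.+1 <= b.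
    have : d *+ k.+1 <= d *+ n.+1 by apply: ler_wpMn2l.
    by rewrite dn; lra.
  have := H _ _ h1 h2 h3.
  have := IH (ltnW kn).
  have -> : a + d *+ k.+1 - (a + d *+ k) = d by rewrite mulrSr; ring.
  have := ler_normD (E (a + d *+ k.+1) - E (a + d *+ k)) (E (a + d *+ k) - E a).
  rewrite addrA subrK; nra.
have := Kk n.+1 (leqnn _); rewrite dn [a + _]addrC subrK.
by rewrite /d mulrA.
Qed.

(** [g] picks a supergradient of [h] at each point of [D]. One-sided derivatives of a concave
    function do this, so the fundamental theorem below asks for no differentiability. *)
Definition slope_selection (h g : R -> R) (D : set R) :=
  forall x y, D x -> D y -> h y <= h x + g x * (y - x).

Lemma slope_selection_le h g D x y : slope_selection h g D ->
  D x -> D y -> x <= y -> g y <= g x.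
Proof.
move=> H Dx Dy; rewrite le_eqVlt => /predU1P[->//|xy].
have := H _ _ Dx Dy; have := H _ _ Dy Dx => h1 h2.
have : 0 <= (g x - g y) * (y - x) by lra.
by rewrite pmulr_lge0 ?subr_gt0// subr_ge0.
Qed.

Lemma slope_selectionS h g (D D' : set R) : D' `<=` D ->
  slope_selection h g D -> slope_selection h g D'.
Proof. by move=> DD H x y /DD Dx /DD; exact: H. Qed.

Lemma slope_selection_integrable h g a b :
  measurable_fun `[a, b] g -> slope_selection h g `[a, b] ->
  leb.-integrable `[a, b] (EFin \o g).
Proof.
move=> mg H; apply: measurable_bounded_integrable => //.
  by rewrite /= lebesgue_measure_itv/=; case: ifP => // _; rewrite -EFinB ltry.
exists (`|g a| + `|g b|); split => // r Mr x /= xab.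
apply/ltW/(le_lt_trans _ Mr).
move: (xab); rewrite in_itv/= => /andP[ax xb].
have [aab bab] : `[a, b]%classic a /\ `[a, b]%classic b.
  by rewrite /= !in_itv/= !lexx/= (le_trans ax xb).
have := slope_selection_le H aab xab ax; have := slope_selection_le H xab bab xb.
have := ler_norm (g a); have := ler_norm (- g b); rewrite normrN.
by rewrite ler_norml => ? ? ? ?; apply/andP; split; have := normr_ge0 (g a); have := normr_ge0 (g b); lra.
Qed.

(** The increment of [h] over [[s, t]] and the integral of [g] over it both lie between
    [g t * (t - s)] and [g s * (t - s)], so their difference satisfies the hypothesis of
    [constant_of_modulus]. *)
Lemma slope_selection_Rintegral h g a b : a <= b ->
  measurable_fun `[a, b] g -> slope_selection h g `[a, b] ->
  (\int[leb]_(x in `[a, b]) g x)%R = h b - h a.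
Proof.
move=> ab mg H; have ig := slope_selection_integrable mg H.
pose E t := h t - (\int[leb]_(x in `[a, t]) g x)%R.
suff : E b = E a by rewrite /E set_itv1 Rintegral_set1; lra.
apply: (@constant_of_modulus g E a b ab) => s t as_ st tb.
have mst : {subset `[s, t] <= `[a, b]}.
  by move=> x; rewrite !in_itv/= => /andP[? ?]; apply/andP; split; lra.
have ist : leb.-integrable `[s, t] (EFin \o g).
  by apply: integrableS ig => //; exact: mst.
have Ds : `[a, b]%classic s by rewrite /= in_itv/=; apply/andP; split; lra.
have Dt : `[a, b]%classic t by rewrite /= in_itv/=; apply/andP; split; lra.
have iat : leb.-integrable `[a, t] (EFin \o g).
  apply: integrableS ig => //; move=> x /=; rewrite !in_itv/= => /andP[? ?].
  by apply/andP; split; lra.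
have split_int : (\int[leb]_(x in `[a, t]) g x)%R - (\int[leb]_(x in `[a, s]) g x)%R =
    (\int[leb]_(x in `[s, t]) g x)%R.
  rewrite (Rintegral_itvB iat) ?bnd_simp//.
  by rewrite Rintegral_itv_obnd_cbnd//; apply: integrableS ist => //; exact: subset_itv_oc_cc.
have cst_int (c : R) : (\int[leb]_(x in `[s, t]) c)%R = c * (t - s).
  rewrite Rintegral_cst//= lebesgue_measure_itv/=.
  move: st; rewrite le_eqVlt lte_fin => /predU1P[->|->]; last by [].
  by rewrite ltxx subrr.
have icst (c : R) : leb.-integrable `[s, t] (EFin \o (fun=> c)).
  apply: measurable_bounded_integrable => //.
    by rewrite /= lebesgue_measure_itv/=; case: ifP => // _; rewrite -EFinB ltry.
  exact: bounded_cst.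
have up : (\int[leb]_(x in `[s, t]) g x)%R <= g s * (t - s).
  rewrite -cst_int; apply: le_Rintegral; [by []|exact: ist|exact: icst|].
  move=> x xst; apply: (slope_selection_le H) => //; first exact: mst.
  by move: xst; rewrite /= in_itv/= => /andP[].
have lo : g t * (t - s) <= (\int[leb]_(x in `[s, t]) g x)%R.
  rewrite -cst_int; apply: le_Rintegral; [by []|exact: icst|exact: ist|].
  move=> x xst; apply: (slope_selection_le H) => //; first exact: mst.
  by move: xst; rewrite /= in_itv/= => /andP[].
move: split_int up lo (H _ _ Ds Dt) (H _ _ Dt Ds); rewrite /E ler_norml {E}.
move: (\int[leb]_(x in `[a, t]) g x)%R (\int[leb]_(x in `[a, s]) g x)%R => It Is <-.
by move=> ? ? ? ?; apply/andP; split; lra.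
Qed.

Lemma slope_selection_integral h g a b : a <= b ->
  measurable_fun `[a, b] g -> slope_selection h g `[a, b] ->
  (\int[leb]_(x in `[a, b]) (g x)%:E = (h b - h a)%:E)%E.
Proof.
move=> ab mg H; rewrite -(slope_selection_Rintegral ab mg H).
rewrite /Rintegral fineK//.
exact: integrable_fin_num (slope_selection_integrable mg H).
Qed.

End supergradient_integral.

(** * Exhaustion of open intervals; positive and negative parts of a slope *)

Section interval_exhaustion.
Context {R : realType}.
Notation leb := (@lebesgue_measure R).
Implicit Types (h g : R -> R) (a b : R).

Lemma open_interval_itv (J : set R) : open J -> is_interval J ->
  has_lbound J -> has_ubound J -> J = `]inf J, sup J[%classic.
Proof.
move=> oJ iJ lJ uJ; have /interior_id := oJ.
by rewrite interval_bounded_interior// => <-.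
Qed.

(** Monotone convergence along compact subintervals. The bound is asked only on some larger compact
    interval [[s', t']]: this lets the end points be moved to places with extra properties, such as
    regularity or small height, that are available only almost everywhere or close to the ends. *)
Lemma integral_oo_le (F : R -> \bar R) a b (K : \bar R) : (0 <= K)%E ->
  measurable_fun `]a, b[ F -> (forall x, x \in `]a, b[ -> 0 <= F x)%E ->
  (forall s t, a < s -> s <= t -> t < b -> exists s' t',
    [/\ a < s', s' <= s, t <= t', t' < b &
     (\int[leb]_(x in `[s', t']) F x <= K)%E]) ->
  (\int[leb]_(x in `]a, b[) F x <= K)%E.
Proof.
move=> K0 mF F0 H.
pose I n := `[a + n.+1%:R^-1, b - n.+1%:R^-1]%classic.
have Iab n : I n `<=` `]a, b[.
  move=> x; rewrite /I /= !in_itv/=.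
  have : 0 < n.+1%:R^-1 :> R by rewrite invr_gt0 ltr0n.
  by move: (n.+1%:R^-1) => e ? /andP[? ?]; apply/andP; split; lra.
have -> : `]a, b[%classic = \bigcup_n I n.
  apply/seteqP; split => x /=; last by case=> n _ /Iab.
  rewrite in_itv/= => /andP[ax xb].
  have e0 : 0 < Num.min (x - a) (b - x) by rewrite lt_min !subr_gt0 ax.
  have [n] := ltr_add_invr e0; rewrite add0r lt_min => /andP[h1 h2].
  exists n => //; rewrite /I /= in_itv/=; move: (n.+1%:R^-1) h1 h2 => e ? ?.
  by apply/andP; split; lra.
have mI n : measurable (I n) by exact: measurable_itv.
have cvI : (\int[leb]_(x in I i) F x)%E @[i --> \oo] -->
    (\int[leb]_(x in \bigcup_i I i) F x)%E.
  apply: ge0_nondecreasing_set_cvg_integral => //.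
  - move=> n m nm; rewrite subsetEset => x; rewrite /I /= !in_itv/=.
    have : m.+1%:R^-1 <= n.+1%:R^-1 :> R by rewrite lef_pV2 ?posrE ?ltr0n// ler_nat.
    by move: (m.+1%:R^-1) (n.+1%:R^-1) => d e ? /andP[? ?]; apply/andP; split; lra.
  - by move=> n; apply: measurable_funS mF.
  - by move=> n x /Iab; exact: F0.
apply: cvge_le cvI; near=> n.
have [le_ab|gt_ab] := leP (a + n.+1%:R^-1) (b - n.+1%:R^-1); last first.
  by rewrite /I set_itv_ge ?bnd_simp -?ltNge// integral_set0.
have n0 : 0 < n.+1%:R^-1 :> R by rewrite invr_gt0 ltr0n.
have [||s' [t' [as' s's tt' t'b Kst]]] := H _ _ _ le_ab.
- by rewrite ltrDl.
- by rewrite gtrBl.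
have Ist : `[s', t'] `<=` (`]a, b[ : set R).
  by move=> x /=; rewrite !in_itv/= => /andP[? ?]; apply/andP; split; lra.
apply: le_trans Kst; apply: ge0_subset_integral => //.
- exact: mI.
- by apply: measurable_funS mF.
- by move=> x /Ist; exact: F0.
- move=> x; rewrite /I /= !in_itv/= => /andP[h1 h2].
  by rewrite (le_trans s's h1) (le_trans h2 tt').
Unshelve. all: by end_near. Qed.

Definition pos (r : R) := Num.max r 0.
Definition neg (r : R) := Num.max (- r) 0.

Lemma pos_ge0 r : 0 <= pos r. Proof. by rewrite le_max lexx orbT. Qed.
Lemma neg_ge0 r : 0 <= neg r. Proof. by rewrite le_max lexx orbT. Qed.
Lemma posBneg r : r = pos r - neg r.
Proof. by rewrite /pos /neg !maxEle; case: leP => ?; case: leP => ?; lra. Qed.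
Lemma posDneg r : `|r| = pos r + neg r.
Proof. by rewrite /pos /neg !maxEle; case: leP => ?; case: leP => ?; have [?|?] := ger0P r; lra. Qed.

Lemma measurable_pos d (T : measurableType d) (D : set T) (f : T -> R) :
  measurable_fun D f -> measurable_fun D (pos \o f).
Proof. by move=> mf; apply: measurable_maxr => //; exact: measurable_cst. Qed.

Lemma measurable_neg d (T : measurableType d) (D : set T) (f : T -> R) :
  measurable_fun D f -> measurable_fun D (neg \o f).
Proof.
by move=> mf; apply: measurable_maxr; [exact/measurable_funN|exact: measurable_cst].
Qed.

(** The running maximum of a concave function follows it while it increases and is constant
    afterwards. It is again concave, with [pos \o g] as slopes, and so the fundamental theorem
    evaluates the integral of [pos \o g]. *)
Lemma slope_selection_pos h g a b : slope_selection h g `[a, b] ->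
  slope_selection (fun x => sup [set h y | y in `[a, x]]) (pos \o g) `[a, b].
Proof.
move=> H x y xab yab /=.
have inab z : `[a, b]%classic z -> a <= z /\ z <= b by rewrite /= in_itv/= => /andP.
have [ax xb] := inab _ xab; have [ay yb] := inab _ yab.
have toab z : a <= z -> z <= b -> `[a, b]%classic z by move=> ? ?; rewrite /= in_itv/=; apply/andP.
have ub z : a <= z -> z <= b -> has_ubound [set h y | y in `[a, z]].
  move=> az zb; exists (h a + `|g a| * (b - a)) => _ /= [w + <-]; rewrite in_itv/= => /andP[aw wz].
  have aab : `[a, b]%classic a by apply: toab; lra.
  have wab : `[a, b]%classic w by apply: toab; lra.
  have := H _ _ aab wab; have := ler_norm (g a).
  have : `|g a| * (w - a) <= `|g a| * (b - a) by rewrite ler_wpM2l//; lra.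
  have w0 : 0 <= w - a by lra.
  by have := ler_wpM2r w0 (ler_norm (g a)); lra.
have ne z : a <= z -> [set h y | y in `[a, z]] !=set0.
  by move=> az; exists (h a), a => //=; rewrite in_itv/= lexx.
have sup_ge z w : a <= w -> w <= z -> z <= b -> h w <= sup [set h y | y in `[a, z]].
  move=> aw wz zb; apply: ub_le_sup; first by apply: ub => //; lra.
  by exists w => //=; rewrite in_itv/= aw.
have p0 := pos_ge0 (g x).
apply: ge_sup; first exact: ne.
move=> _ /= [w + <-]; rewrite in_itv/= => /andP[aw wy].
have wab : `[a, b]%classic w by apply: toab; lra.
have [wx|xw] := leP w x.
  have [yx|xy] := leP x y.
    have := sup_ge x w aw wx xb.
    have : 0 <= pos (g x) * (y - x) by rewrite mulr_ge0//; lra.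
    by lra.
  have [g0|g0] := leP (g x) 0.
    have -> : pos (g x) = 0 by rewrite /pos; apply/max_idPr.
    by rewrite mul0r addr0; exact: sup_ge.
  have -> : pos (g x) = g x by rewrite /pos; apply/max_idPl/ltW.
  have gy : 0 <= g y.
    by apply: le_trans (slope_selection_le H yab xab (ltW xy)); exact: ltW.
  have := H _ _ yab wab; have := H _ _ xab yab => h1 h2.
  have := sup_ge x x ax (lexx _) xb.
  have : 0 <= g y * (y - w) by rewrite mulr_ge0//; lra.
  by lra.
have := sup_ge x x ax (lexx _) xb; have := H _ _ xab wab => h1 h2.
have h3 : g x * (w - x) <= pos (g x) * (w - x).
  by rewrite ler_wpM2r ?le_max ?lexx//; lra.
have h4 : pos (g x) * (w - x) <= pos (g x) * (y - x) by rewrite ler_wpM2l//; lra.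
by lra.
Qed.

Lemma integral_pos_le h g a b m M : a <= b -> measurable_fun `[a, b] g ->
  slope_selection h g `[a, b] -> (forall x, x \in `[a, b] -> m <= h x <= M) ->
  (\int[leb]_(x in `[a, b]) (pos (g x))%:E <= (M - m)%:E)%E.
Proof.
move=> ab mg H hmM.
rewrite (slope_selection_integral ab _ (slope_selection_pos H)); last first.
  exact: measurable_pos.
have aab : a \in `[a, b] by rewrite in_itv/= lexx.
rewrite lee_fin set_itv1 image_set1 sup1 lerB//; last by have /andP[] := hmM _ aab.
apply: ge_sup; first by exists (h a), a.
by move=> _ /= [x + <-] => /hmM/andP[].
Qed.

(** The fundamental theorem for [g = pos g - neg g], arranged without subtraction for use in the
    extended reals. *)
Lemma integral_pos_neg h g a b : a <= b -> measurable_fun `[a, b] g ->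
  slope_selection h g `[a, b] ->
  ((h a)%:E + \int[leb]_(x in `[a, b]) (pos (g x))%:E =
   (h b)%:E + \int[leb]_(x in `[a, b]) (neg (g x))%:E)%E.
Proof.
move=> ab mg H.
have ip : leb.-integrable `[a, b] (EFin \o (pos \o g)).
  exact: slope_selection_integrable (measurable_pos mg) (slope_selection_pos H).
have ig := slope_selection_integrable mg H.
have in_ : leb.-integrable `[a, b] (EFin \o (neg \o g)).
  have -> : EFin \o (neg \o g) = ((EFin \o (pos \o g)) \- (EFin \o g))%E.
    by apply/funext => x /=; rewrite -EFinB; congr EFin; rewrite [X in _ - X]posBneg; ring.
  exact: integrableB.
have := slope_selection_Rintegral ab mg H.
under eq_Rintegral => x _ do rewrite (posBneg (g x)).
rewrite RintegralB// => E.
have fp : (\int[leb]_(x in `[a, b]) (pos (g x))%:E)%E \is a fin_num.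
  exact: integrable_fin_num ip.
have fn : (\int[leb]_(x in `[a, b]) (neg (g x))%:E)%E \is a fin_num.
  exact: integrable_fin_num in_.
rewrite -(fineK fp) -(fineK fn) -!EFinD; congr EFin.
by rewrite /Rintegral in E; rewrite /= in E *; lra.
Qed.

Lemma integral_neg_le h g a b m M : a <= b -> measurable_fun `[a, b] g ->
  slope_selection h g `[a, b] -> (forall x, x \in `[a, b] -> m <= h x <= M) ->
  (\int[leb]_(x in `[a, b]) (neg (g x))%:E <= (M - m)%:E)%E.
Proof.
move=> ab mg H hmM.
have aab : a \in `[a, b] by rewrite in_itv/= lexx.
have bab : b \in `[a, b] by rewrite in_itv/= lexx andbT.
have := integral_pos_neg ab mg H.
rewrite (slope_selection_integral ab _ (slope_selection_pos H)); last first.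
  exact: measurable_pos.
have sM : sup [set h y | y in `[a, b]] <= M.
  apply: ge_sup; first by exists (h a), a.
  by move=> _ /= [x + <-] => /hmM/andP[].
rewrite set_itv1 image_set1 sup1.
have := slope_selection_integrable (measurable_pos mg) (slope_selection_pos H).
case: (\int[leb]_(x in _) (neg _)%:E)%E => [r _| _ //|_ //].
  rewrite -!EFinD => -[E]; have /andP[_ +] := hmM _ aab; have /andP[+ _] := hmM _ bab.
  by rewrite lee_fin; lra.
Qed.

End interval_exhaustion.

(** * The product measure on the plane *)

Notation leb2 := (@lebesgue_measure _ \x @lebesgue_measure _)%E.

Section plane.
Context {R : realType}.
Notation leb := (@lebesgue_measure R).
Implicit Types (A : set (R * R)) (x y : R * R).

Lemma plane_interiorP A x : interior A x <-> exists2 e : R, 0 < e &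
  forall y, `|y.1 - x.1| < e -> `|y.2 - x.2| < e -> A y.
Proof.
split=> [/nbhs_ballP[e /= e0 H]|[e e0 H]].
  exists e => // y y1 y2; apply: H; split; rewrite /ball /= distrC//.
apply/nbhs_ballP; exists e => //= y [y1 y2].
by apply: H; rewrite distrC.
Qed.

Lemma plane_openP A : open A <-> forall x, A x -> exists2 e : R, 0 < e &
  forall y, `|y.1 - x.1| < e -> `|y.2 - x.2| < e -> A y.
Proof.
rewrite openE; split => H x /H /plane_interiorP; exact.
Qed.

(** Measurability refers to the product structure on the plane, so an open set is exhibited as a
    countable union of boxes with rational centres. *)
Lemma plane_open_measurable A : open A -> measurable A.
Proof.
move=> /plane_openP oA.
pose B (q : rat * rat * nat) : set (R * R) :=
  ball (ratr q.1.1 : R) (q.2.+1%:R^-1) `*` ball (ratr q.1.2 : R) (q.2.+1%:R^-1).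
pose P (q : rat * rat * nat) := B q `<=` A.
have -> : A = \bigcup_(q in P) B q.
  apply/seteqP; split=> [x Ax|x [q Pq Bq]]; last exact: Pq.
  have [e e0 H] := oA _ Ax.
  have [n] := ltr_add_invr (divr_gt0 e0 (ltr0n _ 2)); rewrite add0r => ne.
  have n0 : 0 < n.+1%:R^-1 :> R by rewrite invr_gt0 ltr0n.
  have rat_near (r : R) : exists q : rat, `|ratr q - r| < n.+1%:R^-1.
    have : r - n.+1%:R^-1 < r + n.+1%:R^-1 by move: n0; move: (_^-1) => d ?; lra.
    move=> /rat_in_itvoo[q]; rewrite in_itv/= => /andP[h1 h2]; exists q.
    by rewrite ltr_distl h1 h2.
  have [q1 h1] := rat_near x.1; have [q2 h2] := rat_near x.2.
  exists (q1, q2, n); last by split.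
  move=> y [/= ]; rewrite /ball /= => y1 y2.
  move: n0 ne h1 h2 y1 y2; move: (n.+1%:R^-1) => d d0 de.
  rewrite !ltr_distl => /andP[? ?] /andP[? ?] /andP[? ?] /andP[? ?].
  by apply: H; rewrite ltr_distl; apply/andP; split; lra.
rewrite bigcup_mkcond; apply: countable_bigcupT_measurable => // q.
by case: ifPn => // _; apply: measurableX; exact: measurable_ball.
Qed.

Lemma plane_closed_measurable A : closed A -> measurable A.
Proof.
move=> cA; rewrite -(setCK A); apply: measurableC; apply: plane_open_measurable.
exact: closed_openC.
Qed.

Definition hsec A (t : R) : set R := [set s : R | A (s, t)].
Definition vsec A (s : R) : set R := [set t : R | A (s, t)].

Lemma hsec_open A t : open A -> open (hsec A t).
Proof.
move=> /plane_openP oA; rewrite openE => s /= /oA[e e0 H].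
apply/nbhs_ballP; exists e => //= z sz; apply: H; first by rewrite distrC.
by rewrite /= subrr normr0.
Qed.

Lemma vsec_open A s : open A -> open (vsec A s).
Proof.
move=> /plane_openP oA; rewrite openE => t /= /oA[e e0 H].
apply/nbhs_ballP; exists e => //= z tz; apply: H; last by rewrite distrC.
by rewrite /= subrr normr0.
Qed.

Lemma hsecE A t : hsec A t = ysection A t.
Proof. by apply/funext => s; apply/propext; rewrite /ysection /hsec /= inE. Qed.

Lemma vsecE A s : vsec A s = xsection A s.
Proof. by apply/funext => t; apply/propext; rewrite /xsection /vsec /= inE. Qed.

Lemma patch_hsec T (d : R * R -> T) (F : R * R -> T) A s t :
  patch (fun s => d (s, t)) (hsec A t) (fun s => F (s, t)) s = patch d A F (s, t).
Proof.
rewrite /patch; suff -> : (s \in hsec A t) = ((s, t) \in A) by [].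
by apply/idP/idP; rewrite !inE.
Qed.

Lemma patch_vsec T (d : R * R -> T) (F : R * R -> T) A s t :
  patch (fun t => d (s, t)) (vsec A s) (fun t => F (s, t)) t = patch d A F (s, t).
Proof.
rewrite /patch; suff -> : (t \in vsec A s) = ((s, t) \in A) by [].
by apply/idP/idP; rewrite !inE.
Qed.

Lemma measurable_hsec A t : measurable A -> measurable (hsec A t).
Proof. by move=> mA; rewrite hsecE; exact: measurable_ysection. Qed.

Lemma measurable_vsec A s : measurable A -> measurable (vsec A s).
Proof. by move=> mA; rewrite vsecE; exact: measurable_xsection. Qed.

Lemma measurable_fun_hsec (F : R * R -> \bar R) A t : measurable A ->
  measurable_fun A F -> measurable_fun (hsec A t) (fun s => F (s, t)).
Proof.
move=> mA /(measurable_restrictT _ mA) mF.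
apply/(measurable_restrictT _ (measurable_hsec t mA)).
have -> : (fun s => F (s, t)) \_ (hsec A t) = (F \_ A) \o (fun s => (s, t)).
  by apply/funext => s; exact: patch_hsec.
by apply: measurableT_comp => //; exact: pair2_measurable.
Qed.

Lemma measurable_fun_vsec (F : R * R -> \bar R) A s : measurable A ->
  measurable_fun A F -> measurable_fun (vsec A s) (fun t => F (s, t)).
Proof.
move=> mA /(measurable_restrictT _ mA) mF.
apply/(measurable_restrictT _ (measurable_vsec s mA)).
have -> : (fun t => F (s, t)) \_ (vsec A s) = (F \_ A) \o (fun t => (s, t)).
  by apply/funext => t; exact: patch_vsec.
by apply: measurableT_comp => //; exact: pair1_measurable.
Qed.

Lemma tonelli_hsec (F : R * R -> \bar R) A : measurable A ->
  measurable_fun A F -> (forall x, A x -> 0 <= F x)%E ->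
  (\int[leb2]_(x in A) F x = \int[leb]_t \int[leb]_(s in hsec A t) F (s, t))%E.
Proof.
move=> mA mF F0; rewrite integral_mkcond fubini_tonelli2.
- apply: eq_integral => t _; rewrite /fubini_G [RHS]integral_mkcond.
  by apply: eq_integral => s _; exact/esym/patch_hsec.
- exact/(measurable_restrictT _ mA).
- by move=> x; apply: erestrict_ge0 => y; exact: F0.
Qed.

Lemma tonelli_vsec (F : R * R -> \bar R) A : measurable A ->
  measurable_fun A F -> (forall x, A x -> 0 <= F x)%E ->
  (\int[leb2]_(x in A) F x = \int[leb]_s \int[leb]_(t in vsec A s) F (s, t))%E.
Proof.
move=> mA mF F0; rewrite integral_mkcond fubini_tonelli1.
- apply: eq_integral => t _; rewrite /fubini_F [RHS]integral_mkcond.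
  by apply: eq_integral => s _; exact/esym/patch_vsec.
- exact/(measurable_restrictT _ mA).
- by move=> x; apply: erestrict_ge0 => y; exact: F0.
Qed.

Lemma measurable_tonelli_hsec (F : R * R -> \bar R) A : measurable A ->
  measurable_fun A F -> (forall x, A x -> 0 <= F x)%E ->
  measurable_fun setT (fun t => \int[leb]_(s in hsec A t) F (s, t))%E.
Proof.
move=> mA mF F0.
have -> : (fun t => \int[leb]_(s in hsec A t) F (s, t))%E = fubini_G leb (F \_ A).
  apply/funext => t; rewrite /fubini_G [LHS]integral_mkcond.
  by apply: eq_integral => s _; exact/esym/patch_hsec.
apply: measurable_fun_fubini_tonelli_G.
- exact/(measurable_restrictT _ mA).
- by move=> x; apply: erestrict_ge0 => y; exact: F0.
Qed.

Lemma measurable_tonelli_vsec (F : R * R -> \bar R) A : measurable A ->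
  measurable_fun A F -> (forall x, A x -> 0 <= F x)%E ->
  measurable_fun setT (fun s => \int[leb]_(t in vsec A s) F (s, t))%E.
Proof.
move=> mA mF F0.
have -> : (fun s => \int[leb]_(t in vsec A s) F (s, t))%E = fubini_F leb (F \_ A).
  apply/funext => t; rewrite /fubini_F [LHS]integral_mkcond.
  by apply: eq_integral => s _; exact/esym/patch_vsec.
apply: measurable_fun_fubini_tonelli_F.
- exact/(measurable_restrictT _ mA).
- by move=> x; apply: erestrict_ge0 => y; exact: F0.
Qed.

End plane.

(** * Shears and rotations preserve area *)

Section measure_preserving.
Context {R : realType}.
Notation leb := (@lebesgue_measure R).

Lemma lebesgue_measure_shift (k : R) (A : set R) : measurable A ->
  leb ((fun s => s + k) @^-1` A) = leb A.
Proof.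
move=> mA.
have mk : measurable_fun setT ((fun s => s + k) : R -> measurableTypeR R).
  by apply: measurable_funD => //; exact: measurable_cst.
rewrite -[LHS]/(pushforward leb ((fun s => s + k) : _ -> measurableTypeR R) A).
apply/esym/lebesgue_measure_unique => //= _ [[a b]] _ <-.
rewrite /pushforward /=.
rewrite (_ : _ @^-1` _ = `]a - k, b - k]%classic); last first.
  by apply/seteqP; split => s /=; rewrite !in_itv/= => /andP[? ?]; apply/andP; split; lra.
rewrite !lebesgue_measure_itv/= !lte_fin; have -> : (a - k < b - k) = (a < b) by apply/idP/idP => ?; lra.
by case: ifP => // _; rewrite -!EFinB; congr EFin; lra.
Qed.

Definition plane_preserving (T : R * R -> R * R) :=
  measurable_fun setT T /\ forall A, measurable A -> leb2 (T @^-1` A) = leb2 A.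

Lemma plane_preserving_comp T1 T2 : plane_preserving T1 -> plane_preserving T2 ->
  plane_preserving (T1 \o T2).
Proof.
move=> [m1 H1] [m2 H2]; split; first exact: measurableT_comp.
move=> A mA; rewrite comp_preimage H2 ?H1//.
by rewrite -[X in measurable X]setTI; exact: m1.
Qed.

Lemma measurable_pairR (f g : R * R -> R) : measurable_fun setT f -> measurable_fun setT g ->
  measurable_fun setT (fun x => (f x, g x)).
Proof. by move=> mf mg; exact: measurable_fun_pair. Qed.

Lemma plane_preserving_vshear k : plane_preserving (fun x => (x.1, x.2 + k * x.1)).
Proof.
have mT : measurable_fun setT (fun x : R * R => (x.1, x.2 + k * x.1)).
  apply: measurable_pairR; first exact: measurable_fst.
  apply: measurable_funD; first exact: measurable_snd.
  by apply: measurable_funM; [exact: measurable_cst|exact: measurable_fst].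
split => // A mA; rewrite /product_measure1 /=; apply: eq_integral => s _ /=.
rewrite -!vsecE -(lebesgue_measure_shift (k * s) (measurable_vsec s mA)).
by congr (leb _).
Qed.

Lemma plane_preserving_hshear k : plane_preserving (fun x => (x.1 + k * x.2, x.2)).
Proof.
have mT : measurable_fun setT (fun x : R * R => (x.1 + k * x.2, x.2)).
  apply: measurable_pairR; last exact: measurable_snd.
  apply: measurable_funD; first exact: measurable_fst.
  by apply: measurable_funM; [exact: measurable_cst|exact: measurable_snd].
split => // A mA.
have E (B : set (R * R)) : measurable B -> leb2 B = (\int[leb]_t leb (hsec B t))%E.
  move=> mB; rewrite -[LHS]mul1e -integral_cst// tonelli_hsec//.
    by apply: eq_integral => t _; rewrite integral_cst ?mul1e//; exact: measurable_hsec.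
rewrite !E//; last by rewrite -[X in measurable X]setTI; exact: mT.
apply: eq_integral => t _ /=.
rewrite -(lebesgue_measure_shift (k * t) (measurable_hsec t mA)).
by congr (leb _).
Qed.

Definition rotation (c s : R) (x : R * R) : R * R := (c * x.1 - s * x.2, s * x.1 + c * x.2).

(** A rotation is a product of three shears, horizontal, vertical, horizontal; the horizontal
    coefficient [- s / (1 + c)] is minus the tangent of the half angle. The half turn [c = -1]
    escapes this formula and is obtained as a quarter turn applied twice. *)
Lemma plane_preserving_rotation c s : c ^+ 2 + s ^+ 2 = 1 ->
  plane_preserving (rotation c s).
Proof.
have rot_ne c' s' : c' ^+ 2 + s' ^+ 2 = 1 -> 1 + c' != 0 ->
    plane_preserving (rotation c' s').
  move=> cs c0; pose k := - s' / (1 + c').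
  have -> : rotation c' s' = (fun x => (x.1 + k * x.2, x.2)) \o
      ((fun x => (x.1, x.2 + s' * x.1)) \o (fun x => (x.1 + k * x.2, x.2))).
    apply/funext => x; rewrite /rotation /comp /=.
    have ks : 1 + k * s' = c'.
      have : (1 + c') * (1 + k * s' - c') = 0.
        rewrite /k; have -> : (1 + c') * (1 + - s' / (1 + c') * s' - c') =
          1 - (c' ^+ 2 + s' ^+ 2) by field.
        by rewrite cs subrr.
      by move/eqP; rewrite mulf_eq0 (negbTE c0)/= subr_eq0 => /eqP.
    have kc : k * c' = - s' - k by rewrite /k; field.
    congr pair.
    + rewrite -{1}ks; have -> : x.1 + k * x.2 + k * (x.2 + s' * (x.1 + k * x.2)) =
        (1 + k * s') * x.1 + (k + k * (1 + k * s')) * x.2 by ring.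
      by rewrite ks kc; ring.
    + rewrite -{1}ks; ring.
  apply: plane_preserving_comp; first exact: plane_preserving_hshear.
  apply: plane_preserving_comp; first exact: plane_preserving_vshear.
  exact: plane_preserving_hshear.
move=> cs; have [c0|] := eqVneq (1 + c) 0; last exact: rot_ne.
have -> : rotation c s = rotation 0 1 \o rotation 0 1.
  have cN : c = -1 by lra.
  have s0 : s = 0 by apply/eqP; rewrite -sqrf_eq0; apply/eqP; move: cs; rewrite cN; lra.
  by apply/funext => x; rewrite /rotation /comp cN s0 /=; congr pair; ring.
have h : plane_preserving (rotation 0 1).
  by apply: rot_ne; rewrite ?addr0 ?oner_neq0// expr0n expr1n add0r.
exact: plane_preserving_comp.
Qed.

Lemma plane_preserving_integral T (A : set (R * R)) (F : R * R -> \bar R) :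
  plane_preserving T -> measurable A -> measurable_fun A F ->
  (forall x, A x -> 0 <= F x)%E ->
  (\int[leb2]_(x in T @^-1` A) F (T x) = \int[leb2]_(x in A) F x)%E.
Proof.
move=> [mT HT] mA mF F0.
pose X := (measurableTypeR R * measurableTypeR R)%type.
pose T' : X -> X := T.
have mT' : measurable_fun setT T' by exact: mT.
transitivity (\int[pushforward leb2 T']_(y in A) F y)%E.
  by rewrite ge0_integral_pushforward// => x; rewrite inE; exact: F0.
apply: eq_measure_integral => //= B mB _.
exact: HT.
Qed.

End measure_preserving.

(** * Planar concave functions and their gradients *)

Section planar_convexity.
Context {R : realType}.
Implicit Types (A : set (R * R)) (u : R * R -> R) (x y d : R * R) (s t : R).

Definition mv x d t : R * R := (x.1 + t * d.1, x.2 + t * d.2).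
Definition seg x y t : R * R := mv x (y.1 - x.1, y.2 - x.2) t.

Definition cvx A := forall x y t, A x -> A y -> 0 <= t -> t <= 1 -> A (seg x y t).
Definition ccv A u := forall x y t, A x -> A y -> 0 <= t -> t <= 1 ->
  u x + t * (u y - u x) <= u (seg x y t).

Lemma seg_mv x d s t : seg x (mv x d s) t = mv x d (t * s).
Proof. by rewrite /seg /mv /=; congr pair; ring. Qed.

Lemma seg1 x y : seg x y 1 = y.
Proof. by rewrite /seg /mv /= !mul1r !(addrC x.1) !(addrC x.2) !subrK -surjective_pairing. Qed.

Lemma mv0 x d : mv x d 0 = x.
Proof. by rewrite /mv !mul0r !addr0 -surjective_pairing. Qed.

Lemma convN_seg x y (p : {i01 R}) :
  conv p (x : convex_lmodType (R * R)%type) y = seg y x p%:num.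
Proof.
rewrite /conv /= /seg /mv; case: x y => [x1 x2] [y1 y2] /=.
move: p%:num => q; apply/eqP; rewrite xpair_eqE; apply/andP; split; apply/eqP.
  by rewrite -[LHS]/(q * x1 + (1 - q) * y1); ring.
by rewrite -[LHS]/(q * x2 + (1 - q) * y2); ring.
Qed.

Lemma convex_setE A : convex_set A <-> cvx A.
Proof.
split=> [H x y t Ax Ay t0 t1|H x y p].
  have := H y x (Itv01 t0 t1); rewrite !inE convN_seg; exact.
by rewrite !inE convN_seg => Ax Ay; apply: H.
Qed.

Lemma concave_functionE A u : concave_function A u <-> ccv A u.
Proof.
split=> [H x y t Ax Ay t0 t1|H p x y].
  have := H (Itv01 t0 t1) y x; rewrite !inE convN_seg convRE /= /unstable.onem => /(_ Ay Ax).
  by move: (u (seg x y t)) => w; lra.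
rewrite !inE convN_seg => Ax Ay; rewrite convRE /unstable.onem.
have p0 : (0 : R) <= p%:num by exact: ge0.
have p1 : p%:num <= (1 : R) by exact: le1.
by have := H y x p%:num Ay Ax p0 p1; move: p%:num => q; lra.
Qed.

End planar_convexity.

Section concave_planar.
Context {R : realType}.
Variables (Om : set (R * R)) (u : R * R -> R).
Hypotheses (cO : cvx Om) (cu : ccv Om u).
Implicit Types (x y d : R * R) (s t e : R).

Lemma interior_seg x y t : Om° x -> Om y -> 0 <= t -> t < 1 -> Om° (seg x y t).
Proof.
move=> /plane_interiorP[e e0 H] Oy t0 t1; apply/plane_interiorP.
have t1' : 0 < 1 - t by rewrite subr_gt0.
exists (e * (1 - t)); first exact: mulr_gt0.
move=> z z1 z2; set p := seg x y t in z1 z2.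
(* The homothety with centre [y] and ratio [1 - t] maps [x] to [p]; [x'] is the preimage of [z]
   under it. *)
pose x' : R * R := (x.1 + (z.1 - p.1) / (1 - t), x.2 + (z.2 - p.2) / (1 - t)).
have Ox' : Om x'.
  by apply: H; rewrite /x' /= addrC addKr normrM normfV (gtr0_norm t1') ltr_pdivrMr.
have -> : z = seg x' y t.
  have tn : 1 - t != 0 by rewrite gt_eqF.
  by rewrite [LHS]surjective_pairing /seg /mv /x' /p /seg /mv /=; congr pair; field.
by apply: cO => //; exact: ltW.
Qed.

Lemma interiorW x : Om° x -> Om x.
Proof. exact: interior_subset. Qed.

Lemma interior_cvx : cvx Om°.
Proof.
move=> x y t Ix Iy t0; rewrite le_eqVlt => /predU1P[->|t1]; first by rewrite seg1.
by apply: interior_seg => //; exact: interiorW.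
Qed.

Lemma mv_near x d : Om° x -> exists2 e, 0 < e & forall s, `|s| < e -> Om° (mv x d s).
Proof.
have /plane_openP oI := open_interior Om.
move=> /oI[e e0 H].
have D0 : 0 < 1 + `|d.1| + `|d.2| by rewrite -addrA ltr_pwDl// addr_ge0.
exists (e / (1 + `|d.1| + `|d.2|)); first exact: divr_gt0.
move=> s; rewrite ltr_pdivlMr// => se; apply: H; rewrite /mv /= addrC addKr normrM;
  apply: le_lt_trans se; rewrite ler_wpM2l//.
  by rewrite addrAC lerDr addr_ge0.
by rewrite lerDr addr_ge0.
Qed.

Lemma slope_le x d s t : Om x -> Om (mv x d t) -> 0 < s -> s <= t ->
  (u (mv x d t) - u x) / t <= (u (mv x d s) - u x) / s.
Proof.
move=> Ox Ot s0 st; have t0 := lt_le_trans s0 st.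
have h0 : 0 <= s / t by rewrite divr_ge0// ltW.
have h1 : s / t <= 1 by rewrite ler_pdivrMr// mul1r.
have := cu Ox Ot h0 h1; rewrite seg_mv divfK ?gt_eqF// => H.
rewrite ler_pdivlMr//.
have -> : (u (mv x d t) - u x) / t * s = s / t * (u (mv x d t) - u x) by ring.
by lra.
Qed.

Lemma slope_leN x d s t : Om (mv x d s) -> Om (mv x d (- t)) -> 0 < s -> 0 < t ->
  (u (mv x d s) - u x) / s <= (u x - u (mv x d (- t))) / t.
Proof.
move=> Os Ot s0 t0; have st0 : 0 < s + t by exact: addr_gt0.
have h0 : 0 <= s / (s + t) by rewrite divr_ge0// ltW.
have h1 : s / (s + t) <= 1 by rewrite ler_pdivrMr// mul1r lerDl ltW.
have := cu Os Ot h0 h1.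
have -> : seg (mv x d s) (mv x d (- t)) (s / (s + t)) = x.
  have stn : s + t != 0 by rewrite gt_eqF.
  by rewrite [RHS]surjective_pairing /seg /mv /=; congr pair; field.
move=> H; rewrite ler_pdivrMr// mulrAC ler_pdivlMr//.
have : (s / (s + t)) * (s + t) = s by rewrite divfK// gt_eqF.
move: (s / (s + t)) H h0 h1 => w H h0 h1 ws.
have := ler_wpM2l (ltW st0) H.
have -> : (s + t) * (u (mv x d s) + w * (u (mv x d (- t)) - u (mv x d s))) =
  (s + t) * u (mv x d s) + (w * (s + t)) * (u (mv x d (- t)) - u (mv x d s)) by ring.
by rewrite ws; lra.
Qed.

(** The lower bound comes from chords to four points on the axes through [x], a nearby point being
    the midpoint of two axis points with doubled coordinates. The upper bound is the lower bound at
    the point reflected in [x]. *)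
Lemma ccv_continuous x e : Om° x -> 0 < e -> exists2 r, 0 < r &
  forall y, `|y.1 - x.1| < r -> `|y.2 - x.2| < r -> Om° y /\ `|u y - u x| < e.
Proof.
move=> Ix e0; have /plane_openP/(_ _ Ix)[r r0 H] := open_interior Om.
pose p := r / 2; have p0 : 0 < p by rewrite divr_gt0.
have pr : p < r by rewrite /p; lra.
have OI d s : `|s * d.1| < r -> `|s * d.2| < r -> Om (mv x d s).
  by move=> h1 h2; apply/interiorW/H; rewrite /mv /= addrC addKr.
pose e1 : R * R := (1, 0); pose e2 : R * R := (0, 1).
pose C := `|u x - u (mv x e1 p)| + `|u x - u (mv x e1 (- p))| +
   (`|u x - u (mv x e2 p)| + `|u x - u (mv x e2 (- p))|).
have C0 : 0 <= C by rewrite /C !addr_ge0.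
have ax d w : (d = e1 \/ d = e2) -> `|w| <= p -> u x - C * (`|w| / p) <= u (mv x d w).
  move=> dE wp.
  have h0 : 0 <= `|w| / p by rewrite divr_ge0// ltW.
  have h1 : `|w| / p <= 1 by rewrite ler_pdivrMr// mul1r.
  have pn : p != 0 by rewrite gt_eqF.
  have Od s : `|s| < r -> Om (mv x d s).
    move=> sr; apply: OI; case: dE => -> /=; rewrite ?mulr1// mulr0 normr0//.
  have pp : `|p| < r by rewrite gtr0_norm.
  have Ox : Om x by exact: interiorW.
  have bd : u x - u (mv x d p) <= C /\ u x - u (mv x d (- p)) <= C.
    have := ler_norm (u x - u (mv x e1 p)); have := ler_norm (u x - u (mv x e2 p)).
    have := ler_norm (u x - u (mv x e1 (- p))); have := ler_norm (u x - u (mv x e2 (- p))).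
    have := normr_ge0 (u x - u (mv x e1 p)); have := normr_ge0 (u x - u (mv x e2 p)).
    have := normr_ge0 (u x - u (mv x e1 (- p))); have := normr_ge0 (u x - u (mv x e2 (- p))).
    by rewrite /C; case: dE => -> *; split; lra.
  have [w0|w0] := leP 0 w.
    have := cu Ox (Od _ pp) h0 h1; rewrite seg_mv divfK// ger0_norm//.
    by have := ler_wpM2r h0 bd.1; rewrite ger0_norm//; move: (w / p) => z; lra.
  have pp' : `|- p| < r by rewrite normrN.
  have := cu Ox (Od _ pp') h0 h1; rewrite seg_mv mulrN divfK// ltr0_norm// opprK.
  by have := ler_wpM2r h0 bd.2; rewrite ltr0_norm//; move: (- w / p) => z; lra.
(* Chosen so that [C * (2 * q / p) < e]; the factor 2 is the doubling of coordinates in the midpoint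
   argument. *)
pose q := p / 2 * Num.min 1 (e / (C + 1)).
have C1 : 0 < C + 1 by rewrite ltr_wpDl.
have m0 : 0 < Num.min 1 (e / (C + 1)) by rewrite lt_min ltr01 divr_gt0.
have q0 : 0 < q by rewrite mulr_gt0// divr_gt0.
have qp : q <= p / 2 by rewrite /q ler_piMr ?ge_min ?lexx// divr_ge0// ltW.
have qe : C * (2 * q / p) < e.
  have -> : 2 * q / p = Num.min 1 (e / (C + 1)) by rewrite /q; field; rewrite gt_eqF.
  apply: (@le_lt_trans _ _ (C * (e / (C + 1)))).
    by rewrite ler_wpM2l// ge_min lexx orbT.
  rewrite mulrA ltr_pdivrMr// mulrC; lra.
have low w1 w2 : `|w1| < q -> `|w2| < q -> Om (x.1 + w1, x.2 + w2) /\
    u x - e < u (x.1 + w1, x.2 + w2).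
  move=> w1q w2q; split; first by apply/interiorW/H; rewrite /= addrC addKr; lra.
  have n1 : `|2 * w1| = 2 * `|w1| by rewrite normrM ger0_norm.
  have n2 : `|2 * w2| = 2 * `|w2| by rewrite normrM ger0_norm.
  have l1 : `|2 * w1| <= p by rewrite n1; lra.
  have l2 : `|2 * w2| <= p by rewrite n2; lra.
  have a1 := ax e1 (2 * w1) (or_introl erefl) l1.
  have a2 := ax e2 (2 * w2) (or_intror erefl) l2.
  have O1 : Om (mv x e1 (2 * w1)) by apply: OI; rewrite /= ?mulr1 ?mulr0 ?normr0//; lra.
  have O2 : Om (mv x e2 (2 * w2)) by apply: OI; rewrite /= ?mulr1 ?mulr0 ?normr0//; lra.
  have h2 : 2^-1 <= (1 : R) by rewrite invf_le1 ?ler1n.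
  have h0 : 0 <= (2^-1 : R) by rewrite invr_ge0.
  have := cu O1 O2 h0 h2.
  have -> : seg (mv x e1 (2 * w1)) (mv x e2 (2 * w2)) 2^-1 = (x.1 + w1, x.2 + w2).
    by rewrite /seg /mv /=; congr pair; field.
  have b1 : C * (`|2 * w1| / p) <= C * (2 * q / p).
    by rewrite ler_wpM2l// ler_pM2r ?invr_gt0// n1; lra.
  have b2 : C * (`|2 * w2| / p) <= C * (2 * q / p).
    by rewrite ler_wpM2l// ler_pM2r ?invr_gt0// n2; lra.
  move: (C * (`|2 * w1| / p)) (C * (`|2 * w2| / p)) (C * (2 * q / p)) a1 a2 b1 b2 qe.
  by move=> A B D *; lra.
exists q => // y y1 y2.
have [Oy ly] := low _ _ y1 y2.
have [Oz lz] : Om (x.1 + - (y.1 - x.1), x.2 + - (y.2 - x.2)) /\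
    u x - e < u (x.1 + - (y.1 - x.1), x.2 + - (y.2 - x.2)).
  by apply: low; rewrite normrN.
have yE : (x.1 + (y.1 - x.1), x.2 + (y.2 - x.2)) = y.
  by rewrite !(addrC x.1) !(addrC x.2) !subrK -surjective_pairing.
move: Oy ly; rewrite yE => Oy ly; split; first by apply: H; lra.
have h2 : 2^-1 <= (1 : R) by rewrite invf_le1 ?ler1n.
have h0 : 0 <= (2^-1 : R) by rewrite invr_ge0.
have := cu Oy Oz h0 h2.
have -> : seg y (x.1 + - (y.1 - x.1), x.2 + - (y.2 - x.2)) 2^-1 = x.
  by rewrite [RHS]surjective_pairing /seg /mv /=; congr pair; field.
by move=> ?; rewrite ltr_norml; apply/andP; split; lra.
Qed.

End concave_planar.

Section right_derivative.
Context {R : realType}.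
Variables (Om : set (R * R)) (u : R * R -> R).
Hypotheses (cO : cvx Om) (cu : ccv Om u).
Implicit Types (x y d : R * R) (s t e : R).

(** For concave [u] the difference quotient grows as [s] decreases to 0, so the supremum is the
    one-sided derivative along [d]. In this form its lower semicontinuity, and hence its
    measurability on the interior, is immediate. *)
Definition rder d x : R := sup [set q | exists s, [/\ 0 < s, Om° (mv x d s) &
  q = (u (mv x d s) - u x) / s]].

Definition oppd d : R * R := (- d.1, - d.2).

Lemma mv_oppd x d s : mv x (oppd d) s = mv x d (- s).
Proof. by rewrite /mv /oppd /=; congr pair; ring. Qed.

Lemma rder_has_sup d x : Om° x -> has_sup [set q | exists s,
  [/\ 0 < s, Om° (mv x d s) & q = (u (mv x d s) - u x) / s]].
Proof.
move=> Ix; have [e e0 H] := mv_near d Ix.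
have eh : `|e / 2| < e by rewrite gtr0_norm ?divr_gt0//; lra.
have ehN : `|- (e / 2)| < e by rewrite normrN.
split; first by exists ((u (mv x d (e / 2)) - u x) / (e / 2)), (e / 2); split => //; [lra|exact: H].
exists ((u x - u (mv x d (- (e / 2)))) / (e / 2)) => _ [s [s0 Is ->]].
by apply: (slope_leN cu) => //; rewrite ?divr_gt0//; apply: interiorW => //; exact: H.
Qed.

Lemma rder_ge d x s : Om° x -> Om (mv x d s) -> 0 < s ->
  (u (mv x d s) - u x) / s <= rder d x.
Proof.
move=> Ix Os s0; have [e e0 H] := mv_near d Ix.
pose t := Num.min s (e / 2).
have t0 : 0 < t by rewrite lt_min s0 divr_gt0.
have ts : t <= s by rewrite ge_min lexx.
have It : Om° (mv x d t).
  by apply: H; rewrite gtr0_norm//; apply: (@le_lt_trans _ _ (e / 2)); [rewrite ge_min lexx orbT|lra].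
apply: (le_trans (slope_le cu (interiorW Ix) Os t0 ts)).
apply: sup_upper_bound; first exact: rder_has_sup.
by exists t.
Qed.

(** For negative [s] this expresses that forward slopes never exceed backward ones. *)
Lemma rder_up d x s : Om° x -> Om (mv x d s) -> u (mv x d s) <= u x + s * rder d x.
Proof.
move=> Ix Os; have [s0|s0|<-] := ltgtP 0 s; last by rewrite mv0 mul0r addr0.
  by have := rder_ge Ix Os s0; rewrite ler_pdivrMr// => ?; lra.
have ns0 : 0 < - s by rewrite oppr_gt0.
have : rder d x <= (u x - u (mv x d s)) / (- s).
  apply: ge_sup; first by case: (rder_has_sup d Ix).
  move=> _ [t [t0 It ->]]; have := @slope_leN _ _ _ cu x d t (- s).
  by rewrite opprK; apply => //; exact: interiorW.
by rewrite ler_pdivlMr// => ?; lra.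
Qed.

Lemma rder_near d x e : Om° x -> 0 < e -> exists2 r, 0 < r &
  forall s, 0 < s -> s < r -> Om° (mv x d s) /\ u x + s * (rder d x - e) <= u (mv x d s).
Proof.
move=> Ix e0; have hs := rder_has_sup d Ix.
have [r1 r10 H1] := mv_near d Ix.
have [_ [t [t0 It ->]] Ht] := sup_adherent e0 hs.
exists (Num.min t r1); first by rewrite lt_min t0.
move=> s s0; rewrite lt_min => /andP[st sr].
have Is : Om° (mv x d s) by apply: H1; rewrite gtr0_norm.
split => //.
have := slope_le cu (interiorW Ix) (interiorW It) s0 (ltW st) => h.
have : rder d x - e <= (u (mv x d s) - u x) / s by apply: le_trans h; exact: ltW.
by rewrite ler_pdivlMr// => ?; lra.
Qed.

Lemma rderD_le0 d x : Om° x -> rder d x + rder (oppd d) x <= 0.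
Proof.
move=> Ix; have [r r0 H] := mv_near d Ix.
have I1 : Om (mv x d (r / 2)) by apply: interiorW; apply: H; rewrite gtr0_norm; lra.
have I2 : Om (mv x (oppd d) (r / 2)).
  by rewrite mv_oppd; apply: interiorW; apply: H; rewrite normrN gtr0_norm; lra.
have : rder d x <= - rder (oppd d) x; last by lra.
apply: ge_sup; first by case: (rder_has_sup d Ix).
move=> _ [s [s0 Is ->]].
have Iss : Om (mv (mv x d s) (oppd d) s).
  rewrite mv_oppd; suff -> : mv (mv x d s) d (- s) = x by exact: interiorW.
  by rewrite [RHS]surjective_pairing /mv /=; congr pair; ring.
have : rder (oppd d) x <= (u x - u (mv x d s)) / s.
  apply: ge_sup; first by case: (rder_has_sup (oppd d) Ix).
  move=> _ [t [t0 It ->]]; rewrite -[in mv x d s](opprK s) -mv_oppd.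
  by apply: (slope_leN cu) => //; [exact: interiorW|rewrite mv_oppd opprK; exact: interiorW].
have -> : (u x - u (mv x d s)) / s = - ((u (mv x d s) - u x) / s) by ring.
by lra.
Qed.

Definition diff_at d x := Om° x /\ rder d x + rder (oppd d) x = 0.

Lemma diff_near d x e : diff_at d x -> 0 < e -> exists2 r, 0 < r &
  forall s, `|s| < r -> Om° (mv x d s) /\ u x + s * rder d x - e * `|s| <= u (mv x d s).
Proof.
move=> [Ix D] e0; have [r1 r10 H1] := rder_near d Ix e0.
have [r2 r20 H2] := rder_near (oppd d) Ix e0.
exists (Num.min r1 r2); first by rewrite lt_min r10.
move=> s; rewrite lt_min => /andP[sr1 sr2].
have [s0|s0|s0] := ltgtP 0 s.
- have := H1 s s0; rewrite gtr0_norm// in sr1 *.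
  by move=> /(_ sr1)[? ?]; split => //; lra.
- have ns0 : 0 < - s by rewrite oppr_gt0.
  have := H2 _ ns0; rewrite ltr0_norm// in sr2 *.
  rewrite mv_oppd opprK => /(_ sr2)[Is lo]; split => //.
  have E : rder (oppd d) x = - rder d x by lra.
  by rewrite E in lo; lra.
- by rewrite -s0 mv0 normr0; split => //; lra.
Qed.

Lemma diff_derive d x : diff_at d x -> 'D_d u x = rder d x.
Proof.
move=> D; have [Ix _] := D.
rewrite /derive; apply: cvg_lim => //; apply/cvgrPdist_le => e e0.
have [r r0 H] := diff_near D e0.
apply/nbhs_ballP; exists r => //= s; rewrite /ball /= sub0r normrN => sr s0.
have [Is lo] := H _ sr.
have up := rder_up Ix (interiorW Is).
have E : s *: d + x = mv x d s.
  by rewrite /mv [LHS]surjective_pairing /=; congr pair; rewrite addrC.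
rewrite /= E.
have -> : rder d x - s^-1 *: (u (mv x d s) - u x) = (u x + s * rder d x - u (mv x d s)) / s.
  by rewrite -[X in _ - X]/(s^-1 * (u (mv x d s) - u x)); field.
rewrite normrM normfV ler_pdivrMr ?normr_gt0//.
by rewrite ger0_norm; lra.
Qed.

(** A difference quotient exceeding [c] at [x], for one fixed [s], still exceeds [c] at nearby
    points by continuity of [u] at both ends. *)
Lemma rder_gt_open d (c : R) : open [set x | Om° x /\ c < rder d x].
Proof.
apply/plane_openP => x [Ix cx].
have e0 : 0 < (rder d x - c) / 2 by lra.
have [r r0 H] := rder_near d Ix e0.
have [s s0 sr] : exists2 s, 0 < s & s < r by exists (r / 2); lra.
have [Is us] := H _ s0 sr.
have k0 : 0 < s * (rder d x - c) / 4 by rewrite divr_gt0// mulr_gt0// subr_gt0.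
have [r1 r10 H1] := ccv_continuous cu Ix k0.
have [r2 r20 H2] := ccv_continuous cu Is k0.
have /plane_openP/(_ _ Ix)[r3 r30 H3] := open_interior Om.
have /plane_openP/(_ _ Is)[r4 r40 H4] := open_interior Om.
exists (Num.min (Num.min r1 r2) (Num.min r3 r4)); first by rewrite !lt_min r10 r20 r30 r40.
move=> y; rewrite !lt_min => /andP[/andP[a1 a2] /andP[a3 a4]] /andP[/andP[b1 b2] /andP[b3 b4]].
have Iy : Om° y by exact: H3.
have [E1 E2] : (mv y d s).1 - (mv x d s).1 = y.1 - x.1 /\ (mv y d s).2 - (mv x d s).2 = y.2 - x.2.
  by rewrite /mv /=; split; ring.
have Iys : Om° (mv y d s) by apply: H4; rewrite ?E1 ?E2.
split => //.
have [_ uy] := H1 _ a1 b1.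
have [_ uys] : Om° (mv y d s) /\ `|u (mv y d s) - u (mv x d s)| < s * (rder d x - c) / 4.
  by apply: H2; rewrite ?E1 ?E2.
have := rder_ge Iy (interiorW Iys) s0; rewrite ler_pdivrMr//.
move: uy uys; rewrite !ltr_norml => /andP[? ?] /andP[? ?] ?.
rewrite -(ltr_pM2l s0); lra.
Qed.

Lemma measurable_rder d : measurable_fun Om° (rder d).
Proof.
apply: (measurability (@RGenOInfty.G R)); first exact: RGenOInfty.measurableE.
move=> _ [_ [c ->] <-]; apply: plane_open_measurable.
rewrite (_ : _ `&` _ = [set x | Om° x /\ c < rder d x]); first exact: rder_gt_open.
by apply/seteqP; split => x /=; rewrite in_itv/= andbT.
Qed.

End right_derivative.

Section selections.
Context {R : realType}.
Notation leb := (@lebesgue_measure R).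
Implicit Types (h g : R -> R) (J : set R).

(** On each compact subinterval both selections integrate to the same increment of [h]. *)
Lemma slope_selection_unique h g1 g2 J : open J -> is_interval J ->
  has_lbound J -> has_ubound J ->
  measurable_fun J g1 -> measurable_fun J g2 ->
  slope_selection h g1 J -> slope_selection h g2 J ->
  (forall x, J x -> g2 x <= g1 x) ->
  (\int[leb]_(x in J) (g1 x - g2 x)%:E = 0)%E.
Proof.
move=> oJ iJ lJ uJ m1 m2 H1 H2 g21.
have JE := open_interval_itv oJ iJ lJ uJ.
move: (inf J) (sup J) JE => a b JE; rewrite JE in m1 m2 H1 H2 g21 *.
have ge0 x : x \in `]a, b[ -> (0 <= (g1 x - g2 x)%:E)%E by move=> /g21; rewrite lee_fin subr_ge0.
apply/le_anti/andP; split; last by apply: integral_ge0.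
apply: integral_oo_le => //; first by apply/measurable_EFinP/measurable_funB.
move=> s t as_ st tb; exists s, t; split => //.
have sub : `[s, t] `<=` (`]a, b[ : set R).
  by move=> x /=; rewrite !in_itv/= => /andP[? ?]; apply/andP; split; lra.
have m1' : measurable_fun `[s, t] g1 by apply: measurable_funS m1.
have m2' : measurable_fun `[s, t] g2 by apply: measurable_funS m2.
have H1' := slope_selectionS sub H1; have H2' := slope_selectionS sub H2.
have i1 := slope_selection_integrable m1' H1'.
have i2 := slope_selection_integrable m2' H2'.
under eq_integral do rewrite EFinB.
rewrite integralB//= (slope_selection_integral st m1' H1') (slope_selection_integral st m2' H2').
by rewrite -EFinB subrr.
Qed.

End selections.

Section regular_points.
Context {R : realType}.
Notation leb := (@lebesgue_measure R).
Variables (Om : set (R * R)) (u : R * R -> R).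
Hypotheses (cO : cvx Om) (cu : ccv Om u).
Implicit Types (x y d z : R * R) (s t e : R).

Definition e1 : R * R := (1, 0).
Definition e2 : R * R := (0, 1).
Definition rgrad x : R * R := (rder Om u e1 x, rder Om u e2 x).

Definition plane_above k z x := forall y, Om y ->
  u y <= k + z.1 * (y.1 - x.1) + z.2 * (y.2 - x.2).

(** The second clause links the gradient used by the resistance to the one-sided derivatives. The
    last one is a quantitative uniqueness of the supergradient: it covers affine majorants that
    touch [u] only approximately, which is all that an infimum of affine functions provides. *)
Definition regular x := [/\ Om° x, grad u x = rgrad x, plane_above (u x) (rgrad x) x &
  forall e, 0 < e -> exists2 r, 0 < r & forall k z, plane_above k z x -> k <= u x + r ->
    `|z.1 - (rgrad x).1| <= e /\ `|z.2 - (rgrad x).2| <= e].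

(** The majorant is compared with [u] at [mv x d s] and [mv x d (- s)], where [u] is affine up to a
    small multiple of [s]; this bounds its slope from both sides. *)
Lemma diff_exposed d x e : diff_at Om u d x -> 0 < e -> exists2 r, 0 < r &
  forall k z, plane_above k z x -> k <= u x + r ->
    `|z.1 * d.1 + z.2 * d.2 - rder Om u d x| <= e.
Proof.
move=> D e0; have e20 : 0 < e / 2 by lra.
have [r r0 H] := diff_near cu D e20.
have [s s0 sr] : exists2 s, 0 < s & s < r by exists (r / 2); lra.
exists (s * (e / 2)); first exact: mulr_gt0.
move=> k z P kx.
have sr1 : `|s| < r by rewrite gtr0_norm.
have sr2 : `|- s| < r by rewrite normrN gtr0_norm.
have [I1 h1] := H _ sr1; have [I2 h2] := H _ sr2.
have := P _ (interiorW I1); have := P _ (interiorW I2).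
rewrite normrN gtr0_norm// in h1 h2.
have mvB w : (mv x d w).1 - x.1 = w * d.1 /\ (mv x d w).2 - x.2 = w * d.2.
  by rewrite /mv /=; split; ring.
rewrite !(mvB _).1 !(mvB _).2 => P1 P2.
rewrite ler_norml; apply/andP; split; rewrite -(ler_pM2l s0); lra.
Qed.

(** For a concave function the two partial derivatives suffice. If [u y] exceeded the plane by [k],
    a step [t] towards [y] would gain at least [t * k] over it. The opposite point is the midpoint
    of two points on the axes, where [u] is nearly affine, and falls below the plane by at most half
    as much. Concavity at [x], midway between the two, is then violated. *)
Lemma diff_plane_above x : diff_at Om u e1 x -> diff_at Om u e2 x ->
  plane_above (u x) (rgrad x) x.
Proof.
move=> D1 D2 y Oy; rewrite leNgt; apply/negP => Hlt.
have Ix : Om° x by case: D1.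
pose k := u y - (u x + (rgrad x).1 * (y.1 - x.1) + (rgrad x).2 * (y.2 - x.2)).
have k0 : 0 < k by rewrite /k; lra.
pose W := 1 + `|y.1 - x.1| + `|y.2 - x.2|.
have W1 : 1 <= W by rewrite /W -addrA lerDl addr_ge0.
have W0 : 0 < W by lra.
have e0 : 0 < k / (2 * W) by rewrite divr_gt0// mulr_gt0.
have [r1 r10 H1] := diff_near cu D1 e0; have [r2 r20 H2] := diff_near cu D2 e0.
have [r3 r30 H3] := mv_near (y.1 - x.1, y.2 - x.2) Ix.
pose m := Num.min 1 (Num.min (r3) (Num.min r1 r2)).
have m0 : 0 < m by rewrite !lt_min ltr01 r30 r10.
have [t [t0 t1 t3 tr1 tr2]] : exists t, [/\ 0 < t, t <= 1, t < r3, 2 * t * W < r1 & 2 * t * W < r2].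
  have tm : 2 * (m / (4 * W)) * W < m.
    have -> : 2 * (m / (4 * W)) * W = m / 2 by field; rewrite gt_eqF.
    by rewrite ltr_pdivrMr// ltr_pMr// ltr1n.
  have tm' : m / (4 * W) < m by rewrite ltr_pdivrMr ?mulr_gt0// ltr_pMr//; lra.
  exists (m / (4 * W)); split.
  - by rewrite divr_gt0// mulr_gt0.
  - by apply: le_trans (ltW tm') _; rewrite ge_min lexx.
  - by apply: lt_le_trans tm' _; rewrite /m !ge_min lexx !orbT.
  - by apply: lt_le_trans tm _; rewrite /m !ge_min lexx !orbT.
  - by apply: lt_le_trans tm _; rewrite /m !ge_min lexx !orbT.
have bw (w : R) r : `|w| <= W -> 2 * t * W < r -> `|- (2 * t * w)| < r.
  move=> wW; apply: le_lt_trans.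
  by rewrite normrN normrM gtr0_norm ?mulr_gt0// ler_pM2l// mulr_gt0.
have wW1 : `|y.1 - x.1| <= W by rewrite /W addrAC lerDr addr_ge0.
have wW2 : `|y.2 - x.2| <= W by rewrite /W lerDr addr_ge0.
have [I1 h1] := H1 _ (bw _ _ wW1 tr1); have [I2 h2] := H2 _ (bw _ _ wW2 tr2).
have It : Om (mv x (y.1 - x.1, y.2 - x.2) (- t)).
  by apply: interiorW; apply: H3; rewrite normrN gtr0_norm.
have Op : Om (seg x y t) by apply: cO => //; [exact: interiorW|exact: ltW].
have up := cu (interiorW Ix) Oy (ltW t0) t1.
have hf0 : 0 <= (2^-1 : R) by rewrite invr_ge0.
have hf1 : 2^-1 <= (1 : R) by rewrite invf_le1 ?ler1n.
have := cu Op It hf0 hf1.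
have -> : seg (seg x y t) (mv x (y.1 - x.1, y.2 - x.2) (- t)) 2^-1 = x.
  by rewrite [RHS]surjective_pairing /seg /mv /=; congr pair; field.
have := cu (interiorW I1) (interiorW I2) hf0 hf1.
have -> : seg (mv x e1 (- (2 * t * (y.1 - x.1)))) (mv x e2 (- (2 * t * (y.2 - x.2)))) 2^-1 =
    mv x (y.1 - x.1, y.2 - x.2) (- t).
  by rewrite /seg /mv /=; congr pair; field.
have n1 (w : R) : `|- (2 * t * w)| = 2 * t * `|w|.
  by rewrite normrN normrM gtr0_norm// mulr_gt0.
rewrite !n1 in h1 h2.
have eW : k / (2 * W) * W = k / 2 by field; rewrite gt_eqF.
have eWt : k / (2 * W) * (2 * t * `|y.1 - x.1|) + k / (2 * W) * (2 * t * `|y.2 - x.2|) <= t * k.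
  rewrite -mulrDr -mulrDr mulrA [_ * (2 * t)]mulrC -mulrA.
  apply: (@le_trans _ _ (2 * t * (k / 2))); last lra.
  rewrite ler_pM2l ?mulr_gt0// -eW ler_pM2l// /W -addrA lerDr//.
move: (u (mv x e1 _)) (u (mv x e2 _)) h1 h2 => A B h1 h2.
move: (u (mv x _ (- t))) => C; move: up; move: (u (seg x y t)) => D up.
move: eWt; move: (k / (2 * W) * (2 * t * `|y.1 - x.1|)) (k / (2 * W) * (2 * t * `|y.2 - x.2|)) h1 h2 => E1 E2 h1 h2 eWt i1 i2.
have kE : t * k = t * (u y - u x) - t * ((rgrad x).1 * (y.1 - x.1) + (rgrad x).2 * (y.2 - x.2)) by rewrite /k; ring.
have tk : 0 < t * k by exact: mulr_gt0.
rewrite /rgrad /= in kE.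
move: (k) kE tk eWt => kk kE tk eWt.
have : t * kk <= (E1 + E2) / 2 by lra.
by lra.
Qed.

Lemma diff_regular x : diff_at Om u e1 x -> diff_at Om u e2 x -> regular x.
Proof.
move=> D1 D2; split.
- by case: D1.
- by rewrite /grad (diff_derive cu D1) (diff_derive cu D2).
- exact: diff_plane_above.
- move=> e e0; have [r1 r10 H1] := diff_exposed D1 e0; have [r2 r20 H2] := diff_exposed D2 e0.
  exists (Num.min r1 r2); first by rewrite lt_min r10.
  move=> k z P kx.
  have := H1 k z P; have := H2 k z P; rewrite /= !mulr1 !mulr0 addr0 add0r => h2 h1.
  split; [apply: h1|apply: h2]; apply: (le_trans kx); rewrite lerD2l ge_min lexx ?orbT//.
Qed.

Lemma regular_unique x z : regular x -> plane_above (u x) z x -> z = rgrad x.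
Proof.
move=> [_ _ _ H] P.
have eq0 (w : R) : (forall e, 0 < e -> `|w| <= e) -> w = 0.
  move=> h; apply/eqP; rewrite -normr_eq0; apply/eqP/le_anti; rewrite normr_ge0 andbT.
  by apply/ler_addgt0Pl => e /h; rewrite addr0.
have h e : 0 < e -> `|z.1 - (rgrad x).1| <= e /\ `|z.2 - (rgrad x).2| <= e.
  by move=> /H[r r0 Hr]; apply: (Hr _ _ P); rewrite lerDl ltW.
rewrite [LHS]surjective_pairing [RHS]surjective_pairing; congr pair; apply/eqP;
  rewrite -subr_eq0; apply/eqP/eq0 => e /h[]//.
Qed.

End regular_points.

(** * Integrals of nonnegative functions without measurability *)

Section nonmeasurable_integral.
Context d (T : measurableType d) (R : realType) (mu : {measure set T -> \bar R}).
Local Open Scope ereal_scope.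
Import HBNNSimple.

Lemma ge0_integral_le_nonmeas (D : set T) (F G : T -> \bar R) :
  (forall x, D x -> 0 <= F x) -> (forall x, D x -> F x <= G x) ->
  \int[mu]_(x in D) F x <= \int[mu]_(x in D) G x.
Proof.
move=> F0 FG; rewrite !(integral_mkcond D).
have h x : (F \_ D) x <= (G \_ D) x by apply: lee_restrict.
have F0' x : 0 <= (F \_ D) x by apply: erestrict_ge0.
have G0' x : 0 <= (G \_ D) x by apply: le_trans (F0' x) (h x).
rewrite !ge0_integralTE//; apply: le_ereal_sup => _ [g /= gF <-].
by exists g => //= x; exact: le_trans (gF x) (h x).
Qed.

(** On the boundary of [Omega] the integrand of [resistance] depends on the values of [u] outside,
    so it is not known to be measurable. Since the integral of a nonnegative function is a supremum
    over simple functions below it, each of these can be compared with [G] off the null set. *)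
Lemma ge0_ae_eq_integral_nonmeas (D : set T) (F G : T -> \bar R) :
  measurable D -> measurable_fun D G ->
  (forall x, D x -> 0 <= F x) -> (forall x, D x -> 0 <= G x) ->
  ae_eq mu D F G -> \int[mu]_(x in D) F x = \int[mu]_(x in D) G x.
Proof.
move=> mD mG F0 G0 [N [mN N0 sub]].
have E x : D x -> ~ N x -> F x = G x.
  by move=> Dx Nx; apply: contrapT => FG; apply/Nx/sub => /= H; exact/FG/H.
have -> : \int[mu]_(x in D) G x = \int[mu]_(x in D `\` N) G x.
  exact: ge0_negligible_integral.
apply/le_anti/andP; split; last first.
  have -> : \int[mu]_(x in D `\` N) G x = \int[mu]_(x in D `\` N) F x.
    by apply: eq_integral => x; rewrite inE => -[Dx Nx]; rewrite E.
  rewrite (integral_mkcond (D `\` N)) (integral_mkcond D).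
  apply: ge0_integral_le_nonmeas => x _; first by apply: erestrict_ge0 => y [/F0].
  rewrite !patchE; case: ifPn => [|_]; first by rewrite inE => -[Dx _]; rewrite mem_set.
  by case: ifPn => //; rewrite inE => /F0.
rewrite (integral_mkcond D) ge0_integralTE; last by move=> x; apply: erestrict_ge0.
apply: ge_ereal_sup => _ [g /= gF <-].
rewrite -integralT_nnsfun (@ge0_negligible_integral _ _ _ _ _ N)//; last 2 first.
- exact/measurable_EFinP.
- by move=> x _; rewrite lee_fin.
rewrite setTD [leRHS](integral_mkcond (D `\` N)) [leLHS]integral_mkcond.
apply: ge0_le_integral => //.
- by move=> x _; apply: erestrict_ge0 => y _; rewrite lee_fin.
- apply/(measurable_restrictT _ _).1; first exact: measurableC.
  by apply: measurable_funTS; exact/measurable_EFinP.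
- apply/(measurable_restrictT _ _).1; first exact: measurableD.
  by apply: measurable_funS mG => //; exact: subDsetl.
- move=> x _; rewrite !patchE.
  have := gF x; rewrite patchE.
  case: (boolP (x \in ~` N)) => [|_]; last first.
    by move=> _; case: (boolP (x \in D `\` N)) => // /set_mem[/G0].
  rewrite inE => Nx; case: (boolP (x \in D)) => Dx.
    by rewrite mem_set; [rewrite E//; exact: set_mem|split => //; exact: set_mem].
  have -> // : x \in D `\` N = false.
  by apply/negbTE/negP; rewrite inE => -[Dx' _]; move: Dx; rewrite mem_set.
Qed.

End nonmeasurable_integral.

(** * Almost every interior point is regular *)

Section almost_everywhere.
Context {R : realType}.
Notation leb := (@lebesgue_measure R).
Variables (Om : set (R * R)) (u : R * R -> R) (B : R).
Hypotheses (cO : cvx Om) (cu : ccv Om u).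
Hypothesis bO : forall x, Om x -> `|x.1| <= B /\ `|x.2| <= B.
Implicit Types (x y d z : R * R) (s t e : R).

Lemma interior_measurable : measurable Om°.
Proof. by apply: plane_open_measurable; exact: open_interior. Qed.

Lemma hsec_interval (A : set (R * R)) t : cvx A -> is_interval (hsec A t).
Proof.
move=> cA a b Aa Ab c /andP[ac cb].
have [ba|ba] := eqVneq b a; first by suff -> : c = a by []; apply/le_anti; rewrite ac -{1}ba cb.
have ba0 : b - a != 0 by rewrite subr_eq0.
have bap : 0 < b - a by rewrite lt_neqAle eq_sym ba0 subr_ge0 (le_trans ac).
have := cA _ _ ((c - a) / (b - a)) Aa Ab.
rewrite ler_pdivrMr// mul1r lerB// divr_ge0 ?subr_ge0 ?(le_trans ac cb)// => /(_ isT isT).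
by rewrite /seg /mv /= divfK// (addrC a) subrK subrr mulr0 addr0.
Qed.

Lemma vsec_interval (A : set (R * R)) s : cvx A -> is_interval (vsec A s).
Proof.
move=> cA a b Aa Ab c /andP[ac cb].
have [ba|ba] := eqVneq b a; first by suff -> : c = a by []; apply/le_anti; rewrite ac -{1}ba cb.
have ba0 : b - a != 0 by rewrite subr_eq0.
have bap : 0 < b - a by rewrite lt_neqAle eq_sym ba0 subr_ge0 (le_trans ac).
have := cA _ _ ((c - a) / (b - a)) Aa Ab.
rewrite ler_pdivrMr// mul1r lerB// divr_ge0 ?subr_ge0 ?(le_trans ac cb)// => /(_ isT isT).
by rewrite /seg /mv /= divfK// (addrC a) subrK subrr mulr0 addr0.
Qed.

Lemma hsec_bounds (A : set (R * R)) t : A `<=` Om -> has_lbound (hsec A t) /\ has_ubound (hsec A t).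
Proof.
by move=> AO; split; [exists (- B)|exists B] => s /AO/bO[/=]; rewrite ler_norml => /andP[].
Qed.

Lemma vsec_bounds (A : set (R * R)) s : A `<=` Om -> has_lbound (vsec A s) /\ has_ubound (vsec A s).
Proof.
by move=> AO; split; [exists (- B)|exists B] => t /AO/bO[_ /=]; rewrite ler_norml => /andP[].
Qed.

Lemma rder_hselection t : slope_selection (fun s => u (s, t))
  (fun s => rder Om u e1 (s, t)) (hsec Om° t).
Proof.
move=> s s' Is Is'; have := @rder_up _ _ _ cu e1 (s, t) (s' - s) Is.
have -> : mv (s, t) e1 (s' - s) = (s', t) by rewrite /mv /=; congr pair; ring.
by move=> /(_ (interiorW Is')); rewrite mulrC.
Qed.

Lemma rder_hselectionN t : slope_selection (fun s => u (s, t))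
  (fun s => - rder Om u (oppd e1) (s, t)) (hsec Om° t).
Proof.
move=> s s' Is Is'; have := @rder_up _ _ _ cu (oppd e1) (s, t) (s - s') Is.
have -> : mv (s, t) (oppd e1) (s - s') = (s', t) by rewrite /mv /=; congr pair; ring.
by move=> /(_ (interiorW Is')); lra.
Qed.

Lemma rder_vselection s : slope_selection (fun t => u (s, t))
  (fun t => rder Om u e2 (s, t)) (vsec Om° s).
Proof.
move=> t t' It It'; have := @rder_up _ _ _ cu e2 (s, t) (t' - t) It.
have -> : mv (s, t) e2 (t' - t) = (s, t') by rewrite /mv /=; congr pair; ring.
by move=> /(_ (interiorW It')); rewrite mulrC.
Qed.

Lemma rder_vselectionN s : slope_selection (fun t => u (s, t))
  (fun t => - rder Om u (oppd e2) (s, t)) (vsec Om° s).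
Proof.
move=> t t' It It'; have := @rder_up _ _ _ cu (oppd e2) (s, t) (t - t') It.
have -> : mv (s, t) (oppd e2) (t - t') = (s, t') by rewrite /mv /=; congr pair; ring.
by move=> /(_ (interiorW It')); lra.
Qed.

Lemma measurable_rder_hsec d t : measurable_fun (hsec Om° t) (fun s => rder Om u d (s, t)).
Proof.
apply/measurable_EFinP; apply: (@measurable_fun_hsec _ (fun x => (rder Om u d x)%:E)).
  exact: interior_measurable.
by apply/measurable_EFinP; exact: measurable_rder.
Qed.

Lemma measurable_rder_vsec d s : measurable_fun (vsec Om° s) (fun t => rder Om u d (s, t)).
Proof.
apply/measurable_EFinP; apply: (@measurable_fun_vsec _ (fun x => (rder Om u d x)%:E)).
  exact: interior_measurable.
by apply/measurable_EFinP; exact: measurable_rder.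
Qed.

(** The integrand is nonnegative by [rderD_le0] and vanishes exactly where the two one-sided
    derivatives agree. *)
Lemma diff_ae_of_integral d :
  (\int[leb2]_(x in Om°) (- rder Om u (oppd d) x - rder Om u d x)%:E = 0)%E ->
  {ae leb2, forall x, Om° x -> diff_at Om u d x}.
Proof.
move=> I0.
have mF : measurable_fun Om° (fun x => (- rder Om u (oppd d) x - rder Om u d x)%:E).
  apply/measurable_EFinP; apply: measurable_funB; last exact: measurable_rder.
  by apply/measurable_funN; exact: measurable_rder.
have /(ae_eq_integral_abs leb2 interior_measurable mF) : (\int[leb2]_(x in Om°)
    `|(- rder Om u (oppd d) x - rder Om u d x)%:E| = 0)%E.
  rewrite -[RHS]I0; apply: eq_integral => x; rewrite inE => Ix.
  by rewrite gee0_abs// lee_fin; have := rderD_le0 cu d Ix; lra.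
apply: filterS => x H Ix; split => //.
by have := H Ix => -[]; lra.
Qed.

(** On each horizontal line the forward and the backward derivative are two slope selections of the
    same function, so their difference has integral zero there; Tonelli does the rest. *)
Lemma diff_ae1 : {ae leb2, forall x, Om° x -> diff_at Om u e1 x}.
Proof.
apply: diff_ae_of_integral; rewrite tonelli_hsec; first last.
- by move=> x Ix; rewrite lee_fin; have := rderD_le0 cu e1 Ix; lra.
- apply/measurable_EFinP; apply: measurable_funB; last exact: measurable_rder.
  by apply/measurable_funN; exact: measurable_rder.
- exact: interior_measurable.
apply: integral0_eq => t _.
have [lJ uJ] := hsec_bounds t (@interiorW R Om).
apply: (@slope_selection_unique _ (fun s => u (s, t))) => //.
- by apply: hsec_open; exact: open_interior.
- by apply: hsec_interval; exact: interior_cvx.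
- by apply/measurable_funN; exact: measurable_rder_hsec.
- exact: measurable_rder_hsec.
- exact: rder_hselectionN.
- exact: rder_hselection.
- by move=> s Is; have := rderD_le0 cu e1 Is; lra.
Qed.

Lemma diff_ae2 : {ae leb2, forall x, Om° x -> diff_at Om u e2 x}.
Proof.
apply: diff_ae_of_integral; rewrite tonelli_vsec; first last.
- by move=> x Ix; rewrite lee_fin; have := rderD_le0 cu e2 Ix; lra.
- apply/measurable_EFinP; apply: measurable_funB; last exact: measurable_rder.
  by apply/measurable_funN; exact: measurable_rder.
- exact: interior_measurable.
apply: integral0_eq => s _.
have [lJ uJ] := vsec_bounds s (@interiorW R Om).
apply: (@slope_selection_unique _ (fun t => u (s, t))) => //.
- by apply: vsec_open; exact: open_interior.
- by apply: vsec_interval; exact: interior_cvx.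
- by apply/measurable_funN; exact: measurable_rder_vsec.
- exact: measurable_rder_vsec.
- exact: rder_vselectionN.
- exact: rder_vselection.
- by move=> t It; have := rderD_le0 cu e2 It; lra.
Qed.

Lemma regular_ae : {ae leb2, forall x, Om° x -> regular Om u x}.
Proof.
have [[N1 [m1 n1 s1]] [N2 [m2 n2 s2]]] := (diff_ae1, diff_ae2).
exists (N1 `|` N2); split; [exact: measurableU|by rewrite measureU0|].
move=> x /= nx; apply: contrapT => /not_orP[nN1 nN2]; apply: nx => Ix.
by apply: diff_regular => //; apply: contrapT => nd; [apply: nN1; apply: s1|apply: nN2; apply: s2] => /(_ Ix).
Qed.

End almost_everywhere.

Section planar_measure.
Context {R : realType}.
Notation leb := (@lebesgue_measure R).
Implicit Types (A D : set (R * R)) (x y : R * R).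

Lemma ae_app2 (P Q S : R * R -> Prop) : (forall x, P x -> Q x -> S x) ->
  {ae leb2, forall x, P x} -> {ae leb2, forall x, Q x} -> {ae leb2, forall x, S x}.
Proof.
move=> H [N1 [m1 n1 s1]] [N2 [m2 n2 s2]].
exists (N1 `|` N2); split; [exact: measurableU|by rewrite measureU0|].
move=> x /= nx; apply: contrapT => /not_orP[nN1 nN2]; apply: nx.
by apply: H; apply: contrapT => nd; [apply: nN1; apply: s1|apply: nN2; apply: s2].
Qed.

Lemma ae_app1 (P S : R * R -> Prop) : (forall x, P x -> S x) ->
  {ae leb2, forall x, P x} -> {ae leb2, forall x, S x}.
Proof. by move=> H hP; apply: (ae_app2 _ hP hP) => x Px _; exact: H. Qed.

Definition box (a b c d : R) : set (R * R) := `[a, b] `*` `[c, d].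

Lemma measurable_box a b c d : measurable (box a b c d).
Proof. exact: measurableX. Qed.

Lemma leb2_box a b c d : a <= b -> c <= d ->
  leb2 (box a b c d) = ((b - a) * (d - c))%:E.
Proof.
move=> ab cd; rewrite /box product_measure1E//= !lebesgue_measure_itv/= !lte_fin.
move: ab cd; rewrite !le_eqVlt => /predU1P[->|->]; first by rewrite ltxx subrr mul0r mul0e.
by move=> /predU1P[->|->]; first by rewrite ltxx subrr mulr0 mule0.
Qed.

Lemma leb2_open_gt0 A x : open A -> A x -> (0 < leb2 A)%E.
Proof.
move=> oA Ax; have /plane_openP/(_ _ Ax)[e e0 H] := oA.
have hA : box (x.1 - e / 2) (x.1 + e / 2) (x.2 - e / 2) (x.2 + e / 2) `<=` A.
  move=> y [/=]; rewrite !in_itv/= => /andP[? ?] /andP[? ?].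
  by apply: H; rewrite ltr_norml; apply/andP; split; lra.
apply: (@lt_le_trans _ _ (leb2 (box (x.1 - e / 2) (x.1 + e / 2) (x.2 - e / 2) (x.2 + e / 2)))).
  by rewrite leb2_box ?lte_fin ?mulr_gt0//; lra.
by apply: le_measure => //; rewrite inE; [exact: measurable_box|exact: plane_open_measurable].
Qed.

Lemma leb2_bounded A (B : R) : measurable A ->
  (forall x, A x -> `|x.1| <= B /\ `|x.2| <= B) -> (leb2 A < +oo)%E.
Proof.
move=> mA bA; have [->|/eqP/set0P[x0 Ax0]] := pselect (A = set0); first by rewrite measure0.
have [b1 _] := bA _ Ax0; have B0 : 0 <= B by apply: le_trans b1.
have hA : A `<=` box (- B) B (- B) B.
  by move=> y /bA[]; rewrite !ler_norml => ? ?; split; rewrite /= in_itv.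
apply: (@le_lt_trans _ _ (leb2 (box (- B) B (- B) B))).
  by apply: le_measure => //; rewrite inE//; exact: measurable_box.
by rewrite leb2_box ?ltry//; lra.
Qed.

(** Minimality is exploited in this form: it supplies the reversed inequality between the integrals,
    and pointwise comparison then becomes equality. *)
Lemma ae_eq_of_integral_le D (phi psi : R * R -> R) (C : R) :
  measurable D -> (leb2 D < +oo)%E ->
  measurable_fun D phi -> measurable_fun D psi ->
  (forall x, D x -> `|phi x| <= C) -> (forall x, D x -> `|psi x| <= C) ->
  {ae leb2, forall x, D x -> phi x <= psi x} ->
  (\int[leb2]_(x in D) (psi x)%:E <= \int[leb2]_(x in D) (phi x)%:E)%E ->
  {ae leb2, forall x, D x -> phi x = psi x}.
Proof.
move=> mD fD mphi mpsi bphi bpsi le_ae int_le.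
have intg (g : R * R -> R) : measurable_fun D g -> (forall x, D x -> `|g x| <= C) ->
    (leb2 : set (measurableTypeR R * measurableTypeR R) -> \bar R).-integrable D (EFin \o g).
  move=> mg bg; apply: measurable_bounded_integrable => //.
  exists C; split; first exact: num_real.
  by move=> r Cr x Dx /=; apply: le_trans (bg _ Dx) _; exact: ltW.
have iphi := intg _ mphi bphi; have ipsi := intg _ mpsi bpsi.
have mB : measurable_fun D (fun x => (psi x - phi x)%:E).
  by apply/measurable_EFinP; exact: measurable_funB.
have E0 : (\int[leb2]_(x in D) `|(psi x - phi x)%:E| = 0)%E.
  apply/le_anti/andP; split; last by apply: integral_ge0.
  have -> : (\int[leb2]_(x in D) `|(psi x - phi x)%:E| = \int[leb2]_(x in D) (psi x - phi x)%:E)%E.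
    apply: ae_eq_integral => //; first exact: measurableT_comp.
    move: le_ae; apply: ae_app1 => x h Dx.
    by rewrite gee0_abs// lee_fin subr_ge0 h.
  under eq_integral do rewrite EFinB.
  rewrite integralB// sube_le0//; exact: integrable_fin_num.
move: E0 => /(ae_eq_integral_abs leb2 mD mB).
apply: ae_app1 => x h Dx; have := h Dx => -[].
by move/eqP; rewrite subr_eq0 => /eqP.
Qed.

End planar_measure.

(** * The boundary is null; the resistance through one-sided derivatives *)

Section resistance_formula.
Context {R : realType}.
Notation leb := (@lebesgue_measure R).
Variables (Om : set (R * R)) (u : R * R -> R) (B : R).
Hypotheses (cO : cvx Om) (cu : ccv Om u).
Hypothesis bO : forall x, Om x -> `|x.1| <= B /\ `|x.2| <= B.
Hypothesis clO : closed Om.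
Hypothesis iO : Om° !=set0.
Implicit Types (x y d z : R * R) (s t e : R).

Lemma interior_between s t0 t1 t2 t : Om° (s, t0) -> Om (s, t1) -> Om (s, t2) ->
  t1 < t -> t < t2 -> Om° (s, t).
Proof.
move=> I0 O1 O2 t1t tt2.
have go t' : Om (s, t') -> t' - t0 != 0 -> 0 <= (t - t0) / (t' - t0) ->
    (t - t0) / (t' - t0) < 1 -> Om° (s, t).
  move=> O' n0 h0 h1; have := interior_seg cO I0 O' h0 h1.
  rewrite (_ : seg _ _ _ = (s, t))//.
  by rewrite /seg /mv /=; congr pair; field.
have [lt0|gt0|<-//] := ltgtP t0 t.
- have p : 0 < t2 - t0 by lra.
  by apply: (go t2) => //; rewrite ?gt_eqF// ?divr_ge0 ?ltr_pdivrMr//; lra.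
- have p : t1 - t0 < 0 by lra.
  apply: (go t1) => //; rewrite ?lt_eqF//.
    by rewrite -mulrNN -invrN divr_ge0//; lra.
  by rewrite ltr_ndivrMr//; lra.
Qed.

(** On a vertical line meeting the interior, only the two ends of the section can be boundary
    points. A line that meets [Om] but not its interior must, by convexity, be one of the two
    extreme vertical lines. *)
Lemma boundary_null : leb2 (Om `\` Om°) = 0%E.
Proof.
have mA : measurable (Om `\` Om°).
  by apply: measurableD; [exact: plane_closed_measurable|exact: interior_measurable].
have [[p q] Ipq] := iO.
pose P := [set s | exists t, Om (s, t)].
pose N := [set inf P; sup P].
have vnull s : ~ N s -> leb (xsection (Om `\` Om°) s) = 0%E.
  move=> nN; rewrite -vsecE.
  have [[t0 It0]|nI] := pselect (exists t0, Om° (s, t0)).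
    have [lv uv] := @vsec_bounds _ Om B bO Om s (@subset_refl _ _).
    apply: (@countable_lebesgue_measure0 R (vsec (Om `\` Om°) s)).
    apply: (@sub_countable _ _ _ [set inf (vsec Om s); sup (vsec Om s)]); last exact: finite_set_countable.
    apply: subset_card_le => t [Ot nIt].
    have [ltinf|] := pselect (exists2 t1, Om (s, t1) & t1 < t).
      right; apply/le_anti/andP; split; first by apply: sup_upper_bound => //; split => //; exists t.
      apply: ge_sup; first by exists t.
      move=> t2 Ot2; rewrite leNgt; apply/negP => tt2; apply: nIt.
      by have [t1 O1 t1t] := ltinf; exact: interior_between It0 O1 Ot2 t1t tt2.
    move=> h; left; apply/le_anti/andP; split; last by apply: ge_inf.
    apply: lb_le_inf; first by exists t.
    by move=> t1 Ot1; rewrite leNgt; apply/negP => t1t; apply: h; exists t1.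
  have [[t Ot]|nO] := pselect (exists t, Om (s, t)); last first.
    rewrite (_ : vsec _ _ = set0) ?measure0//.
    by apply/seteqP; split => // t [Ot _]; apply: nO; exists t.
  exfalso; apply: nN.
  have hP : has_inf P /\ has_sup P.
    by split; (split; first by exists s, t); [exists (- B)|exists B];
      move=> s' [t' /bO[/=]]; rewrite ler_norml => /andP[].
  (* A ratio in [[0, 1)] would put over [s] a point of a segment from an interior point to a point
     of [Om], hence an interior point. *)
  have key s' : Om° (s', q) -> forall s2, P s2 -> s2 != s -> ((s - s') / (s2 - s') < 0 \/ 1 <= (s - s') / (s2 - s')) \/ s2 = s'.
    move=> I' s2 [t2 O2] s2s; have [->|n2] := eqVneq s2 s'; first by right.
    left; have [h0|h0] := ltP ((s - s') / (s2 - s')) 0; first by left.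
    have [h1|h1] := leP 1 ((s - s') / (s2 - s')); first by right.
    exfalso; apply: nI; have := interior_seg cO I' O2 h0 h1.
    rewrite /seg /mv /= divfK ?subr_eq0// addrC subrK => ?; by eexists; eassumption.
  have [sp|ps|E] := ltgtP s p.
  - left; apply/le_anti/andP; split; last by apply: ge_inf; [exact: hP.1.2|exists t].
    apply: lb_le_inf; first by exists s, t.
    move=> s2 Ps2; rewrite leNgt; apply/negP => s2s.
    have p2 : s2 - p < 0 by lra.
    have [[]|] := key _ Ipq _ Ps2 (negbT (lt_eqF s2s)).
    + by rewrite ltr_ndivrMr// mul0r; lra.
    + by rewrite ler_ndivlMr//; lra.
    + by lra.
  - right; apply/le_anti/andP; split; first by apply: sup_upper_bound; [exact: hP.2|exists t].
    apply: ge_sup; first by exists s, t.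
    move=> s2 Ps2; rewrite leNgt; apply/negP => s2s.
    have p2 : 0 < s2 - p by lra.
    have [[]|] := key _ Ipq _ Ps2 (negbT (gt_eqF s2s)).
    + by rewrite ltr_pdivrMr// mul0r; lra.
    + by rewrite ler_pdivlMr//; lra.
    + by lra.
  - by exfalso; apply: nI; exists q; rewrite E.
have mN : leb N = 0%E.
  by apply: countable_lebesgue_measure0; rewrite /N; exact: finite_set_countable.
transitivity (\int[leb]_s leb (xsection (Om `\` Om°) s))%E; first by [].
rewrite (@ge0_negligible_integral _ _ _ leb setT N)//.
- by apply: integral0_eq => s [_ /vnull].
- exact: measurableU.
- exact: measurable_fun_xsection.
Qed.

Definition fres (z : R * R) : R := 1 / (1 + (z.1 ^+ 2 + z.2 ^+ 2)).

Lemma fres_ge0 z : 0 <= fres z.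
Proof. by rewrite /fres divr_ge0// !addr_ge0// sqr_ge0. Qed.

Lemma fres_le1 z : fres z <= 1.
Proof.
have h : 0 <= z.1 ^+ 2 + z.2 ^+ 2 by rewrite addr_ge0// sqr_ge0.
by rewrite /fres ler_pdivrMr; lra.
Qed.

Lemma measurable_fres (D : set (R * R)) (g1 g2 : R * R -> R) : measurable_fun D g1 ->
  measurable_fun D g2 -> measurable D -> measurable_fun D (fun x => fres (g1 x, g2 x)).
Proof.
move=> m1 m2 mD.
(* The absolute value keeps the denominator positive, so that the outer function is continuous on
   the whole line. *)
have mi : measurable_fun setT (fun r : R => (1 + `|r|)^-1).
  apply: continuous_measurable_fun => r; apply: cvgV; last first.
    by apply: cvgD; [exact: cvg_cst|exact: cvg_norm].
  by rewrite gt_eqF// ltr_wpDr.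
have mden : measurable_fun D (fun x => g1 x ^+ 2 + g2 x ^+ 2).
  by apply: measurable_funD; exact: measurable_funX.
rewrite (_ : (fun x => _) = (fun r : R => (1 + `|r|)^-1) \o (fun x => g1 x ^+ 2 + g2 x ^+ 2)).
  exact: measurableT_comp.
apply/funext => x; rewrite /fres /= div1r ger0_norm//.
by rewrite addr_ge0// sqr_ge0.
Qed.

Lemma measurable_fres_rgrad : measurable_fun Om° (fun x => fres (rgrad Om u x)).
Proof.
apply: measurable_fres; [exact: measurable_rder|exact: measurable_rder|exact: interior_measurable].
Qed.

Lemma resistanceE :
  resistance Om u = (\int[leb2]_(x in Om°) (fres (rgrad Om u x))%:E)%E.
Proof.
have mI := @interior_measurable _ Om.
have mO : measurable Om by exact: plane_closed_measurable.
pose G := (fun x => (fres (rgrad Om u x))%:E) \_ Om°.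
have IO : Om° `<=` Om by exact: interior_subset.
transitivity (\int[leb2]_(x in Om) G x)%E; last first.
  rewrite [LHS]integral_mkcond [RHS]integral_mkcond; apply: eq_integral => x _.
  rewrite !patchE; case: ifPn => // nO; case: ifPn => //; rewrite inE => /IO/mem_set.
  by rewrite (negbTE nO).
rewrite /resistance; apply: ge0_ae_eq_integral_nonmeas => //.
- apply: (measurable_funS measurableT) => //; apply/(measurable_restrictT _ mI).
  by apply/measurable_EFinP; exact: measurable_fres_rgrad.
- by move=> x _; rewrite lee_fin; exact: (fres_ge0 (grad u x)).
- by move=> x _; rewrite /G patchE; case: ifPn => // _; rewrite lee_fin fres_ge0.
- have [N [mN N0 sN]] := regular_ae cO cu bO.
  exists (N `|` (Om `\` Om°)); split.
  + by apply: measurableU => //; apply: measurableD.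
  + by rewrite measureU0//; [apply: measurableD|exact: boundary_null].
  move=> x /= nx; apply: contrapT => /not_orP[nN nD]; apply: nx => Ox.
  have Ix : Om° x by apply: contrapT => nI; apply: nD.
  have [_ gE _ _] : regular Om u x by apply: contrapT => nr; apply/nN/sN => /= /(_ Ix).
  rewrite /G patchE mem_set// -gE; reflexivity.
Qed.

End resistance_formula.

(** * Minimality *)

Section minimality.
Context {R : realType}.
Implicit Types (Om : set (R * R)) (u v : R * R -> R) (x y z : R * R).

Definition planar_body Om (B : R) :=
  [/\ cvx Om, closed Om, Om° !=set0 & forall x, Om x -> `|x.1| <= B /\ `|x.2| <= B].

Definition bounded_ccv Om (M : R) v := ccv Om v /\ forall x, Om x -> 0 <= v x <= M.

(** Minimality expressed by a measurable integrand on the interior, the form that is transported by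
    rotations of the plane. *)
Definition optimal Om (M : R) u := bounded_ccv Om M u /\
  forall v, bounded_ccv Om M v ->
  (\int[leb2]_(x in Om°) (fres (rgrad Om u x))%:E <=
   \int[leb2]_(x in Om°) (fres (rgrad Om v x))%:E)%E.

Lemma ae_not_open (A : set (R * R)) x : open A -> A x -> ~ {ae leb2, forall y, ~ A y}.
Proof.
move=> oA Ax [N [mN N0 sN]].
have AN : A `<=` N by move=> y Ay; apply: sN => /= /(_ Ay).
have := leb2_open_gt0 oA Ax.
have -> : leb2 A = 0%E.
  apply/le_anti/andP; split; last exact: measure_ge0.
  by rewrite -N0; apply: le_measure => //; rewrite inE//; exact: plane_open_measurable.
by rewrite ltxx.
Qed.

Lemma fres_norm_le z : `|fres z| <= 1.
Proof. by rewrite ger0_norm ?fres_ge0// fres_le1. Qed.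

Section body.
Variables (Om : set (R * R)) (B M : R).
Hypothesis OmB : planar_body Om B.

Lemma interior_finite : (leb2 Om° < +oo)%E.
Proof.
have [_ _ _ bO] := OmB; apply: (@leb2_bounded _ _ B); first exact: interior_measurable.
by move=> x /interiorW/bO.
Qed.

Lemma body_regular_ae v : ccv Om v -> {ae leb2, forall x, Om° x -> regular Om v x}.
Proof. by have [cO _ _ bO] := OmB; move=> cv; exact: regular_ae cO cv bO. Qed.

Lemma optimal_le_eq u v : optimal Om M u -> bounded_ccv Om M v ->
  {ae leb2, forall x, Om° x -> fres (rgrad Om v x) <= fres (rgrad Om u x)} ->
  {ae leb2, forall x, Om° x -> fres (rgrad Om v x) = fres (rgrad Om u x)}.
Proof.
move=> [[cu _] Hu] bv le_ae.
apply: (@ae_eq_of_integral_le _ _ _ _ 1) => //.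
- exact: interior_measurable.
- exact: interior_finite.
- by apply: measurable_fres_rgrad => //; case: bv.
- exact: measurable_fres_rgrad.
- by move=> x _; exact: fres_norm_le.
- by move=> x _; exact: fres_norm_le.
- exact: Hu.
Qed.

Lemma optimal_reaches_top u (c : R) : optimal Om M u -> 0 < c -> c < M ->
  (forall x, Om x -> u x <= c) -> False.
Proof.
move=> ou c0 cM uc; have [[cu bu] _] := ou.
have [cO clO [x0 Ix0] bO] := OmB.
have M0 : 0 < M by exact: lt_trans cM.
have [k kE] : exists k, k = M / c by exists (M / c).
have k1 : 1 < k by rewrite kE ltr_pdivlMr ?mul1r.
have k0 : 0 < k by lra.
pose v x := k * u x.
have bv : bounded_ccv Om M v.
  split=> [x y t Ox Oy t0 t1|x Ox].
    have := ler_wpM2l (ltW k0) (cu _ _ _ Ox Oy t0 t1).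
    by rewrite /v; move: (u (seg x y t)) => w; lra.
  have /andP[u0 _] := bu _ Ox; rewrite /v mulr_ge0 ?(ltW k0)//=.
  by rewrite kE mulrAC ler_pdivrMr// ler_pM2l// uc.
have [cv _] := bv.
have gv : {ae leb2, forall x, Om° x -> rgrad Om v x = (k * (rgrad Om u x).1, k * (rgrad Om u x).2)}.
  apply: ae_app2 (body_regular_ae cu) (body_regular_ae cv) => x ru rv Ix.
  apply/esym; apply: regular_unique (rv Ix) _ => y Oy.
  have [_ _ pu _] := ru Ix.
  by have := ler_wpM2l (ltW k0) (pu _ Oy); rewrite /v /=; lra.
have sq a b : 0 <= a ^+ 2 + b ^+ 2 :> R by rewrite addr_ge0// sqr_ge0.
have le_f a b : fres (k * a, k * b) <= fres (a, b).
  rewrite /fres /= ler_pM2l// lef_pV2 ?posrE; try by rewrite ltr_pwDl// sq.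
  have k2 : 1 <= k ^+ 2 by rewrite exprn_ege1//; lra.
  by rewrite lerD2l !exprMn -mulrDr ler_peMl.
have eq_f a b : fres (k * a, k * b) = fres (a, b) -> fres (a, b) = 1.
  rewrite /fres /= !div1r => /invr_inj.
  rewrite !exprMn => E.
  have : (k ^+ 2 - 1) * (a ^+ 2 + b ^+ 2) = 0 by lra.
  have k2 : k ^+ 2 - 1 != 0 by rewrite gt_eqF// subr_gt0 exprn_egt1//; lra.
  by move/eqP; rewrite mulf_eq0 (negbTE k2)/= => /eqP ->; rewrite addr0 invr1.
have fv_le : {ae leb2, forall x, Om° x -> fres (rgrad Om v x) <= fres (rgrad Om u x)}.
  by apply: ae_app1 gv => x + Ix => /(_ Ix) ->; case: (rgrad Om u x) => a b; exact: le_f.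
have f1 : {ae leb2, forall x, Om° x -> fres (rgrad Om u x) = 1}.
  apply: ae_app2 gv (optimal_le_eq ou bv fv_le) => x + + Ix => /(_ Ix) -> /(_ Ix).
  by case: (rgrad Om u x) => a b; exact: eq_f.
have [B0 _] := bO _ (interiorW Ix0).
have {}B0 : 0 <= B by apply: le_trans B0.
(* With this slope the affine competitor stays in [[0, M]] for abscissas in [[- B, B]]; the added 1
   keeps the denominator positive. *)
have [m mD] : exists m, m = M / (2 * (B + 1)) by exists (M / (2 * (B + 1))).
have m0 : 0 < m by rewrite mD divr_gt0//; lra.
pose w x := m * (x.1 + (B + 1)).
have mE : m * (2 * (B + 1)) = M by rewrite mD divfK// gt_eqF//; lra.
have bw : bounded_ccv Om M w.
  split=> [x y t Ox Oy t0 t1|x Ox]; first by rewrite /w /seg /mv /=; lra.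
  have [+ _] := bO _ Ox; rewrite ler_norml => /andP[? ?].
  rewrite /w mulr_ge0 ?(ltW m0)//=; last lra.
  by rewrite -mE ler_pM2l//; lra.
have [cw _] := bw.
have gw : {ae leb2, forall x, Om° x -> rgrad Om w x = (m, 0)}.
  apply: ae_app1 (body_regular_ae cw) => x rw Ix.
  by apply/esym; apply: regular_unique (rw Ix) _ => y Oy; rewrite /w /=; lra.
have fw_le : {ae leb2, forall x, Om° x -> fres (rgrad Om w x) <= fres (rgrad Om u x)}.
  by apply: ae_app1 f1 => x + Ix => /(_ Ix) ->; exact: fres_le1.
apply: (@ae_not_open Om° x0 (open_interior _) Ix0).
apply: ae_app2 gw _; last first.
  by apply: ae_app2 f1 (optimal_le_eq ou bw fw_le) => x h1 h2; exact: (conj h1 h2).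
move=> x gx [h1 h2] Ix; have := h2 Ix; rewrite (h1 Ix) (gx Ix) /fres /= => /eqP.
have m2 : 0 < m ^+ 2 by rewrite exprn_gt0.
by rewrite expr0n /= addr0 div1r invr_eq1 => /eqP; lra.
Qed.

End body.
End minimality.

(** * Raising the graph over a gentle ridge *)

Section slices.
Context {R : realType}.
Notation leb := (@lebesgue_measure R).
Implicit Types (Om N : set (R * R)) (x y z : R * R).

Lemma leb2_hsec N : measurable N -> leb2 N = (\int[leb]_t leb (hsec N t))%E.
Proof.
move=> mN; rewrite -[LHS]mul1e -integral_cst// tonelli_hsec//.
by apply: eq_integral => t _; rewrite integral_cst ?mul1e//; exact: measurable_hsec.
Qed.

Lemma ae_hsec (P : R * R -> Prop) : {ae leb2, forall x, P x} ->
  {ae leb, forall t, {ae leb, forall s, P (s, t)}}.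
Proof.
move=> [N [mN N0 sN]].
have mF : measurable_fun setT (fun t => leb (hsec N t)).
  have := @measurable_tonelli_hsec R (fun=> 1%E) N mN (measurable_cst _) (fun _ _ => lee01).
  apply: eq_measurable_fun => t _ /=; rewrite integral_cst ?mul1e//; exact: measurable_hsec.
have : (\int[leb]_t `|leb (hsec N t)| = 0)%E.
  by rewrite -[RHS]N0 leb2_hsec//; apply: eq_integral => t _; rewrite gee0_abs.
move=> /(ae_eq_integral_abs leb measurableT mF).
apply: filterS => t /(_ I) h.
exists (hsec N t); split; first exact: measurable_hsec.
- exact: h.
- by move=> s /= nP; apply: sN.
Qed.

Lemma ae_point_right (P : R -> Prop) (a b : R) : {ae leb, forall s, P s} -> a < b ->
  exists2 s, a < s < b & P s.
Proof.
move=> [N [mN N0 sN]] ab; apply: contrapT => h.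
have sub : `]a, b[ `<=` N.
  move=> s /=; rewrite in_itv/= => sab; apply: sN => /= Ps; apply: h; by exists s.
have : (leb `]a, b[%classic <= leb N)%E.
  by apply: le_measure => //; rewrite inE//; exact: measurable_itv.
by rewrite N0 lebesgue_measure_itv/= lte_fin ab -EFinB lee_fin; lra.
Qed.

Lemma hsec_sup_ge Om (B : R) s t : planar_body Om B -> hsec Om° t !=set0 ->
  Om (s, t) -> s <= sup (hsec Om° t).
Proof.
move=> [cO _ _ bO] [s0 I0] Os.
have [_ uJ] := @hsec_bounds _ Om B bO Om° t (@interiorW R Om).
have leb' w : hsec Om° t w -> w <= sup (hsec Om° t) by exact: ub_le_sup.
rewrite leNgt; apply/negP => hs.
set b := sup _ in leb' hs.
have b0 : s0 <= b by exact: leb'.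
have [c /andP[bc cs]] : exists c, b < c < s by exists ((b + s) / 2); lra.
have ss0 : 0 < s - s0 by lra.
have : Om° (seg (s0, t) (s, t) ((c - s0) / (s - s0))).
  by apply: (interior_seg cO) => //; rewrite ?divr_ge0 ?ltr_pdivrMr//; lra.
rewrite (_ : seg _ _ _ = (c, t)); first by move=> /leb'; lra.
by rewrite /seg /mv /=; congr pair; field; lra.
Qed.

(** This is a supporting line of [Om] at the right end of the section. Its coefficient [m] separates
    the quotients [(y.1 - b) / (y.2 - t)] of points above ordinate [t] from those of points below;
    both kinds of points exist because the section contains an interior point. *)
Lemma hsec_right_normal Om (B : R) t : planar_body Om B -> hsec Om° t !=set0 ->
  exists m, forall y, Om y -> y.1 <= sup (hsec Om° t) + m * (y.2 - t).
Proof.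
move=> bd ne; have [cO _ _ bO] := bd; have [s0 I0] := ne.
have sg s : Om (s, t) -> s <= sup (hsec Om° t) by exact: hsec_sup_ge bd ne.
move: (sup _) sg => b sg.
have [e e0 H] := mv_near (e2 : R * R) I0.
have [h h0 he] : exists2 h, 0 < h & h < e by exists (e / 2); lra.
have Op : Om (s0, t + h).
  have := interiorW (H h _); rewrite gtr0_norm// => /(_ he).
  by rewrite /mv /= mulr0 mulr1 addr0.
have On : Om (s0, t - h).
  have := interiorW (H (- h) _); rewrite normrN gtr0_norm// => /(_ he).
  by rewrite /mv /= mulr0 mulr1 addr0.
have key y y' : Om y -> Om y' -> t < y.2 -> y'.2 < t ->
    (y.1 - b) / (y.2 - t) <= (b - y'.1) / (t - y'.2).
  move=> Oy Oy' ty ty'.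
  have d1 : 0 < y.2 - t by lra.
  have d2 : 0 < t - y'.2 by lra.
  have d3 : 0 < y.2 - y'.2 by lra.
  have : Om (seg y' y ((t - y'.2) / (y.2 - y'.2))).
    by apply: cO => //; rewrite ?divr_ge0 ?ler_pdivrMr//; lra.
  have -> : seg y' y ((t - y'.2) / (y.2 - y'.2)) =
      (y'.1 + (t - y'.2) / (y.2 - y'.2) * (y.1 - y'.1), t).
    by rewrite /seg /mv /=; congr pair; field; lra.
  move=> /sg; suff : y'.1 + (t - y'.2) / (y.2 - y'.2) * (y.1 - y'.1) <= b ->
      (y.1 - b) * (t - y'.2) <= (b - y'.1) * (y.2 - t).
    by move=> hs /hs; rewrite ler_pdivrMr// mulrAC ler_pdivlMr.
  have : (t - y'.2) / (y.2 - y'.2) * (y.2 - y'.2) = t - y'.2 by rewrite divfK// gt_eqF.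
  move: ((t - y'.2) / _) => q qE hq.
  have := ler_wpM2r (ltW d3) hq; rewrite mulrDl.
  have -> : q * (y.1 - y'.1) * (y.2 - y'.2) = (q * (y.2 - y'.2)) * (y.1 - y'.1) by ring.
  by rewrite qE; lra.
pose U := [set q | exists y, [/\ Om y, t < y.2 & q = (y.1 - b) / (y.2 - t)]].
have U0 : U !=set0 by exists ((s0 - b) / (t + h - t)), (s0, t + h); split => //=; lra.
have Ub y' : Om y' -> y'.2 < t -> ubound U ((b - y'.1) / (t - y'.2)).
  by move=> Oy' ty' _ [y [Oy ty ->]]; exact: key.
have Ubd : has_ubound U by exists ((b - s0) / (t - (t - h))); apply: (Ub (s0, t - h)) => //=; lra.
exists (sup U) => y Oy; have [yt|yt|yE] := ltgtP y.2 t.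
- have : sup U <= (b - y.1) / (t - y.2) by apply: ge_sup => //; exact: Ub.
  by rewrite ler_pdivlMr; lra.
- have : (y.1 - b) / (y.2 - t) <= sup U by apply: ub_le_sup => //; exists y.
  by rewrite ler_pdivrMr; lra.
- rewrite yE subrr mulr0 addr0; apply: sg.
  by rewrite -yE -surjective_pairing.
Qed.

End slices.

Section raising.
Context {R : realType}.
Notation leb := (@lebesgue_measure R).
Implicit Types (Om : set (R * R)) (u : R * R -> R) (x y z : R * R).

Definition aff z (c : R) x : R := c + z.1 * x.1 + z.2 * x.2.

(** With [p = - z.1], the affine function [1 - p / 2] equals [1 / (1 + p^2)] at 0 and is tangent to
    it at 1. The lens is where [fres] exceeds it by more than [k]. The condition [-1 < z.1] discards
    the region beyond the tangency, which leaves slopes below -1 at the disposal of the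
    majorants. *)
Definition lens (k : R) : set (R * R) := [set z | -1 < z.1 /\ 1 + k + z.1 / 2 < fres z].

Lemma fres_den_gt0 z : 0 < 1 + (z.1 ^+ 2 + z.2 ^+ 2).
Proof. by have := sqr_ge0 z.1; have := sqr_ge0 z.2; lra. Qed.

Lemma lens_lt0 k z : 0 < k -> lens k z -> z.1 < 0.
Proof. by move=> k0 [_]; have := fres_le1 z; lra. Qed.

Lemma notin_lens k z : 0 < k -> ~ lens k z -> -1 <= z.1 -> fres z <= 1 + k + z.1 / 2.
Proof.
move=> k0 nz; rewrite le_eqVlt => /predU1P[E|z1]; last first.
  by rewrite leNgt; apply/negP => h; apply: nz.
rewrite /fres ler_pdivrMr ?fres_den_gt0// -E.
have := sqr_ge0 z.2; nra.
Qed.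

Lemma lens_open k z : lens k z -> exists2 e, 0 < e &
  forall z', `|z'.1 - z.1| <= e -> `|z'.2 - z.2| <= e -> lens k z'.
Proof.
pose g (w : R * R) : R := (1 + k + w.1 / 2) * (1 + (w.1 * w.1 + w.2 * w.2)).
have gE w : (1 + k + w.1 / 2 < fres w) = (g w < 1).
  by rewrite /fres ltr_pdivlMr ?fres_den_gt0// /g !expr2.
have c1 : continuous (fun w : R * R => w.1) by move=> w; exact: cvg_fst.
have c2 : continuous (fun w : R * R => w.2) by move=> w; exact: cvg_snd.
have cst (c : R) : continuous (fun w : R * R => c) by move=> w; exact: cvg_cst.
have cg : continuous g.
  move=> w; apply: cvgM; apply: cvgD; try exact: cst.
    by apply: cvgM; [exact: c1|exact: cst].
  by apply: cvgD; apply: cvgM; (exact: c1 || exact: c2).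
move=> [z1]; rewrite gE => gz.
have oA : open ([set w | -1 < w.1] `&` [set w | g w < 1]).
  by apply: openI; [apply: (open_comp (f := fst)) (@open_gt R (-1))|apply: (open_comp (f := g)) (@open_lt R 1)] => w _; [exact: c1|exact: cg].
have /plane_openP/(_ z (conj z1 gz))[e e0 H] := oA.
exists (e / 2); first by lra.
move=> z' h1 h2; have [||w1 gw] := H z'; [lra|lra|].
by split => //; rewrite gE.
Qed.

(** The excess of [fres] at [(- p, 0)] is [p (1 - p)^2 / (2 (1 + p^2))]; [c0] bounds it below using
    [p >= a / 2], [1 - p >= (1 - b) / 2] and [1 + p^2 <= 2]. Half of [c0] is spent on [k] and a
    quarter on the second coordinate. *)
Lemma lens_segment (a b : R) : 0 < a -> a <= b -> b < 1 -> exists k r, [/\ 0 < k, 0 < r &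
  forall z, a - r <= - z.1 -> - z.1 <= b + r -> `|z.2| <= r -> lens k z].
Proof.
move=> a0 ab b1.
pose c0 := a / 2 * ((1 - b) / 2) ^+ 2 / 4.
have c00 : 0 < c0 by rewrite !mulr_gt0 ?exprn_gt0 ?invr_gt0//; lra.
have c01 : c0 <= 1.
  have : ((1 - b) / 2) ^+ 2 <= 1 by rewrite expr_le1//; lra.
  have : 0 <= ((1 - b) / 2) ^+ 2 by exact: sqr_ge0.
  rewrite /c0; move: (((1 - b) / 2) ^+ 2) => w w0 w1; nra.
pose r := Num.min (c0 / 4) (Num.min (a / 2) ((1 - b) / 2)).
have r0 : 0 < r by rewrite !lt_min; apply/and3P; split; lra.
have [rc ra rb] : [/\ r <= c0 / 4, r <= a / 2 & r <= (1 - b) / 2].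
  by rewrite /r !ge_min !lexx !orbT.
exists (c0 / 2), r; split => //; first lra.
move=> [z1 q] /=; have z1E : z1 = - - z1 by rewrite opprK.
rewrite [X in lens _ (X, _)]z1E; move: (- z1) => p pa pb qr {z1E}.
have p0 : a / 2 <= p by lra.
have p1 : (1 - b) / 2 <= 1 - p by lra.
split => /=; first by lra.
have q2 : q ^+ 2 <= c0 / 4.
  rewrite -real_normK ?num_real//.
  have : `|q| ^+ 2 <= r ^+ 2 by rewrite ler_sqr ?nnegrE// ltW.
  have : r ^+ 2 <= r by rewrite expr2 ler_piMr//; lra.
  lra.
have F : c0 <= 1 / (1 + p ^+ 2) - (1 - p / 2).
  have dp : 0 < 1 + p ^+ 2 by have := sqr_ge0 p; lra.
  have -> : 1 / (1 + p ^+ 2) - (1 - p / 2) = p * (1 - p) ^+ 2 / (2 * (1 + p ^+ 2)).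
    by field; lra.
  rewrite ler_pdivlMr ?mulr_gt0//.
  have p2 : p ^+ 2 <= 1 by rewrite expr_le1//; lra.
  have h : ((1 - b) / 2) ^+ 2 <= (1 - p) ^+ 2 by rewrite ler_sqr ?nnegrE//; lra.
  have : a / 2 * ((1 - b) / 2) ^+ 2 <= p * (1 - p) ^+ 2.
    by apply: ler_pM => //; [lra|exact: sqr_ge0].
  have : 0 <= p ^+ 2 by exact: sqr_ge0.
  move: c00; rewrite /c0; move: (a / 2 * _) (p * _) p2 => w w'.
  move: (p ^+ 2) => P P1 w0 P0 ww'.
  have : 0 <= w * (1 - P) by rewrite mulr_ge0//; lra.
  by lra.
have Q : 1 / (1 + p ^+ 2) - q ^+ 2 <= fres (- p, q).
  rewrite /fres /= sqrrN.
  have P0 := sqr_ge0 p; have Q0 := sqr_ge0 q.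
  move: (p ^+ 2) (q ^+ 2) P0 Q0 => P Q P0 Q0.
  rewrite -subr_ge0.
  have -> : 1 / (1 + (P + Q)) - (1 / (1 + P) - Q) =
     Q * ((1 + (P + Q)) * (1 + P) - 1) / ((1 + (P + Q)) * (1 + P)) by field; lra.
  rewrite divr_ge0// ?mulr_ge0//; nra.
by lra.
Qed.

End raising.

Section raised_function.
Context {R : realType}.
Notation leb := (@lebesgue_measure R).
Variables (Om : set (R * R)) (B M : R) (u : R * R -> R) (k : R).
Hypotheses (OmB : planar_body Om B) (ou : optimal Om M u) (k0 : 0 < k).
Implicit Types (x y z : R * R).

Definition majorant z (c : R) := ~ lens k z /\ forall y, Om y -> u y <= aff z c y.
Definition raised x : R := inf [set r | exists z c, majorant z c /\ r = aff z c x].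

Let cO : cvx Om. Proof. by case: OmB. Qed.
Let cu : ccv Om u. Proof. by case: ou => -[]. Qed.
Let bu x : Om x -> 0 <= u x <= M. Proof. by case: ou => -[_ bu] _; exact: bu. Qed.
Let bO x : Om x -> `|x.1| <= B /\ `|x.2| <= B. Proof. by case: OmB => _ _ _; exact. Qed.

Lemma const_majorant : majorant (0, 0) M.
Proof.
split=> [[_ /=]|y Oy]; last by have /andP[_] := bu Oy; rewrite /aff /=; lra.
by rewrite mul0r addr0; have := fres_le1 (0 : R, 0 : R); move: (fres _) k0 => f ? ? ?; lra.
Qed.

Lemma raised_has_inf x : Om x -> has_inf [set r | exists z c, majorant z c /\ r = aff z c x].
Proof.
move=> Ox; split; first by exists (aff (0, 0) M x), (0, 0), M; split => //; exact: const_majorant.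
by exists (u x) => _ [z [c [[_ H] ->]]]; exact: H.
Qed.

Lemma raised_ge x : Om x -> u x <= raised x.
Proof.
move=> Ox; apply: lb_le_inf; first by case: (raised_has_inf Ox).
by move=> _ [z [c [[_ H] ->]]]; exact: H.
Qed.

Lemma raised_le z c x : majorant z c -> Om x -> raised x <= aff z c x.
Proof.
move=> mz Ox; apply: ge_inf; first by case: (raised_has_inf Ox).
by exists z, c.
Qed.

Lemma raised_adherent x e : Om x -> 0 < e -> exists z c, majorant z c /\ aff z c x < raised x + e.
Proof.
move=> Ox e0; have [_ [z [c [mz ->]]] h] := inf_adherent e0 (raised_has_inf Ox).
by exists z, c.
Qed.

Lemma raised_ccv : ccv Om raised.
Proof.
move=> x y t Ox Oy t0 t1; apply: lb_le_inf; first by case: (raised_has_inf (cO Ox Oy t0 t1)).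
move=> _ [z [c [mz ->]]].
have -> : aff z c (seg x y t) = (1 - t) * aff z c x + t * aff z c y.
  by rewrite /aff /seg /mv /=; ring.
have t1' : 0 <= 1 - t by lra.
by have := ler_wpM2l t1' (raised_le mz Ox); have := ler_wpM2l t0 (raised_le mz Oy); lra.
Qed.

Lemma raised_bounded : bounded_ccv Om M raised.
Proof.
split; first exact: raised_ccv.
move=> x Ox; have /andP[u0 _] := bu Ox; rewrite (le_trans u0 (raised_ge Ox))/=.
by have := raised_le const_majorant Ox; rewrite /aff /=; lra.
Qed.

Notation gu := (rgrad Om u).
Notation gv := (rgrad Om raised).

Lemma raised_grad_eq x : regular Om u x -> regular Om raised x -> raised x = u x -> gv x = gu x.
Proof.
move=> ru [Ix _ pv _] E; apply: regular_unique ru _ => y Oy.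
by apply: le_trans (raised_ge Oy) _; rewrite -E; exact: pv.
Qed.

Lemma aff_through z (h : R) x y :
  aff z (h - z.1 * x.1 - z.2 * x.2) y = h + z.1 * (y.1 - x.1) + z.2 * (y.2 - x.2).
Proof. by rewrite /aff; ring. Qed.

Lemma raised_grad_u x : regular Om u x -> u x < raised x -> lens k (gu x).
Proof.
move=> [Ix _ pu _] ur; apply: contrapT => nl; move: ur; apply/negP; rewrite -leNgt.
have := @raised_le (gu x) (u x - (gu x).1 * x.1 - (gu x).2 * x.2) x.
rewrite aff_through !subrr !mulr0 !addr0; apply; last exact: interiorW.
by split => // y Oy; rewrite aff_through; exact: pu.
Qed.

(** The infimum need not be attained, but by regularity the slopes of nearly optimal majorants are
    close to the gradient, and the lens is open. *)
Lemma raised_grad_v_notin x : regular Om raised x -> ~ lens k (gv x).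
Proof.
move=> [Ix _ _ ex] /lens_open[e e0 He]; have [r r0 H] := ex _ e0.
have [z [c [mz zx]]] := raised_adherent (interiorW Ix) r0.
have pz : plane_above Om raised (aff z c x) z x.
  by move=> y Oy; apply: le_trans (raised_le mz Oy) _; rewrite /aff; lra.
have [h1 h2] := H _ _ pz (ltW zx).
by case: mz => + _; apply; exact: He.
Qed.

(** The convex combination of the tangent planes of [u] and [raised] with weight [t] still majorizes
    [u] and passes strictly below [raised x]; only its slope can have excluded it. *)
Lemma raised_grad_path x t : regular Om u x -> regular Om raised x -> u x < raised x ->
  0 < t -> t <= 1 ->
  lens k ((gv x).1 + t * ((gu x).1 - (gv x).1), (gv x).2 + t * ((gu x).2 - (gv x).2)).
Proof.
move=> [Ix _ pu _] [_ _ pv _] ur t0 t1; apply: contrapT.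
move: (gu x) (gv x) pu pv => zu zv pu pv; set z : R * R := (_, _) => nz.
pose h := raised x + t * (u x - raised x).
have := @raised_le z (h - z.1 * x.1 - z.2 * x.2) x.
rewrite aff_through !subrr !mulr0 !addr0 => H.
have : raised x <= h.
  apply: H; last exact: interiorW.
  split=> // y Oy; rewrite aff_through /z /h /=.
  have t1' : 0 <= 1 - t by lra.
  have := ler_wpM2l (ltW t0) (pu _ Oy).
  have := ler_wpM2l t1' (pv _ Oy); have := ler_wpM2l t1' (raised_ge Oy).
  by lra.
have : 0 < t * (raised x - u x) by rewrite mulr_gt0//; lra.
by rewrite /h; lra.
Qed.

(** The segment of [raised_grad_path] starts between the lines [z.1 = -1] and [z.1 = 0] and cannot
    cross them, since the lens meets neither. *)
Lemma raised_grad_v_itv x : regular Om u x -> regular Om raised x -> u x < raised x ->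
  -1 <= (gv x).1 <= 0.
Proof.
move=> ru rv ur; have lu := raised_grad_u ru ur.
have [u1 _] := lu; have u0 := lens_lt0 k0 lu.
have path t := @raised_grad_path x t ru rv ur.
move: (gu x) (gv x) path u1 u0 => zu zv path u1 u0.
apply/andP; split; rewrite leNgt; apply/negP => v1.
  have d0 : 0 < zu.1 - zv.1 by lra.
  have h0 : 0 < (-1 - zv.1) / (zu.1 - zv.1) by rewrite divr_gt0//; lra.
  have h1 : (-1 - zv.1) / (zu.1 - zv.1) <= 1 by rewrite ler_pdivrMr//; lra.
  by case: (path _ h0 h1) => /= + _; rewrite divfK ?gt_eqF//; lra.
have d0 : 0 < zv.1 - zu.1 by lra.
have h0 : 0 < zv.1 / (zv.1 - zu.1) by rewrite divr_gt0.
have h1 : zv.1 / (zv.1 - zu.1) <= 1 by rewrite ler_pdivrMr//; lra.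
have := lens_lt0 k0 (path _ h0 h1); rewrite /= -(opprB zv.1) mulrN divfK ?gt_eqF//.
by rewrite subrr ltxx.
Qed.

Definition gap : set (R * R) := [set x | Om° x /\ u x < raised x].

Lemma gap_open : open gap.
Proof.
apply/plane_openP => x [Ix ux].
have e0 : 0 < (raised x - u x) / 2 by lra.
have [r1 r10 H1] := ccv_continuous cu Ix e0.
have [r2 r20 H2] := ccv_continuous raised_ccv Ix e0.
exists (Num.min r1 r2); first by rewrite lt_min r10.
move=> y; rewrite !lt_min => /andP[a1 a2] /andP[b1 b2].
have [Iy h1] := H1 _ a1 b1; have [_ h2] := H2 _ a2 b2; split => //.
by move: h1 h2; rewrite !ltr_norml => /andP[? ?] /andP[? ?]; lra.
Qed.

Lemma gap_measurable : measurable gap.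
Proof. by apply: plane_open_measurable; exact: gap_open. Qed.

(* On the gap both slopes [- z.1] lie in [0, 1] at almost every point; the
   clamping only matters on a null set and makes the function bounded. *)
Definition gap_slope (w : R * R -> R) x : R :=
  Num.min 1 (pos (- rder Om w e1 x)) * \1_gap x.

Lemma gap_slope_ge0 w x : 0 <= gap_slope w x.
Proof. by rewrite mulr_ge0// le_min ler01 pos_ge0. Qed.

Lemma gap_slope_le1 w x : gap_slope w x <= 1.
Proof.
rewrite /gap_slope indicE; case: (x \in gap); rewrite ?mulr0 ?mulr1//.
by rewrite ge_min lexx.
Qed.

Lemma measurable_gap_slope w : ccv Om w -> measurable_fun Om° (gap_slope w).
Proof.
move=> cw; apply: measurable_funM.
  apply: measurable_minr; first exact: measurable_cst.
  by apply: measurable_pos; apply/measurable_funN; exact: measurable_rder.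
by apply: measurable_funTS; exact: measurable_indic gap_measurable.
Qed.

Lemma gap_slopeE w x : gap x -> -1 <= (rgrad Om w x).1 -> (rgrad Om w x).1 <= 0 ->
  gap_slope w x = - (rgrad Om w x).1.
Proof.
rewrite /gap_slope indicE => gx; rewrite mem_set//= mulr1 => h1 h2.
rewrite /pos; have -> : Num.max (- rder Om w e1 x) 0 = - rder Om w e1 x by apply/max_idPl; lra.
by apply/min_idPr; lra.
Qed.

Lemma gap_slope_out w x : ~ gap x -> gap_slope w x = 0.
Proof. by move=> gx; rewrite /gap_slope indicE memNset// mulr0. Qed.

Definition good x := regular Om u x /\ regular Om raised x.

Lemma good_ae : {ae leb2, forall x, Om° x -> good x}.
Proof.
apply: ae_app2 (body_regular_ae OmB cu) (body_regular_ae OmB raised_ccv) => x h1 h2 Ix.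
by split; [exact: h1|exact: h2].
Qed.

(** The last two bounds put the integrands of [raised] and [u] on opposite sides of one affine
    function of the first slope. *)
Lemma good_gap x : good x -> gap x -> [/\ gap_slope u x = - (gu x).1,
  gap_slope raised x = - (gv x).1, fres (gv x) <= 1 + k + (gv x).1 / 2 &
  1 + k + (gu x).1 / 2 < fres (gu x)].
Proof.
move=> [ru rv] gx; have [_ ux] := gx.
have lu := raised_grad_u ru ux; have [u1 uf] := lu.
have /andP[v1 v0] := raised_grad_v_itv ru rv ux.
have vf := notin_lens k0 (raised_grad_v_notin rv) v1.
have u0 := lens_lt0 k0 lu.
by split => //; apply: gap_slopeE => //; exact: ltW.
Qed.

End raised_function.

Lemma ae_mono d (T : measurableType d) (R : realType) (mu : {measure set T -> \bar R})
    (P S : T -> Prop) : (forall x, P x -> S x) ->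
  {ae mu, forall x, P x} -> {ae mu, forall x, S x}.
Proof.
by move=> H [N [mN N0 sN]]; exists N; split => // x /= nS; apply: sN => /= /H.
Qed.

(** * Comparison of the raised function with the original along horizontal lines *)

Section raised_slices.
Context {R : realType}.
Notation leb := (@lebesgue_measure R).
Variables (Om : set (R * R)) (B M : R) (u : R * R -> R) (k : R).
Hypotheses (OmB : planar_body Om B) (ou : optimal Om M u) (k0 : 0 < k).
Implicit Types (x y z : R * R).
Notation raised := (raised Om u k).
Notation gap := (gap Om u k).
Notation gap_slope := (gap_slope Om u k).
Notation good := (good Om u k).

Let cO : cvx Om. Proof. by case: OmB. Qed.
Let cu : ccv Om u. Proof. by case: ou => -[]. Qed.
Let cv : ccv Om raised. Proof. exact: raised_ccv OmB ou k0. Qed.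
Let bO x : Om x -> `|x.1| <= B /\ `|x.2| <= B. Proof. by case: OmB => _ _ _; exact. Qed.

Lemma not_gap x : Om° x -> ~ gap x -> raised x = u x.
Proof.
move=> Ix ng; apply/le_anti/andP; split; last exact: (raised_ge ou k0 (interiorW Ix)).
by rewrite leNgt; apply/negP => h; apply: ng.
Qed.

(** Adding [b + m * (y.2 - x.2) - y.1], nonnegative on [Om], to the tangent plane of [u] gives
    another majorant. Its first slope is lower by 1, hence below -1 on the gap and outside the lens,
    and its excess over [u] at [x] is [b - x.1]. *)
Lemma raised_right_end x (b m : R) : good x ->
  (forall y, Om y -> y.1 <= b + m * (y.2 - x.2)) -> raised x - u x <= b - x.1.
Proof.
move=> gx Hm; have [ru rv] := gx; have [Ix _ pu _] := ru.
have [gpx|ng] := pselect (gap x); last first.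
  rewrite (not_gap Ix ng) subrr; have := Hm _ (interiorW Ix).
  by rewrite subrr mulr0 addr0 => ?; rewrite subr_ge0.
have [_ ux] := gpx; have lu := raised_grad_u ou k0 ru ux; have u0 := lens_lt0 k0 lu.
move: (rgrad Om u x) pu u0 => zu pu u0.
pose z : R * R := (zu.1 - 1, zu.2 + m); pose h := u x + (b - x.1).
have := @raised_le _ _ _ _ _ ou k0 z (h - z.1 * x.1 - z.2 * x.2) x.
rewrite aff_through !subrr !mulr0 !addr0 => H.
suff : raised x <= h by rewrite /h; lra.
apply: H; last exact: interiorW.
split=> [[+ _]|y Oy]; first by rewrite /z /=; lra.
rewrite aff_through /z /h /=; have := pu _ Oy; have := Hm _ Oy; lra.
Qed.

Lemma good_balance x : Om° x -> good x ->
  gap_slope u x = gap_slope raised x + (rder Om raised e1 x - rder Om u e1 x).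
Proof.
move=> Ix gx; have [gpx|ng] := pselect (gap x).
  by have [-> -> _ _] := good_gap ou k0 gx gpx; rewrite /rgrad /=; ring.
rewrite !gap_slope_out//; have [ru rv] := gx.
have := raised_grad_eq ou k0 ru rv (not_gap Ix ng).
by rewrite /rgrad => -[-> _]; ring.
Qed.

Lemma measurable_gap_slope_hsec w t : ccv Om w ->
  measurable_fun (hsec Om° t) (fun s => gap_slope w (s, t)).
Proof.
move=> cw; apply/measurable_EFinP.
apply: (@measurable_fun_hsec _ (fun x => (gap_slope w x)%:E)); first exact: interior_measurable.
by apply/measurable_EFinP; exact: (measurable_gap_slope OmB ou k0 cw).
Qed.

(** By [good_balance] the two integrals over [[s, c]] differ by the increment of [raised - u], which
    is nonnegative at [s] and, by [raised_right_end], at most [b - c] at [c]. *)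
Lemma gap_slope_slice (t : R) : {ae leb, forall s, Om° (s, t) -> good (s, t)} ->
  (\int[leb]_(s in hsec Om° t) (gap_slope u (s, t))%:E <=
   \int[leb]_(s in hsec Om° t) (gap_slope raised (s, t))%:E)%E.
Proof.
move=> good_t; have [ne|/set0P/negP/negPn/eqP ->] := pselect (hsec Om° t !=set0); last first.
  by rewrite !integral_set0.
have [m Hm] := hsec_right_normal OmB ne.
have [lJ uJ] := @hsec_bounds _ Om B bO Om° t (@interiorW R Om).
have JE := open_interval_itv (@hsec_open _ Om° t (open_interior Om))
  (hsec_interval (interior_cvx cO) (t := t)) lJ uJ.
have mu' := measurable_gap_slope_hsec (t := t) cu; have mv' := measurable_gap_slope_hsec (t := t) cv.
have mru := @measurable_rder_hsec _ Om u cu e1 t; have mrv := @measurable_rder_hsec _ Om raised cv e1 t.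
have su := @rder_hselection _ Om u cu t; have sv := @rder_hselection _ Om raised cv t.
have inJ s : hsec Om° t s -> Om° (s, t) by [].
move: (inf _) (sup _) JE Hm => a b JE Hm.
rewrite JE in mu' mv' mru mrv su sv inJ *.
apply/lee_addgt0Pr => e e0.
have ge0 w s : (0 <= (gap_slope w (s, t))%:E)%E by rewrite lee_fin gap_slope_ge0.
apply: integral_oo_le => //.
- by rewrite adde_ge0 ?lee_fin ?(ltW e0)//; apply: integral_ge0.
- exact/measurable_EFinP.
move=> s s' as_ ss' s'b.
(* Good points have full measure on this line, so one can be taken beyond [s'] and within [e] of the
   right end. *)
have [c /andP[mc cb] gc] : exists2 c, Num.max s' (b - e) < c < b & Om° (c, t) -> good (c, t).
  by apply: ae_point_right => //; rewrite gt_max s'b; lra.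
move: mc; rewrite gt_max => /andP[s'c ec].
exists s, c; split => //; first exact: ltW.
have sc : s <= c by rewrite (le_trans ss')// ltW.
have sub : `[s, c] `<=` (`]a, b[ : set R).
  by move=> r /=; rewrite !in_itv/= => /andP[? ?]; apply/andP; split; lra.
have Ic : Om° (c, t) by apply: inJ; rewrite /= in_itv/=; apply/andP; split; lra.
have Is : Om° (s, t) by apply: inJ; rewrite /= in_itv/=; apply/andP; split; lra.
have mS (f : R -> R) : measurable_fun `]a, b[ f -> measurable_fun `[s, c] f.
  by move=> mf; apply: measurable_funS mf.
have su' := slope_selectionS sub su; have sv' := slope_selectionS sub sv.
have iu := slope_selection_integrable (mS _ mru) su'.
have iv := slope_selection_integrable (mS _ mrv) sv'.
have ip : leb.-integrable `[s, c] (EFin \o (fun s => gap_slope raised (s, t))).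
  apply: measurable_bounded_integrable => //; last 2 first.
  - exact: mS.
  - exists 1; split; first exact: num_real.
    move=> r r1 q _ /=; rewrite ger0_norm ?gap_slope_ge0//.
    by apply: le_trans (ltW r1); exact: gap_slope_le1.
  by rewrite /= lebesgue_measure_itv/=; case: ifP => // _; rewrite -EFinB ltry.
have -> : (\int[leb]_(r in `[s, c]) (gap_slope u (r, t))%:E =
   \int[leb]_(r in `[s, c]) ((gap_slope raised (r, t))%:E +
     ((rder Om raised e1 (r, t))%:E - (rder Om u e1 (r, t))%:E)))%E.
  apply: ae_eq_integral => //.
  - by apply/measurable_EFinP; exact: mS.
  - apply: emeasurable_funD; first by apply/measurable_EFinP; exact: mS.
    by apply: emeasurable_funB; apply/measurable_EFinP; exact: mS.
  - move: good_t; apply: ae_mono => r gr rsc.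
    have Ir : Om° (r, t) by apply: inJ; exact: sub.
    by rewrite (good_balance Ir (gr Ir)) EFinD EFinB.
have IB : (\int[leb]_(r in `[s, c])
    ((rder Om raised e1 (r, t))%:E - (rder Om u e1 (r, t))%:E) =
    (raised (c, t) - raised (s, t))%:E - (u (c, t) - u (s, t))%:E)%E.
  rewrite integralB// (slope_selection_integral sc (mS _ mrv) sv').
  by rewrite (slope_selection_integral sc (mS _ mru) su').
rewrite integralD//; last by apply: (integrableB _ iv iu).
rewrite IB.
apply: leeD.
  apply: ge0_subset_integral => //; first exact/measurable_EFinP.
rewrite -!EFinB lee_fin.
have := raised_right_end (gc Ic) Hm; have := raised_ge ou k0 (interiorW Is).
by rewrite /=; lra.
Qed.

Lemma gap_slope_le :
  (\int[leb2]_(x in Om°) (gap_slope u x)%:E <= \int[leb2]_(x in Om°) (gap_slope raised x)%:E)%E.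
Proof.
have ge0 w x : (0 <= (gap_slope w x)%:E)%E by rewrite lee_fin gap_slope_ge0.
have mI : measurable Om° by exact: interior_measurable.
have mg w : ccv Om w -> measurable_fun Om° (fun x => (gap_slope w x)%:E).
  by move=> cw; apply/measurable_EFinP; exact: (measurable_gap_slope OmB ou k0 cw).
rewrite (tonelli_hsec mI (mg _ cu) (fun x _ => ge0 u x)).
rewrite (tonelli_hsec mI (mg _ cv) (fun x _ => ge0 raised x)).
apply: ae_ge0_le_integral => //.
- by move=> t _; apply: integral_ge0.
- exact: (measurable_tonelli_hsec mI (mg _ cu) (fun x _ => ge0 u x)).
- by move=> t _; apply: integral_ge0.
- exact: (measurable_tonelli_hsec mI (mg _ cv) (fun x _ => ge0 raised x)).
by move: (ae_hsec (good_ae OmB ou k0)); apply: ae_mono => t gt _; exact: gap_slope_slice.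
Qed.

(** The weight [2^-1] is the slope of the affine function in the lens: at good points of the gap
    [phi <= 1 + k < psi]. Minimality and [gap_slope_le] order the integrals the other way, so the
    open set [gap] would be null. *)
Lemma gap_empty x : ~ gap x.
Proof.
move=> gx.
have mI : measurable Om° by exact: interior_measurable.
pose phi x := fres (rgrad Om raised x) + 2^-1 * gap_slope raised x.
pose psi x := fres (rgrad Om u x) + 2^-1 * gap_slope u x.
have mphi (w : R * R -> R) : ccv Om w -> measurable_fun Om° (fun x => fres (rgrad Om w x) + 2^-1 * gap_slope w x).
  move=> cw; apply: measurable_funD; first exact: measurable_fres_rgrad.
  by apply: measurable_funM; [exact: measurable_cst|exact: (measurable_gap_slope OmB ou k0 cw)].
have bphi (w : R * R -> R) y : `|fres (rgrad Om w y) + 2^-1 * gap_slope w y| <= 2.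
  have := fres_le1 (rgrad Om w y); have := fres_ge0 (rgrad Om w y).
  have := gap_slope_le1 Om u k w y; have := gap_slope_ge0 Om u k w y => ? ? ? ?.
  by rewrite ger0_norm; lra.
have int_phi (w : R * R -> R) : ccv Om w ->
   (\int[leb2]_(x in Om°) (fres (rgrad Om w x) + 2^-1 * gap_slope w x)%:E =
    \int[leb2]_(x in Om°) (fres (rgrad Om w x))%:E +
    (2^-1)%:E * \int[leb2]_(x in Om°) (gap_slope w x)%:E)%E.
  move=> cw; under eq_integral do rewrite EFinD.
  have m1 : measurable_fun Om° (fun x => (fres (rgrad Om w x))%:E).
    by apply/measurable_EFinP; exact: measurable_fres_rgrad.
  have m2 : measurable_fun Om° (fun x => (gap_slope w x)%:E).
    by apply/measurable_EFinP; exact: (measurable_gap_slope OmB ou k0 cw).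
  rewrite ge0_integralD//; first last.
  - apply/measurable_EFinP; apply: measurable_funM; [exact: measurable_cst|exact: (measurable_gap_slope OmB ou k0 cw)].
  - by move=> y _; rewrite lee_fin mulr_ge0 ?gap_slope_ge0.
  - by move=> y _; rewrite lee_fin fres_ge0.
  rewrite -ge0_integralZl_EFin// => y _; rewrite lee_fin gap_slope_ge0//.
have cmp y : Om° y -> good y -> phi y <= psi y /\ (gap y -> phi y < psi y).
  move=> Iy gy; have [gpy|ng] := pselect (gap y).
    have [E1 E2 h1 h2] := good_gap ou k0 gy gpy.
    by rewrite /phi /psi E1 E2; move: (fres _) (fres _) h1 h2 => *; split => [|_]; lra.
  rewrite /phi /psi !gap_slope_out//; have [ru rv] := gy.
  by rewrite (raised_grad_eq ou k0 ru rv (not_gap Iy ng)).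
have gae := good_ae OmB ou k0.
have : {ae leb2, forall y, Om° y -> phi y = psi y}.
  apply: (@ae_eq_of_integral_le _ _ _ _ 2) => //.
  - exact: interior_finite OmB.
  - exact: mphi.
  - exact: mphi.
  - by move=> y _; exact: bphi.
  - by move=> y _; exact: bphi.
  - by apply: ae_app1 gae => y h Iy; have [] := cmp _ Iy (h Iy).
  rewrite !int_phi//; apply: leeD.
    by case: ou => _; apply; exact: raised_bounded OmB ou k0.
  by rewrite lee_pmul2l ?gap_slope_le// lte_fin invr_gt0.
move=> h; apply: (ae_not_open (gap_open OmB ou k0) gx).
apply: ae_app2 h gae => y h1 h2 gy; have [Iy _] := gy.
by have [_ /(_ gy)] := cmp _ Iy (h2 Iy); rewrite (h1 Iy) ltxx.
Qed.

End raised_slices.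

Section gentle_ridge.
Context {R : realType}.
Implicit Types (Om : set (R * R)) (u : R * R -> R) (x y z d : R * R).

(* The tangent cone of the hypograph at [(x0, u x0)] contains the direction [(d, h)]. *)
Definition reaches Om u x0 d (h : R) := forall e, 0 < e -> exists2 s0, 0 < s0 &
  forall s, 0 < s -> s <= s0 -> exists x, [/\ Om x, `|x.1 - x0.1 - s * d.1| <= e * s,
    `|x.2 - x0.2 - s * d.2| <= e * s & u x0 + s * (h - e) <= u x].

(** An affine majorant almost touching at [x0] cannot descend faster than a direction of the tangent
    cone, up to an error proportional to [e]. *)
Lemma reaches_slope Om u x0 d h e s z (c : R) x : 0 < s -> 0 < e ->
  (forall y, Om y -> u y <= aff z c y) -> aff z c x0 <= u x0 + e * s ->
  Om x -> `|x.1 - x0.1 - s * d.1| <= e * s -> `|x.2 - x0.2 - s * d.2| <= e * s ->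
  u x0 + s * (h - e) <= u x ->
  h - e * (2 + (`|z.1| + `|z.2|)) <= z.1 * d.1 + z.2 * d.2.
Proof.
move=> s0 e0 zu zx0 Ox h1 h2 ux; rewrite -(ler_pM2l s0).
have n (p q : R) : `|q| <= e * s -> p * q <= `|p| * (e * s).
  by move=> qs; apply: le_trans (ler_norm _) _; rewrite normrM ler_wpM2l.
have := n z.1 _ h1; have := n z.2 _ h2; have := zu _ Ox; rewrite /aff in zx0 *.
by move: `|z.1| `|z.2| => p q; lra.
Qed.

(** The errors involve the very slopes to be estimated. The bounds give
    [A <= b + 2 * S <= 1 + (2 + A) / 4], hence [A <= 2], and then [S <= 4 * e]. *)
Lemma slope_estimate (p q e a b r : R) : 0 < e -> e <= 1 / 8 -> 4 * e <= r ->
  0 < a -> a <= b -> b < 1 ->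
  a - e * (2 + (`|p| + `|q|)) <= - p -> - b - e * (2 + (`|p| + `|q|)) <= p ->
  - (e * (2 + (`|p| + `|q|))) <= q -> - (e * (2 + (`|p| + `|q|))) <= - q ->
  [/\ a - r <= - p, - p <= b + r & `|q| <= r].
Proof.
have [A AE] : exists A, A = `|p| + `|q| by eexists.
have [S SE] : exists S, S = e * (2 + A) by eexists.
rewrite -AE -SE => e0 e8 er a0 ab b1 B1 B2 B3 B4.
have n2 : `|q| <= S by rewrite ler_norml; apply/andP; split; lra.
have n1 : `|p| <= b + S by rewrite ler_norml; apply/andP; split; lra.
have A0 : 0 <= A by rewrite AE addr_ge0.
have SA : S <= 1 / 8 * (2 + A) by rewrite SE ler_wpM2r//; lra.
have A2 : A <= 2 by lra.
have Sr : S <= r.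
  by apply: le_trans er; rewrite SE mulrC ler_wpM2r ?(ltW e0)//; lra.
split; [lra|lra|exact: le_trans Sr].
Qed.

(** If [raised] did not exceed [u] at [x0], nearly optimal majorants there would have slopes close
    to the segment joining those of the faces, that is, inside the lens. As [x0] may be a boundary
    point, the gap itself is reached by moving slightly towards an interior point: the first face
    bounds [u] from above there, and concavity bounds [raised] from below. *)
Lemma gentle_ridge_false Om (B M : R) u x0 (a b : R) : planar_body Om B -> optimal Om M u ->
  Om x0 -> 0 < a -> a <= b -> b < 1 ->
  reaches Om u x0 (-1, 0) a -> reaches Om u x0 (1, 0) (- b) ->
  reaches Om u x0 (0, 1) 0 -> reaches Om u x0 (0, -1) 0 ->
  (forall x, Om x -> u x <= u x0 - a * (x.1 - x0.1)) -> False.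
Proof.
move=> OmB ou Ox0 a0 ab b1 rl rr ru rd ua.
have [k [r [k0 r0 Hk]]] := lens_segment a0 ab b1.
have [cO _ [c Ic] _] := OmB.
have lt_x0 : u x0 < raised Om u k x0.
  rewrite ltNge; apply/negP => le_x0.
  have [e [e0 e8 er]] : exists e, [/\ 0 < e, e <= 1 / 8 & 4 * e <= r].
    exists (Num.min (1 / 8) (r / 4)); split.
    - by rewrite lt_min; lra.
    - by rewrite ge_min lexx.
    - have : Num.min (1 / 8) (r / 4) <= r / 4 by rewrite ge_min lexx orbT.
      by lra.
  have [s1 s10 H1] := rl _ e0; have [s2 s20 H2] := rr _ e0.
  have [s3 s30 H3] := ru _ e0; have [s4 s40 H4] := rd _ e0.
  have [s [s0 ss1 ss2 ss3 ss4]] : exists s, [/\ 0 < s, s <= s1, s <= s2, s <= s3 & s <= s4].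
    exists (Num.min (Num.min s1 s2) (Num.min s3 s4)).
    by rewrite !lt_min s10 s20 s30 s40 !ge_min !lexx !orbT.
  have es0 : 0 < e * s by exact: mulr_gt0.
  have [z [w [[nz zu] zx]]] := raised_adherent ou k0 Ox0 es0.
  have zx0 : aff z w x0 <= u x0 + e * s by lra.
  have [y1 [Om1 p1 q1 v1]] := H1 _ s0 ss1; have B1 := reaches_slope s0 e0 zu zx0 Om1 p1 q1 v1.
  have [y2 [Om2 p2 q2 v2]] := H2 _ s0 ss2; have B2 := reaches_slope s0 e0 zu zx0 Om2 p2 q2 v2.
  have [y3 [Om3 p3 q3 v3]] := H3 _ s0 ss3; have B3 := reaches_slope s0 e0 zu zx0 Om3 p3 q3 v3.
  have [y4 [Om4 p4 q4 v4]] := H4 _ s0 ss4; have B4 := reaches_slope s0 e0 zu zx0 Om4 p4 q4 v4.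
  move: B1 B2 B3 B4; rewrite /= !mulr0 !mulr1 !mulrN1 !add0r !addr0 => B1 B2 B3 B4.
  by apply: nz; have [h1 h2 h3] := slope_estimate e0 e8 er a0 ab b1 B1 B2 B3 B4; exact: Hk.
pose D := raised Om u k x0 - u x0; pose C := `|raised Om u k x0 - raised Om u k c| + `|a * (c.1 - x0.1)|.
have D0 : 0 < D by rewrite /D; lra.
have C0 : 0 <= C by rewrite addr_ge0.
(* Moving by the fraction [t] towards [c] reduces the lead [D] by at most [t * C < D]. *)
pose t := D / (D + C + 1).
have t0 : 0 < t by rewrite divr_gt0//; lra.
have t1 : t < 1 by rewrite ltr_pdivrMr//; lra.
have tC : t * C < D by rewrite /t mulrAC ltr_pdivrMr ?ltr_pM2l//; lra.
have Iy : Om° (seg c x0 (1 - t)) by apply: (interior_seg cO) => //; lra.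
apply: (gap_empty OmB ou k0 (x := seg c x0 (1 - t))); split => //.
have := raised_ccv OmB ou k0 (interiorW Ic) Ox0 (t := 1 - t); rewrite subr_ge0 (ltW t1).
have -> : 1 - t <= 1 by lra.
move=> /(_ isT isT) lo; apply: lt_le_trans lo.
apply: le_lt_trans (ua _ (interiorW Iy)) _.
have -> : (seg c x0 (1 - t)).1 - x0.1 = t * (c.1 - x0.1) by rewrite /seg /mv /=; ring.
have h1 := ler_wpM2l (ltW t0) (ler_norm (raised Om u k x0 - raised Om u k c)).
have h2 := ler_wpM2l (ltW t0) (ler_norm (- (a * (c.1 - x0.1)))).
rewrite normrN in h2.
move: tC h1 h2; rewrite /C /D.
move: `|raised _ _ _ _ - _| `|a * _| => p q; lra.
Qed.

End gentle_ridge.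

(** * Cutting off a steep ridge *)

Section cut_pointwise.
Context {R : realType}.
Implicit Types (a b c p q eta : R).

(** Minus the derivative of [1 / (1 + p^2)] at [p = c]. *)
Definition slope_loss c : R := 2 * c / (1 + c ^+ 2) ^+ 2.

Lemma slope_loss_gt0 c : 0 < c -> 0 < slope_loss c.
Proof.
by move=> c0; rewrite divr_gt0 ?exprn_gt0//; have := sqr_ge0 c; lra.
Qed.

(** At [c = b] the last quantity is at least [a * b > 0] because [b >= 1]; it stays positive
    slightly below [b]. *)
Lemma cut_slope a b : 0 < a -> a < b -> 1 <= b -> exists c, [/\ a < c, c < b & 0 < c * a + c ^+ 2 - 1].
Proof.
move=> a0 ab b1.
have d0 : 0 < 2 * (2 * b + a) by lra.
pose e := Num.min ((b - a) / 2) (a / (2 * (2 * b + a))).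
have e0 : 0 < e by rewrite lt_min !divr_gt0//; lra.
have e1 : e <= (b - a) / 2 by rewrite ge_min lexx.
have e2 : e * (2 * (2 * b + a)) <= a by rewrite -ler_pdivlMr// ge_min lexx orbT.
move: e e0 e1 e2 => e e0 e1 e2.
exists (b - e); split; [lra|lra|].
have b2 : 0 <= (b - 1) * (b + 1) by rewrite mulr_ge0//; lra.
have ba : 0 <= (b - 1) * a by rewrite mulr_ge0//; lra.
have := sqr_ge0 e; rewrite !expr2 => ?; nra.
Qed.

(** The excess over the tangent at [c], computed in [E], is quadratic near [c]. It is traded for a
    linear function of the deviation, at the price of an arbitrarily small [eta], because the
    integral of the absolute deviation is what can be bounded below on the cap. *)
Lemma cut_gain a c eta : 0 < a -> a < c -> 0 < c * a + c ^+ 2 - 1 -> 0 < eta ->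
  exists k, [/\ 0 < k, k <= slope_loss c & forall p, a / 2 <= p ->
    fres (- c, 0) + slope_loss c * (c - p) + k * (`|c - p| - eta) <= fres (- p, 0)].
Proof.
move=> a0 ac m0 eta0; have c0 : 0 < c by lra.
pose m := c * a + c ^+ 2 - 1.
pose k1 := Num.min (2 * c) (m / (1 + a / 2)).
have k10 : 0 < k1 by rewrite lt_min; apply/andP; split; [lra|rewrite divr_gt0 ?/m//; lra].
have k1c : k1 <= 2 * c by rewrite ge_min lexx.
have k1m : k1 * (1 + a / 2) <= m by rewrite -ler_pdivlMr; [rewrite ge_min lexx orbT|lra].
pose k2 := eta / (1 + c + eta).
have k20 : 0 < k2 by rewrite divr_gt0//; lra.
have k2E : k2 * (1 + c + eta) = eta by rewrite divfK// gt_eqF//; lra.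
have C2 : 0 < (1 + c ^+ 2) ^+ 2 by rewrite exprn_gt0//; have := sqr_ge0 c; lra.
pose k0 := k1 * k2 / (1 + c ^+ 2) ^+ 2.
have k00 : 0 < k0 by rewrite divr_gt0// mulr_gt0.
exists (Num.min k0 (slope_loss c)); split.
- by rewrite lt_min k00 slope_loss_gt0.
- by rewrite ge_min lexx orbT.
move=> p pa; have p0 : 0 < p by lra.
have dc : 0 < 1 + c ^+ 2 by have := sqr_ge0 c; lra.
have dp : 0 < 1 + p ^+ 2 by have := sqr_ge0 p; lra.
have E : fres (- p, 0) - (fres (- c, 0) + slope_loss c * (c - p)) =
  (p - c) ^+ 2 * (2 * c * p + c ^+ 2 - 1) / ((1 + c ^+ 2) ^+ 2 * (1 + p ^+ 2)).
  rewrite /fres /slope_loss /= !expr0n /= !addr0 !sqrrN.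
  by field; rewrite !gt_eqF.
(* At [p = a / 2] this is [k1 * (1 + a / 2) <= m]; it propagates to larger [p] by [k1 <= 2 * c]. *)
have lin : k1 * (1 + p) <= 2 * c * p + c ^+ 2 - 1.
  have : (2 * c - k1) * (a / 2) <= (2 * c - k1) * p by rewrite ler_wpM2l//; lra.
  by rewrite /m in k1m; lra.
have [X XD] : exists X, X = `|c - p| by exists `|c - p|.
have XE : (p - c) ^+ 2 = X ^+ 2 by rewrite XD real_normK ?num_real// -sqrrN opprB.
have X0 : 0 <= X by rewrite XD; exact: normr_ge0.
have pX : p <= c + X by have := ler_norm (p - c); rewrite distrC -XD; lra.
rewrite -XD.
have lin0 : 0 <= 2 * c * p + c ^+ 2 - 1 by apply: le_trans lin; rewrite mulr_ge0//; lra.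
suff : Num.min k0 (slope_loss c) * (X - eta) <=
    fres (- p, 0) - (fres (- c, 0) + slope_loss c * (c - p)) by lra.
rewrite E XE ler_pdivlMr ?mulr_gt0//.
have P1 : 1 + p ^+ 2 <= (1 + p) * (1 + p) by rewrite expr2; nra.
move: (2 * c * p + c ^+ 2 - 1) lin lin0 => W lin lin0 {E XE}.
have dd : 0 <= (1 + c ^+ 2) ^+ 2 * (1 + p ^+ 2) by exact: mulr_ge0 (ltW C2) (ltW dp).
have XW : 0 <= X ^+ 2 * W by rewrite mulr_ge0// sqr_ge0.
have [Xe|Xe] := leP X eta.
  apply: le_trans XW; rewrite mulr_le0_ge0//.
  by rewrite mulr_ge0_le0 ?subr_le0// ltW// lt_min k00 slope_loss_gt0.
have Xe0 : 0 <= X - eta by lra.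
apply: (@le_trans _ _ (k0 * (X - eta) * ((1 + c ^+ 2) ^+ 2 * (1 + p ^+ 2)))).
  by rewrite ler_wpM2r// ler_wpM2r// ge_min lexx.
have -> : k0 * (X - eta) * ((1 + c ^+ 2) ^+ 2 * (1 + p ^+ 2)) =
    k1 * (k2 * (X - eta)) * (1 + p ^+ 2).
  by rewrite /k0; field; rewrite gt_eqF.
have kX0 : 0 <= k2 * (X - eta) by exact: mulr_ge0 (ltW k20) Xe0.
(* After [p <= c + X] the claim becomes [eta * (X - eta) * (1 + c + X) <= X^2 * (1 + c + eta)],
   whose difference is written with squares. *)
have step1 : k2 * (X - eta) * (1 + p) <= X ^+ 2.
  apply: (@le_trans _ _ (k2 * (X - eta) * (1 + c + X))).
    by rewrite ler_wpM2l//; lra.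
  rewrite -(ler_pM2r (_ : 0 < 1 + c + eta)); last by lra.
  have -> : k2 * (X - eta) * (1 + c + X) * (1 + c + eta) =
    (k2 * (1 + c + eta)) * (X - eta) * (1 + c + X) by ring.
  rewrite k2E -subr_ge0.
  have -> : X ^+ 2 * (1 + c + eta) - eta * (X - eta) * (1 + c + X) =
    (1 + c) * ((X - eta / 2) ^+ 2 + 3 / 4 * eta ^+ 2) + eta ^+ 2 * X by field.
  rewrite addr_ge0//; last by rewrite mulr_ge0 ?sqr_ge0.
  by rewrite mulr_ge0 ?addr_ge0 ?mulr_ge0 ?sqr_ge0//; lra.
apply: (@le_trans _ _ (k1 * (k2 * (X - eta)) * ((1 + p) * (1 + p)))).
  by rewrite ler_wpM2l//; exact: mulr_ge0 (ltW k10) kX0.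
have p1 : 0 <= 1 + p by lra.
have -> : k1 * (k2 * (X - eta)) * ((1 + p) * (1 + p)) =
  (k2 * (X - eta) * (1 + p)) * (k1 * (1 + p)) by ring.
by apply: ler_pM => //; [exact: mulr_ge0 kX0 p1|exact: mulr_ge0 (ltW k10) p1].
Qed.

Lemma fres_tangential p q : fres (- p, 0) - `|q| <= fres (- p, q).
Proof.
rewrite /fres /= sqrrN expr0n /= addr0.
have P0 := sqr_ge0 p; rewrite -(real_normK (num_real q)); have := normr_ge0 q.
move: (p ^+ 2) `|q| P0 => P Q P0 Q0; rewrite -subr_ge0.
have Q2 := sqr_ge0 Q.
have -> : 1 / (1 + (P + Q ^+ 2)) - (1 / (1 + P) - Q) =
   Q * ((1 + (P + Q ^+ 2)) * (1 + P) - Q) / ((1 + (P + Q ^+ 2)) * (1 + P)).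
  by field; rewrite !gt_eqF//; lra.
apply: divr_ge0; rewrite mulr_ge0//; try lra.
have : 0 <= (Q - 1 / 2) ^+ 2 by exact: sqr_ge0.
have : 0 <= (P + Q ^+ 2) * P by rewrite mulr_ge0//; lra.
rewrite !expr2; lra.
Qed.

(* [s / D] comes from a supporting plane compared with a point of the graph at
   distance about [s] up the slope. *)
Lemma cut_integrand a c eta s D : 0 < a -> a < c -> 0 < c * a + c ^+ 2 - 1 -> 0 < eta ->
  0 < s -> 0 < D ->
  exists k C, [/\ 0 < k, k <= slope_loss c, 0 <= C & forall z : R * R,
    (a / 2 <= - z.1 \/ s * (a / 4 + 3 / 4 * pos z.1) <= `|z.2| * D) ->
    fres (- c, 0) + (slope_loss c + k) * pos (z.1 + c) <=
    fres z + (slope_loss c - k) * neg (z.1 + c) + k * eta + C * `|z.2| ].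
Proof.
move=> a0 ac m0 eta0 s0 D0; have [k [k0 kl Hk]] := cut_gain a0 ac m0 eta0.
have c0 : 0 < c by lra.
have l0 := slope_loss_gt0 c0; move: (slope_loss c) l0 kl Hk => l l0 kl Hk.
(* Makes [K * (a / 4 + 3 / 4 * pos z1)] dominate [1 + (l + k) * (c + pos z1)], so that in the second
   case [C * |z.2|] absorbs the whole left side. *)
pose K := 4 * (1 + (l + k) * c) / a + 4 / 3 * (l + k).
have lc0 : 0 < (l + k) * c by rewrite mulr_gt0//; lra.
have K0 : 0 <= K by rewrite addr_ge0 ?divr_ge0//; lra.
have Ka : 1 + (l + k) * c <= K * (a / 4).
  have -> : K * (a / 4) = 1 + (l + k) * c + 4 / 3 * (l + k) * (a / 4).
    by rewrite /K; field; rewrite gt_eqF.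
  by rewrite lerDl mulr_ge0//; lra.
have Kl : l + k <= K * (3 / 4).
  have : 0 <= 4 * (1 + (l + k) * c) / a by rewrite divr_ge0//; lra.
  by rewrite /K; lra.
exists k, (1 + D / s * K); split => //; first by rewrite addr_ge0// mulr_ge0// divr_ge0 ?ltW.
move=> [z1 q] /= Hz.
have DK : 0 <= D / s * K by rewrite mulr_ge0// divr_ge0// ltW.
have q0 := normr_ge0 q.
have eN : `|c + z1| = pos (z1 + c) + neg (z1 + c) by rewrite addrC posDneg.
have eE : z1 + c = pos (z1 + c) - neg (z1 + c) by exact: posBneg.
(* With [p = - z1], the numbers [|c - p|] and [c - p] are the sum and the difference of
   [pos (z1 + c)] and [neg (z1 + c)]; this turns [cut_gain] into an inequality between nonnegative
   terms. *)
have [za|za] := leP (a / 2) (- z1).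
  have := Hk _ za; have := fres_tangential (- z1) q; rewrite !opprK eN => h1 h2.
  have : 0 <= D / s * K * `|q| by rewrite mulr_ge0.
  move: (pos _) (neg _) (fres _) (fres _) (fres _) eE h1 h2 => P N f1 f2 f3 eE h1 h2.
  have cz : c + z1 = P - N by lra.
  by rewrite cz in h1 h2; lra.
case: Hz => [|Hz]; first by rewrite leNgt za.
have f0 := fres_ge0 (z1, q); have f1 := fres_le1 (- c, 0).
have n0 : neg (z1 + c) = 0 by rewrite /neg; apply/max_idPr; lra.
have p1 : pos (z1 + c) <= c + pos z1.
  have : z1 <= pos z1 by rewrite le_max lexx.
  by have := pos_ge0 z1; rewrite ge_max => *; apply/andP; split; lra.
have qK : s * (a / 4 + 3 / 4 * pos z1) * (K / s) <= `|q| * D * (K / s).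
  by rewrite ler_wpM2r// divr_ge0// ltW.
have e1 : s * (a / 4 + 3 / 4 * pos z1) * (K / s) = K * (a / 4) + K * (3 / 4) * pos z1.
  by field; rewrite gt_eqF.
have e2 : `|q| * D * (K / s) = D / s * K * `|q| by field; rewrite gt_eqF.
have P0 := pos_ge0 z1.
have h3 : (l + k) * pos z1 <= K * (3 / 4) * pos z1 by rewrite ler_wpM2r.
have h4 : (l + k) * pos (z1 + c) <= (l + k) * (c + pos z1) by rewrite ler_wpM2l//; lra.
have ke : 0 < k * eta by exact: mulr_gt0.
rewrite n0 mulr0; rewrite e1 e2 in qK; lra.
Qed.

End cut_pointwise.

(** * A concave height on one slice of the cap *)

Section slice_bounds.
Context {R : realType}.
Notation leb := (@lebesgue_measure R).
Variables (h g : R -> R) (p q e : R).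
Hypotheses (mg : measurable_fun `]p, q[ g) (sg : slope_selection h g `]p, q[)
  (he : forall x, x \in `]p, q[ -> 0 <= h x <= e) (e0 : 0 <= e).

Let sub s t : p < s -> t < q -> `[s, t] `<=` (`]p, q[ : set R).
Proof. by move=> ps tq x /=; rewrite !in_itv/= => /andP[? ?]; apply/andP; split; lra. Qed.

Let mpos : measurable_fun `]p, q[ (fun x => (pos (g x))%:E).
Proof. by apply/measurable_EFinP; exact: measurable_pos. Qed.

Let mneg : measurable_fun `]p, q[ (fun x => (neg (g x))%:E).
Proof. by apply/measurable_EFinP; exact: measurable_neg. Qed.

Lemma slice_pos_le : (\int[leb]_(x in `]p, q[) (pos (g x))%:E <= e%:E)%E.
Proof.
apply: integral_oo_le => //; first by move=> x _; rewrite lee_fin pos_ge0.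
move=> s t ps st tq; exists s, t; split => //; rewrite -[e]subr0.
apply: (integral_pos_le st _ (slope_selectionS (sub ps tq) sg)).
  by apply: measurable_funS mg => //; exact: sub.
by move=> x /(sub ps tq); exact: he.
Qed.

Lemma slice_neg_le : (\int[leb]_(x in `]p, q[) (neg (g x))%:E <= e%:E)%E.
Proof.
apply: integral_oo_le => //; first by move=> x _; rewrite lee_fin neg_ge0.
move=> s t ps st tq; exists s, t; split => //; rewrite -[e]subr0.
apply: (integral_neg_le st _ (slope_selectionS (sub ps tq) sg)).
  by apply: measurable_funS mg => //; exact: sub.
by move=> x /(sub ps tq); exact: he.
Qed.

Lemma slice_pos_neg s t : p < s -> s <= t -> t < q ->
  ((h t)%:E + \int[leb]_(x in `[s, t]) (neg (g x))%:E <=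
   (h s)%:E + \int[leb]_(x in `]p, q[) (pos (g x))%:E)%E.
Proof.
move=> ps st tq.
rewrite -(integral_pos_neg st _ (slope_selectionS (sub ps tq) sg)); last first.
  by apply: measurable_funS mg => //; exact: sub.
rewrite leeD2lE//; apply: ge0_subset_integral => //; last exact: sub.
by move=> x _; rewrite lee_fin pos_ge0.
Qed.

(** Descent exceeds ascent by the initial minus the final height. The final height is nonnegative,
    and the initial one can be brought below [K + d] by moving the left end. *)
Lemma slice_neg_le_pos (K : R) : 0 <= K ->
  (forall d s, 0 < d -> p < s -> s < q -> exists s', [/\ p < s', s' <= s & h s' <= K + d]) ->
  (\int[leb]_(x in `]p, q[) (neg (g x))%:E <=
   \int[leb]_(x in `]p, q[) (pos (g x))%:E + K%:E)%E.
Proof.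
move=> K0 HK; apply/lee_addgt0Pr => d d0.
have P0 : (0 <= \int[leb]_(x in `]p, q[) (pos (g x))%:E)%E.
  by apply: integral_ge0 => x _; rewrite lee_fin pos_ge0.
apply: integral_oo_le => //.
- by apply: adde_ge0; [exact: adde_ge0|rewrite lee_fin ltW].
- by move=> x _; rewrite lee_fin neg_ge0.
move=> s t ps st tq; have [|s' [ps' s's hs']] := HK _ s d0 ps.
  exact: le_lt_trans tq.
exists s', t; split => //.
have s't : s' <= t by exact: le_trans st.
have tin : t \in `]p, q[ by rewrite in_itv/= tq (lt_le_trans ps st).
have /andP[ht _] := he tin.
have := slice_pos_neg ps' s't tq.
move=> H; rewrite -addeA -EFinD addeC.
apply: (@le_trans _ _ ((h t)%:E + \int[leb]_(x in `[s', t]) (neg (g x))%:E)%E).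
  by rewrite leeDr// lee_fin.
by apply: le_trans H _; rewrite leeD2r// lee_fin.
Qed.

(** A height starting from 0 must climb [m] before it reaches [m]. *)
Lemma slice_pos_ge (m x : R) : p < x -> x < q -> m <= h x ->
  (forall d s, 0 < d -> p < s -> s < q -> exists s', [/\ p < s', s' <= s & h s' <= d]) ->
  (m%:E <= \int[leb]_(x in `]p, q[) (pos (g x))%:E)%E.
Proof.
move=> px xq mx HK; apply/lee_addgt0Pr => d d0.
have [s' [ps' s's hs']] := HK _ x d0 px xq.
have H := slice_pos_neg ps' s's xq.
rewrite addeC; apply: (@le_trans _ _ (h x)%:E); first by rewrite lee_fin.
apply: (@le_trans _ _ ((h x)%:E + \int[leb]_(x in `[s', x]) (neg (g x))%:E)%E).
  by rewrite leeDl// integral_ge0// => y _; rewrite lee_fin neg_ge0.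
by apply: le_trans H _; rewrite leeD2r// lee_fin.
Qed.

End slice_bounds.

(** * The cut by a plane and what minimality says on the cap *)

Section cut.
Context {R : realType}.
Notation leb := (@lebesgue_measure R).
Variables (Om : set (R * R)) (B M : R) (u : R * R -> R) (x0 : R * R) (a b c e : R).
Hypotheses (OmB : planar_body Om B) (ou : optimal Om M u) (Ox0 : Om x0)
  (ac : a < c) (cb : c < b) (c0 : 0 < c) (e0 : 0 < e) (ue : e * (1 + c / (b - c)) <= u x0)
  (ua : forall x, Om x -> u x <= u x0 - a * (x.1 - x0.1))
  (ub : forall x, Om x -> u x <= u x0 - b * (x.1 - x0.1)).
Implicit Types (x y z : R * R).

Let cO : cvx Om. Proof. by case: OmB. Qed.
Let cu : ccv Om u. Proof. by case: ou => -[]. Qed.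
Let bu x : Om x -> 0 <= u x <= M. Proof. by case: ou => -[_ bu] _; exact: bu. Qed.

Definition cut_plane x : R := u x0 - e - c * (x.1 - x0.1).
Definition cap_height x : R := u x - cut_plane x.
Definition cap : set (R * R) := [set x | Om° x /\ 0 < cap_height x].
Definition cut_fun x : R := Num.min (u x) (cut_plane x).

Lemma cap_height_le x : Om x -> cap_height x <= e.
Proof.
have [ac' cb' e0'] := And3 ac cb e0.
move=> Ox; rewrite /cap_height /cut_plane; have := ua Ox; have := ub Ox.
have [t0|t0] := leP 0 (x.1 - x0.1).
  have bc0 : 0 <= b - c by lra.
  by have := mulr_ge0 bc0 t0; lra.
have ca0 : 0 <= c - a by lra.
have := mulr_ge0_le0 ca0 (ltW t0).
by lra.
Qed.

(** The two bounds are the abscissas, relative to the edge, at which the faces meet the cutting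
    plane. *)
Lemma cap_strip x : Om x -> 0 < cap_height x ->
  - (e / (c - a)) < x.1 - x0.1 /\ x.1 - x0.1 < e / (b - c).
Proof.
have [ac' cb'] := conj ac cb.
rewrite /cap_height /cut_plane => Ox hx; have h1 := ua Ox; have h2 := ub Ox.
have d1 : 0 < c - a by lra.
have d2 : 0 < b - c by lra.
by rewrite -mulNr ltr_pdivrMr// ltr_pdivlMr//; split; lra.
Qed.

Lemma cap_height_ccv : ccv Om cap_height.
Proof.
move=> x y t Ox Oy t0 t1; have := cu Ox Oy t0 t1.
by rewrite /cap_height /cut_plane {3}/seg /mv /=; lra.
Qed.

Lemma cap_open : open cap.
Proof.
apply/plane_openP => x [Ix hx].
have [r r0 H] := ccv_continuous cap_height_ccv Ix hx.
exists r => // y y1 y2; have [Iy] := H _ y1 y2.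
by rewrite ltr_norml => /andP[h1 _]; split => //; lra.
Qed.

Lemma cap_measurable : measurable cap.
Proof. by apply: plane_open_measurable; exact: cap_open. Qed.

Lemma cap_cvx : cvx cap.
Proof.
move=> x y t [Ix hx] [Iy hy] t0 t1; split; first exact: (interior_cvx cO).
apply: lt_le_trans (cap_height_ccv (interiorW Ix) (interiorW Iy) t0 t1).
have [->|t00] := eqVneq t 0; first by rewrite mul0r addr0.
have tp : 0 < t by rewrite lt_neqAle eq_sym t00.
have t1' : 0 <= 1 - t by lra.
have h1 : 0 < t * cap_height y by exact: mulr_gt0.
have h2 : 0 <= (1 - t) * cap_height x by rewrite mulr_ge0// ltW.
by lra.
Qed.

(** The delicate point is nonnegativity: the cap extends less than [e / (b - c)] beyond the edge,
    and [ue] keeps the cutting plane above 0 up to there. *)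
Lemma cut_fun_bounded : bounded_ccv Om M cut_fun.
Proof.
have [ac' cb' c0' e0'] := And4 ac cb c0 e0.
split=> [x y t Ox Oy t0 t1|x Ox].
  have t1' : 0 <= 1 - t by lra.
  have m1 w : cut_fun w <= u w by rewrite ge_min lexx.
  have m2 w : cut_fun w <= cut_plane w by rewrite ge_min lexx orbT.
  rewrite le_min; apply/andP; split.
    have := ler_wpM2l t1' (m1 x); have := ler_wpM2l t0 (m1 y); have := cu Ox Oy t0 t1.
    by lra.
  have := ler_wpM2l t1' (m2 x); have := ler_wpM2l t0 (m2 y).
  have -> : cut_plane (seg x y t) = (1 - t) * cut_plane x + t * cut_plane y.
    by rewrite /cut_plane /seg /mv /=; ring.
  by lra.
have /andP[u0 uM] := bu Ox; rewrite ge_min uM andbT le_min u0/=.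
have [hx|hx] := leP (cap_height x) 0; first by rewrite /cap_height in hx; lra.
have [_ t2] := cap_strip Ox hx.
have := ltW t2; rewrite -(ler_pM2l c0) => ct.
have E : e * (1 + c / (b - c)) = e + c * (e / (b - c)) by ring.
by rewrite /cut_plane; have ue' := ue; rewrite E in ue'; lra.
Qed.

Lemma cut_grad x : regular Om u x -> regular Om cut_fun x ->
  (0 < cap_height x -> rgrad Om cut_fun x = (- c, 0)) /\
  (cap_height x <= 0 -> rgrad Om cut_fun x = rgrad Om u x).
Proof.
move=> ru rv; split=> hx; apply/esym; apply: regular_unique rv _ => y Oy.
  rewrite /cut_fun; have -> : Num.min (u x) (cut_plane x) = cut_plane x.
    by apply/min_idPr; rewrite /cap_height in hx; lra.
  by rewrite ge_min; apply/orP; right; rewrite /cut_plane /=; lra.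
rewrite /cut_fun; have -> : Num.min (u x) (cut_plane x) = u x.
  by apply/min_idPl; rewrite /cap_height in hx; lra.
by have [_ _ pu _] := ru; rewrite ge_min pu.
Qed.

(** The cut changes the gradient only on the cap, to the constant [(- c, 0)]; the contribution of
    the rest is finite and cancels. *)
Lemma cap_resistance_le :
  (\int[leb2]_(x in cap) (fres (rgrad Om u x))%:E <= (fres (- c, 0))%:E * leb2 cap)%E.
Proof.
have [cv _] := cut_fun_bounded; have [_ /(_ _ cut_fun_bounded) min] := ou.
have mI : measurable Om° by exact: interior_measurable.
have IE : Om° = cap `|` (Om° `\` cap).
  by apply/seteqP; split => [x Ix|x [[]|[]]//]; have [?|?] := pselect (cap x); [left|right].
have mC := cap_measurable.
have mD : measurable (Om° `\` cap) by exact: measurableD.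
have mf w : ccv Om w -> measurable_fun Om° (fun x => (fres (rgrad Om w x))%:E).
  by move=> cw; apply/measurable_EFinP; exact: measurable_fres_rgrad.
have f0 w x : (0 <= (fres (rgrad Om w x))%:E)%E by rewrite lee_fin fres_ge0.
have splitI w : ccv Om w -> (\int[leb2]_(x in Om°) (fres (rgrad Om w x))%:E =
   \int[leb2]_(x in cap) (fres (rgrad Om w x))%:E +
   \int[leb2]_(x in Om° `\` cap) (fres (rgrad Om w x))%:E)%E.
  move=> cw; rewrite {1}IE ge0_integral_setU//.
  - by rewrite -IE; exact: mf.
  - by apply/disj_setPS => x [? []].
have gae := body_regular_ae OmB cu; have vae := body_regular_ae OmB cv.
have D_eq : (\int[leb2]_(x in Om° `\` cap) (fres (rgrad Om cut_fun x))%:E =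
    \int[leb2]_(x in Om° `\` cap) (fres (rgrad Om u x))%:E)%E.
  apply: ae_eq_integral => //.
  - by apply: measurable_funS (mf _ cv) => //; exact: subDsetl.
  - by apply: measurable_funS (mf _ cu) => //; exact: subDsetl.
  apply: ae_app2 gae vae => x ru rv [Ix nC].
  have [_ ->//] := cut_grad (ru Ix) (rv Ix).
  by rewrite leNgt; apply/negP => hx; apply: nC.
have C_eq : (\int[leb2]_(x in cap) (fres (rgrad Om cut_fun x))%:E =
    \int[leb2]_(x in cap) (fres (- c, 0))%:E)%E.
  apply: ae_eq_integral => //.
  - by apply: measurable_funS (mf _ cv) => // x [].
  apply: ae_app2 gae vae => x ru rv [Ix hx].
  by have [->] := cut_grad (ru Ix) (rv Ix).
move: min; rewrite (splitI _ cu) (splitI _ cv) D_eq C_eq integral_cst//.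
rewrite leeD2rE// ge0_fin_numE; last by apply: integral_ge0 => x _; exact: f0.
apply: (@le_lt_trans _ _ (\int[leb2]_(x in Om° `\` cap) (cst 1%E x))%E).
  apply: ge0_le_integral => //.
  - by apply: measurable_funS (mf _ cu) => //; exact: subDsetl.
  - by move=> x _; rewrite lee_fin fres_le1.
rewrite integral_cst// mul1e; apply: le_lt_trans (interior_finite OmB).
by apply: le_measure; rewrite ?inE//; exact: subDsetl.
Qed.

Lemma cap_hselection t : slope_selection (fun s => cap_height (s, t))
  (fun s => rder Om u e1 (s, t) + c) (hsec cap t).
Proof.
move=> s s' [Is _] [Is' _]; have := rder_hselection cu Is Is'.
by rewrite /cap_height /cut_plane /=; lra.
Qed.

Lemma cap_vselection s : slope_selection (fun t => cap_height (s, t))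
  (fun t => rder Om u e2 (s, t)) (vsec cap s).
Proof.
move=> t t' [It _] [It' _]; have := rder_vselection cu It It'.
by rewrite /cap_height /cut_plane /=; lra.
Qed.

(** The pointwise bound is integrated at [z = rgrad Om u x], and [cap_resistance_le] removes the
    resistances from both sides. All terms are kept nonnegative so that extended integrals can be
    added and scaled. *)
Lemma cap_integrand_le (k C eta s D : R) : 0 <= C -> 0 < k -> 0 < eta -> 0 <= slope_loss c - k ->
  (forall z : R * R, (a / 2 <= - z.1 \/ s * (a / 4 + 3 / 4 * pos z.1) <= `|z.2| * D) ->
    fres (- c, 0) + (slope_loss c + k) * pos (z.1 + c) <=
    fres z + (slope_loss c - k) * neg (z.1 + c) + k * eta + C * `|z.2|) ->
  (forall x, cap x -> regular Om u x -> a / 2 <= - rder Om u e1 x \/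
     s * (a / 4 + 3 / 4 * pos (rder Om u e1 x)) <= `|rder Om u e2 x| * D) ->
  ((slope_loss c + k)%:E * \int[leb2]_(x in cap) (pos (rder Om u e1 x + c))%:E <=
   (slope_loss c - k)%:E * \int[leb2]_(x in cap) (neg (rder Om u e1 x + c))%:E +
   (k * eta)%:E * leb2 cap +
   C%:E * \int[leb2]_(x in cap) `|rder Om u e2 x|%:E)%E.
Proof.
have [ac' cb' c0' e0'] := And4 ac cb c0 e0.
move=> C0 k0 eta0 lk H1 H2.
have mC := cap_measurable.
have capI : cap `<=` Om° by move=> x [].
have mr d : measurable_fun cap (rder Om u d).
  by apply: measurable_funS (measurable_rder cu d) => //; exact: interior_measurable.
have mr1 : measurable_fun cap (fun x => rder Om u e1 x + c).
  by apply: measurable_funD => //; exact: measurable_cst.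
have mp : measurable_fun cap (fun x => (pos (rder Om u e1 x + c))%:E).
  by apply/measurable_EFinP; exact: measurable_pos mr1.
have mn : measurable_fun cap (fun x => (neg (rder Om u e1 x + c))%:E).
  by apply/measurable_EFinP; exact: measurable_neg mr1.
have mq : measurable_fun cap (fun x => `|rder Om u e2 x|%:E).
  by apply/measurable_EFinP; apply: measurableT_comp.
have mf : measurable_fun cap (fun x => (fres (rgrad Om u x))%:E).
  apply/measurable_EFinP; apply: measurable_funS (measurable_fres_rgrad cu) => //.
  exact: interior_measurable.
have l0 : 0 <= slope_loss c + k by have := slope_loss_gt0 c0; lra.
have ke : 0 <= k * eta by rewrite mulr_ge0// ltW.
have p0 x : (0 <= (pos (rder Om u e1 x + c))%:E)%E by rewrite lee_fin pos_ge0.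
have n0 x : (0 <= (neg (rder Om u e1 x + c))%:E)%E by rewrite lee_fin neg_ge0.
have q0 x : (0 <= `|rder Om u e2 x|%:E)%E by rewrite lee_fin.
have f0 x : (0 <= (fres (rgrad Om u x))%:E)%E by rewrite lee_fin fres_ge0.
have fc : (0 <= (fres (- c, 0 : R))%:E)%E by rewrite lee_fin fres_ge0.
have mZ (r : R) (f : R * R -> \bar R) : measurable_fun cap f -> measurable_fun cap (fun x => r%:E * f x)%E.
  by move=> mff; apply: emeasurable_funM => //; exact: measurable_cst.
have zp x : (0 <= (slope_loss c + k)%:E * (pos (rder Om u e1 x + c))%:E)%E by exact: mule_ge0.
have zn x : (0 <= (slope_loss c - k)%:E * (neg (rder Om u e1 x + c))%:E)%E by exact: mule_ge0.
have zq x : (0 <= C%:E * `|rder Om u e2 x|%:E)%E by exact: mule_ge0.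
have zkq x : (0 <= (k * eta)%:E + C%:E * `|rder Om u e2 x|%:E)%E by exact: adde_ge0.
have mcst (r : \bar R) : measurable_fun cap (fun x : R * R => r) by exact: measurable_cst.
have key : (\int[leb2]_(x in cap) ((fres (- c, 0))%:E +
    (slope_loss c + k)%:E * (pos (rder Om u e1 x + c))%:E) <=
   \int[leb2]_(x in cap) ((fres (rgrad Om u x))%:E +
     ((slope_loss c - k)%:E * (neg (rder Om u e1 x + c))%:E +
      ((k * eta)%:E + C%:E * `|rder Om u e2 x|%:E))))%E.
  apply: ae_ge0_le_integral => //.
  - by move=> x _; exact: adde_ge0.
  - by apply: emeasurable_funD => //; exact: mZ.
  - by move=> x _; apply: adde_ge0 => //; exact: adde_ge0.
  - apply: emeasurable_funD => //; apply: emeasurable_funD; first exact: mZ.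
    by apply: emeasurable_funD => //; exact: mZ.
  apply: ae_app1 (body_regular_ae OmB cu) => x rx cx; have [Ix _] := cx.
  rewrite -!EFinM -!EFinD lee_fin.
  by have := H1 (rgrad Om u x) (H2 x cx (rx Ix)); rewrite /rgrad /=; lra.
move: key.
rewrite ge0_integralD//; [|exact: mZ].
rewrite integral_cst// ge0_integralZl_EFin//.
rewrite ge0_integralD//; last 2 first.
- by move=> x _; exact: adde_ge0.
- apply: emeasurable_funD; first exact: mZ.
  by apply: emeasurable_funD => //; exact: mZ.
rewrite ge0_integralD//; first last.
- by apply: emeasurable_funD => //; exact: mZ.
- exact: mZ.
rewrite ge0_integralZl_EFin//.
rewrite ge0_integralD//; first last.
- exact: mZ.
rewrite integral_cst// ge0_integralZl_EFin//.
move=> key; have fin : ((fres (- c, 0 : R))%:E * leb2 cap)%E \is a fin_num.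
  rewrite fin_numM// ge0_fin_numE//; apply: le_lt_trans (interior_finite OmB).
  by apply: le_measure; rewrite ?inE//; exact: interior_measurable.
rewrite -(leeD2lE _ _ fin); apply: le_trans key _.
by apply: leeD; [exact: cap_resistance_le|rewrite addeA].
Qed.

End cut.

(** * Integrals of the slopes over the cap *)

Section cap_integrals.
Context {R : realType}.
Notation leb := (@lebesgue_measure R).
Variables (Om : set (R * R)) (B M : R) (u : R * R -> R) (x0 : R * R) (a b c e : R).
Hypotheses (OmB : planar_body Om B) (ou : optimal Om M u)
  (ac : a < c) (cb : c < b) (e0 : 0 < e)
  (ua : forall x, Om x -> u x <= u x0 - a * (x.1 - x0.1))
  (ub : forall x, Om x -> u x <= u x0 - b * (x.1 - x0.1)).
Implicit Types (x y z : R * R) (yl yh : R).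
Notation cap := (cap Om u x0 c e).
Notation height := (cap_height u x0 c e).

Let cO : cvx Om. Proof. by case: OmB. Qed.
Let cu : ccv Om u. Proof. by case: ou => -[]. Qed.
Let bO x : Om x -> `|x.1| <= B /\ `|x.2| <= B. Proof. by case: OmB => _ _ _; exact. Qed.
Let capI : cap `<=` Om°. Proof. by move=> x []. Qed.
Let capO : cap `<=` Om. Proof. by move=> x [/interiorW]. Qed.
Let mC : measurable cap. Proof. exact: cap_measurable ou. Qed.
Let oC : open cap. Proof. exact: cap_open ou. Qed.
Let cC : cvx cap. Proof. exact: cap_cvx OmB ou. Qed.
Let mr d : measurable_fun cap (rder Om u d).
Proof. by apply: measurable_funS (measurable_rder cu d) => //; exact: interior_measurable. Qed.
Let mr1 : measurable_fun cap (fun x => rder Om u e1 x + c).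
Proof. by apply: measurable_funD => //; exact: measurable_cst. Qed.
Let mp : measurable_fun cap (fun x => (pos (rder Om u e1 x + c))%:E).
Proof. by apply/measurable_EFinP; exact: measurable_pos mr1. Qed.
Let mn : measurable_fun cap (fun x => (neg (rder Om u e1 x + c))%:E).
Proof. by apply/measurable_EFinP; exact: measurable_neg mr1. Qed.
Let p0 x : (0 <= (pos (rder Om u e1 x + c))%:E)%E.
Proof. by rewrite lee_fin pos_ge0. Qed.
Let n0 x : (0 <= (neg (rder Om u e1 x + c))%:E)%E.
Proof. by rewrite lee_fin neg_ge0. Qed.

Definition width : R := e / (c - a) + e / (b - c).

Lemma width_gt0 : 0 < width.
Proof. by rewrite addr_gt0// divr_gt0// subr_gt0. Qed.

Lemma cap_hsec_itv t : hsec cap t = `]inf (hsec cap t), sup (hsec cap t)[%classic.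
Proof.
have [l r] := @hsec_bounds _ Om B bO cap t capO.
apply: open_interval_itv => //; first exact: hsec_open.
exact: hsec_interval.
Qed.

Lemma cap_vsec_itv s : vsec cap s = `]inf (vsec cap s), sup (vsec cap s)[%classic.
Proof.
have [l r] := @vsec_bounds _ Om B bO cap s capO.
apply: open_interval_itv => //; first exact: vsec_open.
exact: vsec_interval.
Qed.

Lemma height_bounds x : cap x -> 0 <= height x <= e.
Proof.
move=> cx; have [Ix hx] := cx; rewrite (ltW hx)/=.
exact: (cap_height_le ac cb e0 ua ub (capO cx)).
Qed.

Lemma integral_indic_itv (k p q : R) : 0 <= k -> p <= q ->
  (\int[leb]_t (k * \1_(`[p, q]%classic) t)%:E = (k * (q - p))%:E)%E.
Proof.
move=> k0 pq; under eq_integral do rewrite EFinM.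
rewrite ge0_integralZl_EFin//; last first.
  by apply/measurable_EFinP; exact: measurable_indic.
rewrite integral_indic// setIT EFinM; congr (_ * _)%E.
rewrite /= lebesgue_measure_itv/= lte_fin; case: ltP => // qp.
by congr EFin; lra.
Qed.

Lemma measurable_indic_itv (k p q : R) :
  measurable_fun setT (fun t : R => (k * \1_(`[p, q]%classic) t)%:E).
Proof.
apply/measurable_EFinP; apply: measurable_funM; first exact: measurable_cst.
exact: measurable_indic.
Qed.

(** The cutting plane is constant along the edge, so on a vertical slice [u] varies like the height:
    concave with values in [[0, e]], its total variation is at most [2 * e]. The slices occupy an
    interval of length [width]. *)
Lemma cap_tangential_le :
  (\int[leb2]_(x in cap) `|rder Om u e2 x|%:E <= (2 * e * width)%:E)%E.
Proof.
have e0' := e0; have w0 := width_gt0.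
have mq : measurable_fun cap (fun x => `|rder Om u e2 x|%:E).
  by apply/measurable_EFinP; apply: measurableT_comp.
have q0 x : (0 <= `|rder Om u e2 x|%:E)%E by rewrite lee_fin.
rewrite (tonelli_vsec mC mq (fun x _ => q0 x)).
pose A1 := x0.1 - e / (c - a); pose A2 := x0.1 + e / (b - c).
have wE : width = A2 - A1 by rewrite /width /A1 /A2; ring.
have A12 : A1 <= A2 by rewrite -subr_ge0 -wE ltW.
rewrite wE -(integral_indic_itv _ A12); last by lra.
apply: ge0_le_integral => //.
- by move=> s _; apply: integral_ge0.
- exact: (measurable_tonelli_vsec mC mq (fun x _ => q0 x)).
- exact: measurable_indic_itv.
move=> s _; have [->|/eqP/set0P[t ct]] := pselect (vsec cap s = set0).
  by rewrite integral_set0 lee_fin mulr_ge0//; lra.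
have [h1 h2] := cap_strip ac cb ua ub (capO ct) ct.2.
rewrite indicE mem_set; last by rewrite /= in_itv/= /A1 /A2; apply/andP; split; rewrite /= in h1 h2; lra.
rewrite mulr1 mulr_natl mulr2n EFinD.
have sg := @cap_vselection _ _ _ _ x0 c e ou s.
have mg := @measurable_rder_vsec _ Om u cu e2 s.
have sub : vsec cap s `<=` vsec Om° s by move=> ? [].
have {}mg : measurable_fun (vsec cap s) (fun t => rder Om u e2 (s, t)).
  by apply: measurable_funS mg => //; exact: measurable_vsec (interior_measurable _).
have hb r : vsec cap s r -> 0 <= height (s, r) <= e by exact: height_bounds.
rewrite cap_vsec_itv in sg mg hb *; move: (inf _) (sup _) sg mg hb => p q sg mg hb.
under eq_integral do rewrite posDneg EFinD.
rewrite ge0_integralD//; first last.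
- by apply/measurable_EFinP; exact: measurable_neg mg.
- by move=> r _; rewrite lee_fin neg_ge0.
- by apply/measurable_EFinP; exact: measurable_pos mg.
- by move=> r _; rewrite lee_fin pos_ge0.
by apply: leeD; [exact: (slice_pos_le mg sg hb (ltW e0))|exact: (slice_neg_le mg sg hb (ltW e0))].
Qed.

Lemma cap_area yl yh : yl <= yh -> (forall x, cap x -> yl <= x.2 <= yh) ->
  (leb2 cap <= (width * (yh - yl))%:E)%E.
Proof.
move=> ylh Hy; have w0 := width_gt0.
pose A1 := x0.1 - e / (c - a); pose A2 := x0.1 + e / (b - c).
have wE : width = A2 - A1 by rewrite /width /A1 /A2; ring.
have A12 : A1 <= A2 by rewrite -subr_ge0 -wE ltW.
rewrite wE -leb2_box//; apply: le_measure; rewrite ?inE//; first exact: measurable_box.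
move=> x cx; have [h1 h2] := cap_strip ac cb ua ub (capO cx) cx.2.
split => /=; rewrite in_itv/=; last exact: Hy.
by rewrite /A1 /A2; apply/andP; split; lra.
Qed.

Let hslice t : slope_selection (fun s => height (s, t))
    (fun s => rder Om u e1 (s, t) + c) (hsec cap t) /\
  measurable_fun (hsec cap t) (fun s => rder Om u e1 (s, t) + c).
Proof.
split; first exact: (@cap_hselection _ _ _ _ x0 c e ou t).
apply: measurable_funD; last exact: measurable_cst.
have sub : hsec cap t `<=` hsec Om° t by move=> ? [].
apply: measurable_funS (@measurable_rder_hsec _ Om u cu e1 t) => //.
exact: measurable_hsec (interior_measurable _).
Qed.

Lemma cap_pos_le yl yh : yl <= yh -> (forall x, cap x -> yl <= x.2 <= yh) ->
  (\int[leb2]_(x in cap) (pos (rder Om u e1 x + c))%:E <= (e * (yh - yl))%:E)%E.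
Proof.
move=> ylh Hy; rewrite (tonelli_hsec mC mp (fun x _ => p0 x)).
rewrite -(integral_indic_itv (ltW e0) ylh).
apply: ge0_le_integral => //.
- by move=> t _; apply: integral_ge0.
- exact: (measurable_tonelli_hsec mC mp (fun x _ => p0 x)).
- exact: measurable_indic_itv.
move=> t _; have [->|/eqP/set0P[s cs]] := pselect (hsec cap t = set0).
  by rewrite integral_set0 lee_fin mulr_ge0// ltW.
rewrite indicE mem_set; last by rewrite /= in_itv/=; exact: Hy cs.
rewrite mulr1; have [sg mg] := hslice t.
have hb r : hsec cap t r -> 0 <= height (r, t) <= e by exact: height_bounds.
rewrite cap_hsec_itv in sg mg hb *; move: (inf _) (sup _) sg mg hb => p q sg mg hb.
exact: (slice_pos_le mg sg hb (ltW e0)).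
Qed.

(** The slice of the cap at ordinate [t] starts from height 0. This may fail if the slice begins on
    the boundary of [Om], where the height can start anywhere up to [e]. *)
Definition clean t := forall d s, 0 < d -> cap (s, t) ->
  exists s', [/\ s' <= s, cap (s', t) & height (s', t) <= d].

(** On clean slices descent does not exceed ascent. The other slices lie within [w] of one of the
    two ends, and on each of them the surplus is at most [e]. *)
Lemma cap_neg_le yl yh (w : R) : 0 <= w -> (forall x, cap x -> yl <= x.2 <= yh) ->
  (forall t, yl + w <= t -> t <= yh - w -> clean t) ->
  (\int[leb2]_(x in cap) (neg (rder Om u e1 x + c))%:E <=
   \int[leb2]_(x in cap) (pos (rder Om u e1 x + c))%:E + (2 * e * w)%:E)%E.
Proof.
move=> w0 Hy Hc; rewrite (tonelli_hsec mC mp (fun x _ => p0 x)).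
rewrite (tonelli_hsec mC mn (fun x _ => n0 x)).
have mtp := measurable_tonelli_hsec mC mp (fun x _ => p0 x).
have mtn := measurable_tonelli_hsec mC mn (fun x _ => n0 x).
have E : ((2 * e * w)%:E = \int[leb]_t ((e * \1_(`[yl, yl + w]%classic) t)%:E +
    (e * \1_(`[yh - w, yh]%classic) t)%:E))%E.
  rewrite ge0_integralD//.
  - rewrite !integral_indic_itv ?(ltW e0)//; try by rewrite ?lerDl ?gerBl.
    by rewrite -EFinD; congr EFin; ring.
  - by move=> t _; rewrite lee_fin mulr_ge0// ltW.
  - exact: measurable_indic_itv.
  - by move=> t _; rewrite lee_fin mulr_ge0// ltW.
  - exact: measurable_indic_itv.
have i0 t : (0 <= (e * \1_(`[yl, yl + w]%classic) t)%:E +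
    (e * \1_(`[yh - w, yh]%classic) t)%:E)%E.
  by rewrite adde_ge0// lee_fin mulr_ge0// ltW.
have mi : measurable_fun setT (fun t : R => ((e * \1_(`[yl, yl + w]%classic) t)%:E +
    (e * \1_(`[yh - w, yh]%classic) t)%:E)%E).
  by apply: emeasurable_funD; exact: measurable_indic_itv.
have P0 t : (0 <= \int[leb]_(s in hsec cap t) (pos (rder Om u e1 (s, t) + c))%:E)%E.
  by apply: integral_ge0.
rewrite E -ge0_integralD//.
apply: ge0_le_integral => //.
- by move=> t _; apply: integral_ge0.
- by apply: emeasurable_funD.
move=> t _; have [->|/eqP/set0P[s1 cs]] := pselect (hsec cap t = set0).
  by rewrite !integral_set0 add0e.
have [sg mg] := hslice t.
have hb r : hsec cap t r -> 0 <= height (r, t) <= e by exact: height_bounds.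
pose K : R := e * \1_(`[yl, yl + w]%classic) t + e * \1_(`[yh - w, yh]%classic) t.
have K0 : 0 <= K by have := i0 t; rewrite -EFinD lee_fin.
have HK d s : 0 < d -> hsec cap t s -> exists s', [/\ hsec cap t s', s' <= s & height (s', t) <= K + d].
  move=> d0 cst; have [/andP[c1 c2]|nc] := boolP ((yl + w <= t) && (t <= yh - w)).
    have [s' [h1 h2 h3]] := Hc _ c1 c2 _ _ d0 cst.
    by exists s'; split => //; apply: le_trans h3 _; rewrite lerDr.
  exists s; split => //; have /andP[_ he] := hb _ cst.
  have eK : e <= K.
    have /andP[/= y1 y2] := Hy _ cst; rewrite /K !indicE.
    move: nc; rewrite negb_and -!ltNge => /orP[h|h].
      have -> : t \in `[yl, yl + w]%classic by rewrite mem_set//= in_itv/= y1 ltW.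
      by rewrite mulr1 lerDl mulr_ge0// ltW.
    have -> : t \in `[yh - w, yh]%classic by rewrite mem_set//= in_itv/= y2 andbT ltW.
    by rewrite mulr1 lerDr mulr_ge0// ltW.
  by have := ltW d0; lra.
rewrite -EFinD -/K.
rewrite cap_hsec_itv in sg mg hb HK *; move: (inf _) (sup _) sg mg hb HK => p q sg mg hb HK.
apply: (slice_neg_le_pos mg sg hb K0) => d s d0 ps sq.
have [|s' [+ h2 h3]] := HK d s d0; first by rewrite /= in_itv/= ps.
by rewrite /= in_itv/= => /andP[h1 _]; exists s'.
Qed.

Lemma cap_pos_ge (m1 m2 : R) : m1 <= m2 ->
  (forall t, m1 <= t -> t <= m2 -> clean t /\ exists s, cap (s, t) /\ e / 4 <= height (s, t)) ->
  ((e / 4 * (m2 - m1))%:E <= \int[leb2]_(x in cap) (pos (rder Om u e1 x + c))%:E)%E.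
Proof.
move=> m12 Hm; rewrite (tonelli_hsec mC mp (fun x _ => p0 x)).
have e4 : 0 <= e / 4 by rewrite divr_ge0// ltW.
rewrite -(integral_indic_itv e4 m12).
apply: ge0_le_integral => //.
- by move=> t _; rewrite lee_fin mulr_ge0.
- exact: measurable_indic_itv.
- exact: (measurable_tonelli_hsec mC mp (fun x _ => p0 x)).
move=> t _; rewrite indicE; case: (boolP (t \in _)) => [|_]; last first.
  by rewrite mulr0 integral_ge0.
rewrite inE/= in_itv/= mulr1 => /andP[t1 t2].
have [ct [s [cs hs]]] := Hm _ t1 t2.
have [sg mg] := hslice t.
have hb r : hsec cap t r -> 0 <= height (r, t) <= e by exact: height_bounds.
have HK d r : 0 < d -> hsec cap t r -> exists s', [/\ hsec cap t s', s' <= r & height (s', t) <= d].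
  by move=> d0 cr; have [s' [h1 h2 h3]] := ct _ _ d0 cr; exists s'.
have {}cs : hsec cap t s by [].
rewrite cap_hsec_itv in sg mg hb HK cs *.
move: (inf _) (sup _) sg mg hb HK cs => p q sg mg hb HK; rewrite /= in_itv/= => /andP[ps sq].
apply: (slice_pos_ge mg sg ps sq hs) => d r d0 pr rq.
have [|s' [+ h2 h3]] := HK d r d0; first by rewrite /= in_itv/= pr.
by rewrite /= in_itv/= => /andP[h1 _]; exists s'.
Qed.

(** An interior point to the left of the strip containing the cap forces the slice to begin at an
    interior point [p] of [Om], which is outside the cap and so has height at most 0. A
    supergradient at [p] then bounds the height just to its right. *)
Lemma cleanP x : Om° x -> x.1 <= x0.1 - e / (c - a) -> clean x.2.
Proof.
move=> Ix xl d s d0 cs; have [/= Is hs] := cs.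
have hx : height x <= 0.
  rewrite leNgt; apply/negP => hx.
  by have [h1 _] := cap_strip ac cb ua ub (interiorW Ix) hx; lra.
have lo r : hsec cap x.2 r -> x.1 < r.
  by move=> cr; have [/= h1 _] := cap_strip ac cb ua ub (capO cr) cr.2; lra.
have JE := cap_hsec_itv x.2.
have pin : x.1 <= inf (hsec cap x.2).
  by apply: lb_le_inf; [exists s|move=> r /lo/ltW].
move: (inf _) (sup _) JE pin => p q JE xp.
have /andP[ps sq] : p < s < q.
  by have : hsec cap x.2 s by []; rewrite JE /= in_itv.
have Ip : Om° (p, x.2).
  apply: (hsec_interval (interior_cvx cO) (x := x.1) (y := s)) => //; by rewrite xp ltW.
have hp : height (p, x.2) <= 0.
  rewrite leNgt; apply/negP => hp.
  have : hsec cap x.2 p by split.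
  by rewrite JE /= in_itv/= ltxx.
pose g := rder Om u e1 (p, x.2) + c.
have g1 : 0 < `|g| + 1 by rewrite ltr_wpDl.
pose s' := Num.min s (p + d / (`|g| + 1)).
have ps' : p < s' by rewrite lt_min ps ltrDl divr_gt0.
have s's : s' <= s by rewrite ge_min lexx.
have s'd : (s' - p) * (`|g| + 1) <= d.
  have : s' <= p + d / (`|g| + 1) by rewrite ge_min lexx orbT.
  by rewrite -ler_pdivlMr//; move: (d / _) => w; lra.
have cs' : cap (s', x.2).
  have : hsec cap x.2 s' by rewrite JE /= in_itv/= ps' (le_lt_trans s's).
  by [].
exists s'; split => //.
have [/= Is' _] := cs'; have := @rder_hselection _ Om u cu x.2 _ _ Ip Is'.
move: hp; rewrite /cap_height /cut_plane /=.
have := ler_norm g; rewrite /g => gn.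
have sp0 : 0 <= s' - p by lra.
have := ler_wpM2r sp0 gn; rewrite /g in s'd.
move: `|_ + c| s'd => w; lra.
Qed.

End cap_integrals.

(** * Interior approximation and vertical extent *)

Section cap_extent.
Context {R : realType}.
Implicit Types (Om A : set (R * R)) (u : R * R -> R) (x y z : R * R).

(** Although [u] may be discontinuous at a boundary point, concavity on the segment from an interior
    point to [x] prevents it from dropping near [x]; this gives a lower bound on [u x'] and no upper
    one. *)
Lemma interior_approx Om u c x (d : R) : cvx Om -> ccv Om u -> Om° c -> Om x -> 0 < d ->
  exists x', [/\ Om° x', `|x'.1 - x.1| <= d, `|x'.2 - x.2| <= d & u x - d <= u x'].
Proof.
move=> cO cu Ic Ox d0.
have [C CE] : exists C, C = `|c.1 - x.1| + `|c.2 - x.2| + `|u c - u x| + 1 by eexists.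
have [n1 n2 n3] := And3 (normr_ge0 (c.1 - x.1)) (normr_ge0 (c.2 - x.2)) (normr_ge0 (u c - u x)).
have C0 : 0 < C by lra.
have [t tE] : exists t, t = d / (C + d) by eexists.
have t0 : 0 < t by rewrite tE divr_gt0//; lra.
have t1 : t < 1 by rewrite tE ltr_pdivrMr; lra.
have tC : t * C <= d by rewrite tE mulrAC ler_pdivrMr ?ler_pM2l//; lra.
have bnd (q : R) : `|q| <= C -> `|t * q| <= d.
  by move=> qC; rewrite normrM gtr0_norm//; apply: le_trans tC; rewrite ler_pM2l.
exists (seg c x (1 - t)); split.
- by apply: interior_seg => //; lra.
- have -> : (seg c x (1 - t)).1 - x.1 = t * (c.1 - x.1) by rewrite /seg /mv /=; ring.
  by apply: bnd; lra.
- have -> : (seg c x (1 - t)).2 - x.2 = t * (c.2 - x.2) by rewrite /seg /mv /=; ring.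
  by apply: bnd; lra.
have t1' : 0 <= 1 - t by lra.
have t1'' : 1 - t <= 1 by lra.
have := cu _ _ _ (interiorW Ic) Ox t1' t1''.
have /bnd : `|u c - u x| <= C by lra.
by rewrite ler_norml => /andP[h _]; lra.
Qed.

Lemma vertical_extent A (B : R) : A !=set0 -> (forall x, A x -> `|x.2| <= B) ->
  exists yl yh, (forall x, A x -> yl <= x.2 <= yh) /\
  forall d, 0 < d -> (exists2 p, A p & p.2 < yl + d) /\ (exists2 q, A q & yh - d < q.2).
Proof.
move=> [x Ax] AB; pose S := [set z.2 | z in A].
have Sn : S !=set0 by exists x.2, x.
have Sl : has_lbound S by exists (- B) => _ [z Az <-]; have := AB _ Az; rewrite ler_norml => /andP[].
have Su : has_ubound S by exists B => _ [z Az <-]; have := AB _ Az; rewrite ler_norml => /andP[].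
exists (inf S), (sup S); split=> [z Az|d d0].
  by apply/andP; split; [apply: ge_inf|apply: ub_le_sup] => //; exists z.
split.
  by have [|_ [z Az <-] h] := @inf_adherent _ S d d0; [split|exists z].
by have [|_ [z Az <-] h] := @sup_adherent _ S d d0; [split|exists z].
Qed.

End cap_extent.

(** * The length of a thin cap *)

Section thin_cap.
Context {R : realType}.
Variables (Om : set (R * R)) (B M : R) (u : R * R -> R) (x0 : R * R) (a b c e : R).
Hypotheses (OmB : planar_body Om B) (ou : optimal Om M u) (Ox0 : Om x0) (a0 : 0 < a)
  (ac : a < c) (cb : c < b) (e0 : 0 < e)
  (ua : forall x, Om x -> u x <= u x0 - a * (x.1 - x0.1))
  (ub : forall x, Om x -> u x <= u x0 - b * (x.1 - x0.1)).
Notation wid := (width a b c e).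
(* [r] is a point up the slope, at distance about [s] from the edge. *)
Variables (r : R * R) (s D : R).
Hypotheses (Ir : Om° r) (s0 : 0 < s) (D0 : 0 < D)
  (r1 : - (9 / 8 * s) <= r.1 - x0.1) (r2 : r.1 - x0.1 <= - (7 / 8 * s))
  (ur : u x0 + 7 / 8 * a * s <= u r) (rD : forall x, Om x -> `|r.2 - x.2| <= D)
  (ws : wid <= s / 16) (cws : c * wid <= a * s / 32).
Implicit Types (x y z p q : R * R).
Notation cap := (cap Om u x0 c e).
Notation height := (cap_height u x0 c e).

Let cO : cvx Om. Proof. by case: OmB. Qed.
Let cu : ccv Om u. Proof. by case: ou => -[]. Qed.

Lemma cap_width x : cap x -> `|x.1 - x0.1| <= wid.
Proof.
have [ac' cb' e0'] := And3 ac cb e0.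
move=> [Ix hx]; have [h1 h2] := cap_strip ac cb ua ub (interiorW Ix) hx.
have i1 : 0 < e / (c - a) by rewrite divr_gt0//; lra.
have i2 : 0 < e / (b - c) by rewrite divr_gt0//; lra.
by rewrite /width ler_norml; apply/andP; split; lra.
Qed.

(** The tangent plane at [x] lies above the graph at [r], which is higher by nearly [7 / 8 * a * s]
    at a distance about [s] across the edge. What the first slope does not provide of this climb,
    the second slope must provide over a distance of at most [D]. *)
Lemma cap_gradient x : cap x -> regular Om u x -> a / 2 <= - rder Om u e1 x \/
  s * (a / 4 + 3 / 4 * pos (rder Om u e1 x)) <= `|rder Om u e2 x| * D.
Proof.
move=> cx [_ _ pu _]; have [Ix _] := cx.
have [|za] := leP (a / 2) (- rder Om u e1 x); first by left.
right; have [ws' cws' s0' a0'] := And4 ws cws s0 a0; have [r1' r2' ur' e0'] := And4 r1 r2 ur e0.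
have := pu _ (interiorW Ir); rewrite /rgrad /=.
have := cap_width cx; rewrite ler_norml => /andP[x1 x2].
have q1 : rder Om u e2 x * (r.2 - x.2) <= `|rder Om u e2 x| * D.
  by apply: le_trans (ler_norm _) _; rewrite normrM ler_wpM2l// rD//; exact: interiorW.
have c0 : 0 < c by exact: lt_trans ac.
have ux : u x <= u x0 + a * s / 32.
  have := cap_height_le ac cb e0 ua ub (interiorW Ix); rewrite /cap_height /cut_plane.
  have := ler_wpM2l (ltW c0) x1; rewrite mulrN.
  by move: cws'; move: (c * _) => w; lra.
move: (rder Om u e1 x) za q1 => z za q1.
rewrite /pos; case: (leP 0 z) => z0 pr; rewrite ?mulr0 ?addr0.
  have h : 3 / 4 * s <= x.1 - r.1 by lra.
  have := ler_wpM2l z0 h.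
  have as0 : 0 < a * s by exact: mulr_gt0.
  by lra.
have h : 0 <= 19 / 16 * s - (x.1 - r.1) by lra.
have za' : 0 <= z + a / 2 by lra.
have h' : 0 <= x.1 - r.1 by lra.
have := mulr_ge0 za' h'.
have a2 : 0 <= a / 2 by lra.
have := mulr_ge0 a2 h.
by lra.
Qed.

Notation margin := (3 * wid * D / s).

(** The point of the segment from [q] to [r] at ordinate [t] has a parameter [l] with
    [l * s >= 3 * wid]. Since [r] is at least [7 / 8 * s] behind the edge, that point is to the left
    of the strip of the cap, and [cleanP] applies. *)
Lemma clean_between q t : cap q -> margin <= `|t - q.2| ->
  (q.2 <= t <= r.2) || (r.2 <= t <= q.2) -> clean Om u x0 c e t.
Proof.
have [ac' cb' e0'] := And3 ac cb e0.
move=> cq tq tr; have [Iq _] := cq; have [s0' D0' r2'] := And3 s0 D0 r2.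
have w0 : 0 < wid by exact: width_gt0.
have m0 : 0 < margin by rewrite divr_gt0// !mulr_gt0.
have qt0 : 0 < `|t - q.2| by exact: lt_le_trans tq.
have rq : `|r.2 - q.2| <= D by rewrite rD//; exact: interiorW.
have nE : `|t - q.2| + `|r.2 - t| = `|r.2 - q.2|.
  case/orP: tr => /andP[h1 h2].
    by rewrite !ger0_norm; lra.
  by rewrite !ler0_norm; lra.
have rt0 := normr_ge0 (r.2 - t).
have rq0 : 0 < `|r.2 - q.2| by lra.
have d0 : r.2 - q.2 != 0 by rewrite -normr_gt0.
have [l lE] : exists l, l = (t - q.2) / (r.2 - q.2) by eexists.
have l0 : 0 <= l.
  rewrite lE; case/orP: tr => /andP[h1 h2].
    by rewrite divr_ge0//; lra.
  by rewrite -mulrNN -invrN divr_ge0//; lra.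
have lN : l * `|r.2 - q.2| = `|t - q.2|.
  by rewrite -(ger0_norm l0) -normrM lE divfK.
have l1 : l <= 1 by rewrite -(ler_pM2r rq0) lN mul1r; lra.
have lD : margin <= l * D.
  by apply: le_trans tq _; rewrite -lN ler_wpM2l.
have ls : 3 * wid <= l * s.
  by rewrite -(ler_pM2r D0'); move: lD; rewrite ler_pdivrMr//; lra.
have Iz := interior_cvx cO Iq Ir l0 l1.
have -> : t = (seg q r l).2 by rewrite /seg /mv /= lE divfK//; ring.
apply: (cleanP OmB ou ac cb ua ub Iz).
have /ler_normlP[_ q1] := cap_width cq.
have := ler_wpM2l l0 r2'.
have l1' : 0 <= 1 - l by lra.
have := ler_wpM2l l1' q1; have lw : 0 <= l * wid by rewrite mulr_ge0// ltW.
have i2 : 0 < e / (b - c) by rewrite divr_gt0//; lra.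
have wE : wid = e / (c - a) + e / (b - c) by [].
rewrite /seg /mv /=; lra.
Qed.

Variables (yl yh : R).
Hypotheses (Hy : forall x, cap x -> yl <= x.2 <= yh)
  (Hl : forall d, 0 < d -> exists2 p, cap p & p.2 < yl + d)
  (Hh : forall d, 0 < d -> exists2 q, cap q & yh - d < q.2).

(** The extreme point used is the one separated from [r.2] by [t]. One margin is its distance to the
    true end of the cap, the other its distance to [t]. *)
Lemma cap_clean t : yl + 2 * margin <= t -> t <= yh - 2 * margin -> clean Om u x0 c e t.
Proof.
have w0 : 0 < wid by exact: width_gt0.
have m0 : 0 < margin by rewrite divr_gt0// !mulr_gt0.
move=> t1 t2; have [p cp pl] := Hl m0; have [q cq qh] := Hh m0.
have [rt|rt] := leP r.2 t.
  apply: (clean_between cq); last by apply/orP; right; apply/andP; split; lra.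
  by rewrite distrC; apply: le_trans (ler_norm _); lra.
apply: (clean_between cp); last by apply/orP; left; apply/andP; split; lra.
by apply: le_trans (ler_norm _); lra.
Qed.

(** From a point [x] near the edge point, of height at least [3 / 4 * e], a segment runs to a nearly
    extreme point of the cap; its first half keeps height [e / 4]. The end is chosen on the longer
    side of [x], so that this half spans about a quarter of the cap, and its ordinates at least
    [2 * m] away from [x.2] are clean. *)
Lemma cap_pos_long : 10 * margin <= yh - yl ->
  ((e * ((yh - yl) / 16 - 5 / 8 * margin))%:E <=
   \int[leb2]_(x in cap) (pos (rder Om u e1 x + c))%:E)%E.
Proof.
have [e0' ac'] := conj e0 ac; have c0 : 0 < c := lt_trans a0 ac.
have w0 : 0 < wid by exact: width_gt0.
have m0 : 0 < margin by rewrite divr_gt0// !mulr_gt0.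
have [m mE] : exists m, m = margin by eexists.
move=> L10; have [p cp pl] := Hl m0; have [q cq qh] := Hh m0.
have cc := @cap_clean; rewrite -mE in m0 pl qh L10 cc *.
(* Replacing [x0] by an interior point within [c1] costs at most [c1 * (1 + c) = e / 4] of
   height. *)
have [c1 c1E] : exists c1, c1 = e / (4 * (1 + c)) by eexists.
have c10 : 0 < c1 by rewrite c1E divr_gt0//; lra.
have c1e : c1 * (1 + c) = e / 4 by rewrite c1E; field; rewrite gt_eqF//; lra.
have [x [Ix x1 _ ux]] := interior_approx cO cu Ir Ox0 c10.
have hx : 3 / 4 * e <= height x.
  rewrite /cap_height /cut_plane; have /ler_normlP[+ _] := x1.
  by move=> /(ler_wpM2l (ltW c0)); lra.
have cx : cap x by split => //; lra.
have hseg z l : cap z -> 0 <= l -> l <= 1 / 2 -> cap (seg x z l) /\ e / 4 <= height (seg x z l).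
  move=> cz l0 l2; have [Iz hz] := cz.
  have l1' : l <= 1 by lra.
  split; first exact: (cap_cvx OmB ou cx cz l0 l1').
  have := cap_height_ccv x0 c e ou (interiorW Ix) (interiorW Iz) l0 l1'.
  have := mulr_ge0 l0 (ltW hz).
  have l1'' : 0 <= 1 / 2 - l by lra.
  have hx' : 0 <= height x by lra.
  by have := mulr_ge0 l1'' hx'; lra.
have /andP[xl xh] := Hy cx; have /andP[ql qh'] := Hy cq; have /andP[pl' ph] := Hy cp.
have main m1 m2 z : cap z -> m1 <= m2 -> yl + 2 * m <= m1 -> m2 <= yh - 2 * m ->
    (yh - yl) / 4 - 5 / 2 * m <= m2 - m1 ->
    (forall t, m1 <= t -> t <= m2 -> exists l, [/\ 0 <= l, l <= 1 / 2 & (seg x z l).2 = t]) ->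
    ((e * ((yh - yl) / 16 - 5 / 8 * m))%:E <=
   \int[leb2]_(x in cap) (pos (rder Om u e1 x + c))%:E)%E.
  move=> cz m12 lo hi len Hm.
  apply: (@le_trans _ _ (e / 4 * (m2 - m1))%:E).
    rewrite lee_fin -[e / 4 * _]mulrA ler_pM2l//; lra.
  apply: (cap_pos_ge OmB ou ac cb e0 ua ub m12) => t t1 t2; split.
    by apply: cc; lra.
  have [l [l0 l2 lt]] := Hm _ t1 t2.
  by exists (seg x z l).1; rewrite -lt -surjective_pairing; exact: hseg.
have segP z t : 0 <= (t - x.2) / (z.2 - x.2) <= 1 / 2 -> z.2 - x.2 != 0 ->
    exists l, [/\ 0 <= l, l <= 1 / 2 & (seg x z l).2 = t].
  move=> /andP[h1 h2] h3; exists ((t - x.2) / (z.2 - x.2)); split => //.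
  by rewrite /seg /mv /= divfK//; ring.
clear hseg hx ux x1 c1e c10 c1E e0' ac' c0 w0 mE.
have [hi|lo] := leP ((yh + yl) / 2) (yl + yh - x.2).
  apply: (main (x.2 + 2 * m) ((x.2 + q.2) / 2) q) => //; try lra.
  have d0 : 0 < q.2 - x.2 by lra.
  move=> t t1 t2; apply: segP; last by rewrite gt_eqF.
  apply/andP; split; first by apply: divr_ge0; lra.
  by rewrite ler_pdivrMr//; lra.
apply: (main ((x.2 + p.2) / 2) (x.2 - 2 * m) p) => //; try lra.
have d0 : p.2 - x.2 < 0 by lra.
move=> t t1 t2; apply: segP; last by rewrite lt_eqF.
have -> : (t - x.2) / (p.2 - x.2) = (x.2 - t) / (x.2 - p.2).
  by rewrite -mulrNN -invrN !opprB.
apply/andP; split; first by apply: divr_ge0; lra.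
by rewrite ler_pdivrMr; lra.
Qed.

(** Inserting [cap_neg_le] into [cap_integrand_le] cancels [slope_loss c] in front of the ascent and
    leaves [2 * k] times the ascent, which is at least of order [e] times the length. The [eta] term
    consumes half of that since [eta * wid <= e / 16]; everything else is of order [e * wid]. *)
Lemma cap_short (k C eta : R) : 0 < k -> k <= slope_loss c -> 0 <= C -> 0 < eta ->
  eta * wid <= e / 16 -> e * (1 + c / (b - c)) <= u x0 ->
  (forall z : R * R, (a / 2 <= - z.1 \/ s * (a / 4 + 3 / 4 * pos z.1) <= `|z.2| * D) ->
    fres (- c, 0) + (slope_loss c + k) * pos (z.1 + c) <=
    fres z + (slope_loss c - k) * neg (z.1 + c) + k * eta + C * `|z.2|) ->
  10 * margin <= yh - yl ->
  k / 16 * (yh - yl) <= (4 * slope_loss c + 5 / 4 * k) * margin + 2 * C * wid.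
Proof.
have [e0' ac'] := conj e0 ac; have c0 : 0 < c := lt_trans a0 ac.
have w0 : 0 < wid by exact: width_gt0.
have m0 : 0 < margin by rewrite divr_gt0// !mulr_gt0.
move=> k0 kl C0 eta0 etaw ue Hf L10.
have lk : 0 <= slope_loss c - k by lra.
have main := cap_integrand_le OmB ou ac cb c0 e0 ue ua ub C0 k0 eta0 lk Hf cap_gradient.
have P1 := cap_pos_long L10.
have ylh : yl <= yh by lra.
have P2 := cap_pos_le OmB ou ac cb e0 ua ub ylh Hy.
have m20 : 0 <= 2 * margin by lra.
have N := cap_neg_le OmB ou ac cb e0 ua ub m20 Hy cap_clean.
have T := cap_tangential_le OmB ou ac cb e0 ua ub.
have A := cap_area ou ac cb e0 ua ub ylh Hy.
have lkE : (0 <= (slope_loss c - k)%:E)%E by rewrite lee_fin.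
have ke : (0 <= (k * eta)%:E)%E by rewrite lee_fin mulr_ge0// ltW.
have CE : (0 <= C%:E)%E by rewrite lee_fin.
have := le_trans main (leeD (leeD (lee_wpmul2l lkE N) (lee_wpmul2l ke A)) (lee_wpmul2l CE T)).
move: (integral _ _ _) P1 P2 => X P1 P2.
have XE : X = (fine X)%:E.
  rewrite fineK// ge0_fin_numE; first exact: le_lt_trans P2 (ltry _).
  apply: le_trans P1; rewrite lee_fin; apply: mulr_ge0; first exact: ltW.
  lra.
have [m mE] : exists m, m = margin by eexists.
rewrite -mE in m0 L10 P1 *; rewrite XE in P1 *.
rewrite -[(_ + (2 * e * _)%:E)%E]EFinD -!EFinM -!EFinD !lee_fin.
move: P1; rewrite lee_fin; move: (fine X) => Y /(ler_wpM2l (ltW k0)) P1 key.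
rewrite -(ler_pM2l e0).
have kL : 0 <= k * (yh - yl) by rewrite mulr_ge0 ?(ltW k0)//; lra.
have := ler_wpM2l kL etaw.
have := mulr_ge0 (mulr_ge0 (ltW k0) (ltW m0)) (ltW e0).
by lra.
Qed.

End thin_cap.

(** * Choice of the depth of the cut *)

Section steep_ridge.
Context {R : realType}.
Implicit Types (Om : set (R * R)) (u : R * R -> R) (x y z p q : R * R).

(** The direction is realized with relative error [1 / 16] and the point then pushed into the
    interior at the same cost, whence the fractions [7 / 8] and [9 / 8]. *)
Lemma upslope_point Om u x0 (a : R) : cvx Om -> ccv Om u -> Om° !=set0 -> 0 < a -> reaches Om u x0 (-1, 0) a ->
  exists s r, [/\ 0 < s, Om° r, - (9 / 8 * s) <= r.1 - x0.1, r.1 - x0.1 <= - (7 / 8 * s)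
    & u x0 + 7 / 8 * a * s <= u r].
Proof.
move=> cO cu [z Iz] a0 rl.
have [d [d0 d1 da]] : exists d, [/\ 0 < d, d <= 1 / 16 & d <= a / 16].
  exists (Num.min (1 / 16) (a / 16)); split; last 2 first.
  - by rewrite ge_min lexx.
  - by rewrite ge_min lexx orbT.
  by rewrite lt_min; apply/andP; split; lra.
have [s s0 /(_ s s0 (lexx s))[r0 [Or0 /ler_normlP[r1 r2] _ ur]]] := rl _ d0.
have ds0 : 0 < d * s by exact: mulr_gt0.
have [r [Ir /ler_normlP[t1 t2] _ ur']] := interior_approx cO cu Iz Or0 ds0.
have ds1 : d * s <= 1 / 16 * s by rewrite ler_pM2r.
have dsa : d * s <= a / 16 * s by rewrite ler_pM2r.
by rewrite /= in r1 r2; exists s, r; split => //; lra.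
Qed.

(** Along the edge the tangent cone allows only a loss small compared with the distance: at distance
    [2 * K * e] at most half of the depth [e] is lost, for any fixed [K] and small [e]. Passing to
    interior points costs the rest of the slack. *)
Lemma long_cap Om u x0 (c K : R) : cvx Om -> ccv Om u -> Om° !=set0 -> Om x0 -> 0 < c -> 0 < K -> reaches Om u x0 (0, 1) 0 ->
  exists2 s, 0 < s & forall e, 0 < e -> e <= s ->
  exists p q, [/\ cap Om u x0 c e p, cap Om u x0 c e q & K * e <= q.2 - p.2].
Proof.
move=> cO cu [w Iw] Ox0 c0 K0 ru; have P : 0 < 4 * K * (1 + c) by rewrite !mulr_gt0// addr_gt0.
have [d [d0 d1 d2]] : exists d, [/\ 0 < d, d <= 1 / 4 & d * (4 * K * (1 + c)) <= 1].
  exists (Num.min (1 / 4) (1 / (4 * K * (1 + c)))); split.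
  - by rewrite lt_min divr_gt0// divr_gt0.
  - by rewrite ge_min lexx.
  - by rewrite -ler_pdivlMr// ge_min lexx orbT.
have [s1 s10 Hs] := ru _ d0.
have K2 : 0 < 2 * K by exact: mulr_gt0.
exists (s1 / (2 * K)) => [|e e0]; first exact: divr_gt0.
rewrite ler_pdivlMr// mulrC => es.
have Ke : 0 < K * e by exact: mulr_gt0.
have [y [Oy /ler_normlP[y1 _] /ler_normlP[y2 _] uy]] := Hs _ (mulr_gt0 K2 e0) es.
rewrite /= mulr0 subr0 in y1; rewrite /= mulr1 in y2; rewrite sub0r in uy.
have dK : d * (2 * K * e) * (1 + c) <= e / 2.
  by have := ler_wpM2r (ltW e0) d2; rewrite mul1r; clear - e0; lra.
have dK' : d * (2 * K * e) <= 1 / 4 * (2 * K * e) by rewrite ler_pM2r// mulr_gt0.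
have c1 : 0 < 1 + c by exact: addr_gt0.
have [r [r0 rK re]] : exists r, [/\ 0 < r, r <= K * e / 4 & r * (1 + c) <= e / 4].
  exists (Num.min (K * e / 4) (e / 4 / (1 + c))); split.
  - by rewrite lt_min !divr_gt0.
  - by rewrite ge_min lexx.
  - by rewrite -ler_pdivlMr// ge_min lexx orbT.
have near z z' : Om° z' -> `|z'.1 - z.1| <= r -> u z - r <= u z' ->
    e / 2 <= cap_height u x0 c e z -> cap Om u x0 c e z'.
  move=> Iz' /ler_normlP[z1 _] uz hz; split => //.
  move: hz; rewrite /cap_height /cut_plane; have := ler_wpM2l (ltW c0) z1.
  by clear - uz re e0; lra.
have [p [Ip p1 /ler_normlP[_ p2] up]] := interior_approx cO cu Iw Ox0 r0.
have [q [Iq q1 /ler_normlP[q2 _] uq]] := interior_approx cO cu Iw Oy r0.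
exists p, q; split.
- by apply: near up _ => //; rewrite /cap_height /cut_plane; clear - e0; lra.
- apply: near uq _ => //; rewrite /cap_height /cut_plane.
  by have := ler_wpM2l (ltW c0) y1; clear - dK uy; lra.
by clear - p2 q2 y2 dK' rK; lra.
Qed.

(* [K] is chosen so that [cap_short] bounds the length of the cap by less than
   [K * e], whatever the depth [e] of the cut. *)
Lemma steep_ridge_false Om (B M : R) u x0 (a b : R) : planar_body Om B -> optimal Om M u ->
  Om x0 -> 0 < u x0 ->
  0 < a -> a < b -> 1 <= b ->
  (forall x, Om x -> u x <= u x0 - a * (x.1 - x0.1)) ->
  (forall x, Om x -> u x <= u x0 - b * (x.1 - x0.1)) ->
  reaches Om u x0 (-1, 0) a -> reaches Om u x0 (0, 1) 0 -> False.
Proof.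
move=> OmB ou Ox0 u0 a0 ab b1 ua ub rl ru.
have [c [ac cb m0]] := cut_slope a0 ab b1.
have c0 : 0 < c := lt_trans a0 ac.
have [cO _ iO bO] := OmB; have [[cu _] _] := ou.
have [D DE] : exists D, D = 2 * B + 1 by eexists.
have B0 : 0 <= B by have [h _] := bO _ Ox0; apply: le_trans h.
have D0 : 0 < D by clear - B0 DE; lra.
have [s [r [s0 Ir r1 r2 ur]]] := upslope_point cO cu iO a0 rl.
have rD x : Om x -> `|r.2 - x.2| <= D.
  move=> /bO[_]; have [_] := bO _ (interiorW Ir); rewrite !ler_norml => /andP[? ?] /andP[? ?].
  by apply/andP; clear r1 r2 ur; split; lra.
have bc0 : 0 < b - c by rewrite subr_gt0.
have [W WE] : exists W, W = 1 / (c - a) + 1 / (b - c) by eexists.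
have W0 : 0 < W by rewrite WE addr_gt0// divr_gt0// subr_gt0.
have widE e : width a b c e = e * W by rewrite /width WE; ring.
have [eta etaE] : exists eta, eta = 1 / (16 * W) by eexists.
have eta0 : 0 < eta by rewrite etaE divr_gt0// mulr_gt0.
have etaW : eta * W = 1 / 16 by rewrite etaE; field; rewrite gt_eqF.
have [k [C [k0 kl C0 Hf]]] := cut_integrand a0 ac m0 eta0 s0 D0.
have l0 := slope_loss_gt0 c0.
have [m mE] : exists m, m = 3 * W * D / s by eexists.
have mp : 0 < m by rewrite mE divr_gt0// !mulr_gt0.
have marE e : 3 * width a b c e * D / s = e * m by rewrite widE mE; ring.
have [K0 K0E] : exists K0, K0 = (4 * slope_loss c + 5 / 4 * k) * m + 2 * C * W by eexists.
have K00 : 0 <= K0.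
  by rewrite K0E; apply: addr_ge0; apply: mulr_ge0; rewrite ?(ltW mp) ?(ltW W0)//;
    [clear - l0 k0; lra|exact: mulr_ge0].
(* The term [10 * m] meets the length hypothesis of [cap_short], and [16 * K0 / k] contradicts its
   conclusion. *)
have [K [K1 K2 K3]] : exists K, [/\ 0 < K, 10 * m <= K & K0 < k / 16 * K].
  have q0 : 0 <= 16 * K0 / k by apply: divr_ge0; [exact: mulr_ge0|exact: ltW].
  exists (10 * m + 16 * K0 / k + 1); clear - q0 mp k0; split; [lra|lra|].
  have -> : k / 16 * (10 * m + 16 * K0 / k + 1) = k / 16 * (10 * m + 1) + K0.
    by field; rewrite gt_eqF.
  by rewrite ltrDr mulr_gt0//; lra.
have [s1 s10 Hs] := long_cap cO cu iO Ox0 c0 K1 ru.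
have P1 : 0 < 1 + c / (b - c) by rewrite addr_gt0// divr_gt0.
have [e [e0 h1 h2 [h3 h4]]] : exists e, [/\ 0 < e, e * W <= s / 16, c * (e * W) <= a * s / 32 &
    e * (1 + c / (b - c)) <= u x0 /\ e <= s1].
  have q1 : 0 < s / 16 / W by rewrite !divr_gt0.
  have q2 : 0 < a * s / 32 / (c * W) by rewrite !divr_gt0// mulr_gt0.
  have q3 : 0 < u x0 / (1 + c / (b - c)) by rewrite divr_gt0.
  exists (Num.min (Num.min (s / 16 / W) (a * s / 32 / (c * W)))
    (Num.min (u x0 / (1 + c / (b - c))) s1)).
  have cW : 0 < c * W by exact: mulr_gt0.
  rewrite !lt_min q1 q2 q3 s10 mulrCA -!ler_pdivlMr//.
  by rewrite !ge_min !lexx !orbT.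
have wid1 : width a b c e <= s / 16 by rewrite widE.
have wid2 : c * width a b c e <= a * s / 32 by rewrite widE.
have wid3 : eta * width a b c e <= e / 16 by rewrite widE mulrCA etaW mulrA mulr1.
have [p [q [cp cq pq]]] := Hs _ e0 h4.
have cB x : cap Om u x0 c e x -> `|x.2| <= B by move=> [/interiorW/bO[]].
have [yl [yh [Hy Hlh]]] := vertical_extent (ex_intro _ p cp) cB.
have Hl d (d0 : 0 < d) := (Hlh _ d0).1; have Hh d (d0 : 0 < d) := (Hlh _ d0).2.
have L : K * e <= yh - yl.
  have /andP[_ qh] := Hy _ cq; have /andP[pl _] := Hy _ cp.
  by clear - qh pl pq; lra.
have L10 : 10 * (3 * width a b c e * D / s) <= yh - yl.
  by rewrite marE; have := ler_wpM2r (ltW e0) K2; clear - L; lra.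
have := cap_short OmB ou Ox0 a0 ac cb e0 ua ub Ir s0 D0 r1 r2 ur rD wid1 wid2 Hy Hl Hh
  k0 kl C0 eta0 wid3 h3 Hf L10.
rewrite marE widE.
have : k / 16 * (K * e) <= k / 16 * (yh - yl) by rewrite ler_pM2l// divr_gt0.
have : K0 * e < k / 16 * K * e by rewrite ltr_pM2r.
by rewrite K0E; move: (slope_loss c) (yh - yl) => l L'; clear; lra.
Qed.

End steep_ridge.

(** * Rotations *)

Section rotation_lemmas.
Context {R : realType}.
Variables c s : R.
Hypothesis cs : c ^+ 2 + s ^+ 2 = 1.
Implicit Types (Om : set (R * R)) (u v : R * R -> R) (x y z d : R * R).
Notation T := (rotation c s).
Notation T' := (rotation c (- s)).

Lemma rotationK x : T' (T x) = x.
Proof.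
have cs' := cs; rewrite !expr2 in cs'.
case: x => p q; rewrite /rotation /=; congr pair.
  have -> : c * (c * p - s * q) - - s * (s * p + c * q) = (c * c + s * s) * p by ring.
  by rewrite cs' mul1r.
have -> : - s * (c * p - s * q) + c * (s * p + c * q) = (c * c + s * s) * q by ring.
by rewrite cs' mul1r.
Qed.

Lemma rotation_seg x y t : T (seg x y t) = seg (T x) (T y) t.
Proof. by rewrite /rotation /seg /mv /=; congr pair; ring. Qed.

Lemma rotation_bound (p q e : R) : `|p| <= e -> `|q| <= e -> `|c * p - s * q| <= 2 * e.
Proof.
have le1 (w w' : R) : w ^+ 2 + w' ^+ 2 = 1 -> `|w| <= 1.
  move=> E; rewrite -(@expr_le1 _ 2)// real_normK ?num_real// -E lerDl; exact: sqr_ge0.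
have c1 := le1 _ _ cs; have s1 : `|s| <= 1 by apply: (le1 s c); rewrite addrC.
move=> pe qe; have e0 : 0 <= e by apply: le_trans pe.
apply: le_trans (ler_normB _ _) _; rewrite !normrM mulr_natl mulr2n.
by apply: lerD; rewrite -[leRHS]mul1r ler_pM.
Qed.
End rotation_lemmas.

Section rotated_body.
Context {R : realType}.
Implicit Types (c s : R) (Om : set (R * R)) (u v : R * R -> R) (x y z d : R * R).

Lemma rotationVK c s x : c ^+ 2 + s ^+ 2 = 1 -> rotation c s (rotation c (- s) x) = x.
Proof. by move=> cs; rewrite -{1}[s]opprK rotationK// sqrrN. Qed.

Lemma rotation_dist c s x y e : c ^+ 2 + s ^+ 2 = 1 -> `|y.1 - x.1| <= e -> `|y.2 - x.2| <= e ->
  `|(rotation c s y).1 - (rotation c s x).1| <= 2 * e /\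
  `|(rotation c s y).2 - (rotation c s x).2| <= 2 * e.
Proof.
move=> cs h1 h2; rewrite /rotation /=; split.
  have -> : c * y.1 - s * y.2 - (c * x.1 - s * x.2) = c * (y.1 - x.1) - s * (y.2 - x.2) by ring.
  exact: rotation_bound.
have -> : s * y.1 + c * y.2 - (s * x.1 + c * x.2) = s * (y.1 - x.1) - (- c) * (y.2 - x.2) by ring.
by apply: rotation_bound; rewrite ?sqrrN// addrC.
Qed.

Lemma rotation_open c s A : c ^+ 2 + s ^+ 2 = 1 -> open A -> open (rotation c s @^-1` A).
Proof.
move=> cs /plane_openP oA; apply/plane_openP => x /oA[e e0 H].
exists (e / 4) => [|y y1 y2]; first by rewrite divr_gt0.
have [h1 h2] := rotation_dist cs (ltW y1) (ltW y2).
by apply: H; [apply: le_lt_trans h1 _|apply: le_lt_trans h2 _]; lra.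
Qed.

Lemma rotation_interior c s Om : c ^+ 2 + s ^+ 2 = 1 ->
  (rotation c s @^-1` Om)° = rotation c s @^-1` Om°.
Proof.
move=> cs; apply/seteqP; split.
  have csN : c ^+ 2 + (- s) ^+ 2 = 1 by rewrite sqrrN.
  have : rotation c (- s) @^-1` (rotation c s @^-1` Om)° `<=` Om°.
    rewrite -open_subsetE; last by apply: rotation_open => //; exact: open_interior.
    by move=> x /= /interior_subset /=; rewrite rotationVK.
  by move=> H x Ix; apply: H => /=; rewrite rotationK.
rewrite -open_subsetE; last by apply: rotation_open => //; exact: open_interior.
by move=> x /interior_subset.
Qed.

Lemma rotation_ccv c s Om u : ccv Om u -> ccv (rotation c s @^-1` Om) (u \o rotation c s).
Proof. by move=> cu x y t Ox Oy t0 t1 /=; rewrite rotation_seg; exact: cu. Qed.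

Lemma rotation_body c s Om B : c ^+ 2 + s ^+ 2 = 1 -> planar_body Om B ->
  planar_body (rotation c s @^-1` Om) (2 * B).
Proof.
move=> cs [cO clO [x Ix] bO]; split.
- by move=> y z t Oy Oz t0 t1; rewrite /= rotation_seg; exact: cO.
- by rewrite -openC preimage_setC; apply: rotation_open => //; rewrite openC.
- by exists (rotation c (- s) x); rewrite rotation_interior//= rotationVK.
move=> y /bO[h1 h2].
have csN : c ^+ 2 + (- s) ^+ 2 = 1 by rewrite sqrrN.
have := @rotation_dist c (- s) (0, 0) (rotation c s y) B csN.
rewrite rotationK// !subr0 => /(_ h1 h2).
by rewrite {1 2}/rotation /= !mulr0 subr0 addr0 !subr0.
Qed.

(** Composition with a rotation rotates the gradient by the inverse, and [fres] sees only its
    length. The gradient of the composite is identified by uniqueness of the supergradient at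
    regular points. *)
Lemma rotation_resistance c s Om B u : c ^+ 2 + s ^+ 2 = 1 -> planar_body Om B -> ccv Om u ->
  (\int[leb2]_(x in (rotation c s @^-1` Om)°)
     (fres (rgrad (rotation c s @^-1` Om) (u \o rotation c s) x))%:E =
   \int[leb2]_(x in Om°) (fres (rgrad Om u x))%:E)%E.
Proof.
move=> cs OmB cu.
have mI := @interior_measurable _ Om.
have mI' := @interior_measurable _ (rotation c s @^-1` Om).
have Tp := plane_preserving_rotation cs.
have mf : measurable_fun Om° (fun x => (fres (rgrad Om u x))%:E).
  by apply/measurable_EFinP; exact: measurable_fres_rgrad.
have cu' := rotation_ccv (c := c) (s := s) cu.
have OmB' := rotation_body cs OmB.
rewrite -(plane_preserving_integral Tp mI mf); last by move=> x _; rewrite lee_fin fres_ge0.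
rewrite -rotation_interior//.
have ae' := body_regular_ae OmB' cu'.
have aeT : {ae leb2, forall x, (rotation c s @^-1` Om)° x -> regular Om u (rotation c s x)}.
  have [N [mN N0 sN]] := body_regular_ae OmB cu.
  exists (rotation c s @^-1` N); split.
  - by rewrite -[X in measurable X]setTI; case: Tp => mT _; exact: mT.
  - by case: Tp => _ ->.
  move=> x /= nx; apply: sN => /= H; apply: nx => Ix; apply: H.
  by move: Ix; rewrite rotation_interior.
apply: ae_eq_integral => //.
- by apply/measurable_EFinP; exact: measurable_fres_rgrad.
- apply: (measurable_comp mI _ mf); first by move=> _ [x + <-]; rewrite rotation_interior.
  by case: Tp => mT _; apply: measurable_funS mT.
apply: ae_app2 ae' aeT => x r1 r2 Ix.
have {r1}r1 := r1 Ix; have {r2} [_ _ pu _] := r2 Ix.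
congr (_ %:E).
rewrite -(regular_unique r1 (z := rotation c (- s) (rgrad Om u (rotation c s x)))).
  move: (rgrad Om u _) => z; have cs' := cs; rewrite !expr2 in cs'.
  rewrite /fres /rotation /=; congr (1 / (1 + _)).
  have -> : (c * z.1 - - s * z.2) ^+ 2 + (- s * z.1 + c * z.2) ^+ 2 =
    (c * c + s * s) * (z.1 ^+ 2 + z.2 ^+ 2) by ring.
  by rewrite cs' mul1r.
move=> y Oy; have := pu _ Oy; move: (rgrad Om u _) => z.
rewrite /= /rotation /=; lra.
Qed.

Lemma rotation_optimal c s Om B M u : c ^+ 2 + s ^+ 2 = 1 -> planar_body Om B -> optimal Om M u ->
  optimal (rotation c s @^-1` Om) M (u \o rotation c s).
Proof.
move=> cs OmB [[cu bu] min]; have csN : c ^+ 2 + (- s) ^+ 2 = 1 by rewrite sqrrN.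
split=> [|v [cv bv]]; first by split; [exact: rotation_ccv|move=> x; exact: bu].
have OmB' := rotation_body cs OmB.
have OmE : rotation c (- s) @^-1` (rotation c s @^-1` Om) = Om.
  by apply/seteqP; split=> x; rewrite /= rotationVK.
rewrite (rotation_resistance cs OmB cu) -(rotation_resistance csN OmB' cv) OmE.
apply: min; split; first by rewrite -[X in ccv X]OmE; exact: rotation_ccv.
by move=> x Ox; apply: bv; rewrite /= rotationVK.
Qed.

Lemma rotation_reaches c s Om u x d h : c ^+ 2 + s ^+ 2 = 1 ->
  reaches Om u (rotation c s x) (rotation c s d) h ->
  reaches (rotation c s @^-1` Om) (u \o rotation c s) x d h.
Proof.
move=> cs H e e0; have e2 : 0 < e / 2 by rewrite divr_gt0.
have [t0 t00 {}H] := H _ e2; exists t0 => // t tp tt0.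
have [y [Oy y1 y2 uy]] := H _ tp tt0; exists (rotation c (- s) y).
have csN : c ^+ 2 + (- s) ^+ 2 = 1 by rewrite sqrrN.
have [y' yE] : exists y', y = rotation c s y' by exists (rotation c (- s) y); rewrite rotationVK.
rewrite yE rotationK// in Oy y1 y2 uy *.
have cs' := cs; rewrite !expr2 in cs'.
have e2t : e * t = 2 * (e / 2 * t) by field.
split => //; last by apply: le_trans uy; rewrite lerD2l ler_pM2l//; lra.
  have -> : y'.1 - x.1 - t * d.1 = (c * c + s * s) * (y'.1 - x.1 - t * d.1) by rewrite cs' mul1r.
  have -> : (c * c + s * s) * (y'.1 - x.1 - t * d.1) =
    c * ((rotation c s y').1 - (rotation c s x).1 - t * (rotation c s d).1) -
    (- s) * ((rotation c s y').2 - (rotation c s x).2 - t * (rotation c s d).2).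
    by rewrite /rotation /=; ring.
  by rewrite e2t; exact: rotation_bound.
have -> : y'.2 - x.2 - t * d.2 = (c * c + s * s) * (y'.2 - x.2 - t * d.2) by rewrite cs' mul1r.
have -> : (c * c + s * s) * (y'.2 - x.2 - t * d.2) =
  c * ((rotation c s y').2 - (rotation c s x).2 - t * (rotation c s d).2) -
  s * ((rotation c s y').1 - (rotation c s x).1 - t * (rotation c s d).1).
  by rewrite /rotation /=; ring.
by rewrite e2t; exact: rotation_bound.
Qed.

(** The direction [(c, s)] descends across the ridge and [(- s, c)] runs along it. The direction
    down the second face is requested for [b < 1] only: a vertical face is represented by some
    [b >= 1], and its tangent cone does not contain that direction. *)
Lemma sloped_ridge_false c s Om B M u x0 (a b : R) : c ^+ 2 + s ^+ 2 = 1 ->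
  planar_body Om B -> optimal Om M u -> Om x0 -> 0 < u x0 -> 0 < a -> a < b ->
  (forall x, Om x -> u x <= u x0 - a * (c * (x.1 - x0.1) + s * (x.2 - x0.2))) ->
  (forall x, Om x -> u x <= u x0 - b * (c * (x.1 - x0.1) + s * (x.2 - x0.2))) ->
  reaches Om u x0 (- c, - s) a -> (b < 1 -> reaches Om u x0 (c, s) (- b)) ->
  reaches Om u x0 (- s, c) 0 -> reaches Om u x0 (s, - c) 0 -> False.
Proof.
move=> cs OmB ou Ox0 u0 a0 ab ua ub rl rr ru rd.
have OmB' := rotation_body cs OmB; have ou' := rotation_optimal cs OmB ou.
have [y0 yE] : exists y0, x0 = rotation c s y0 by exists (rotation c (- s) x0); rewrite rotationVK.
rewrite yE in Ox0 u0 ua ub rl rr ru rd.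
have tE y : c * ((rotation c s y).1 - (rotation c s y0).1) +
    s * ((rotation c s y).2 - (rotation c s y0).2) = y.1 - y0.1.
  have cs' := cs; rewrite !expr2 in cs'; rewrite /rotation /=.
  by rewrite -[RHS]mul1r -cs'; ring.
have up k : (forall x, Om x -> u x <= u (rotation c s y0) - k * (c * (x.1 - (rotation c s y0).1) +
    s * (x.2 - (rotation c s y0).2))) -> forall y, (rotation c s @^-1` Om) y ->
    (u \o rotation c s) y <= (u \o rotation c s) y0 - k * (y.1 - y0.1).
  by move=> H y /H; rewrite tE.
have rt d h : reaches Om u (rotation c s y0) (rotation c s d) h ->
  reaches (rotation c s @^-1` Om) (u \o rotation c s) y0 d h by exact: rotation_reaches.
have rE (d1 d2 : R) : rotation c s (d1, d2) = (c * d1 - s * d2, s * d1 + c * d2) by [].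
have {}rl : reaches (rotation c s @^-1` Om) (u \o rotation c s) y0 (-1, 0) a.
  by apply: rt; rewrite rE !mulr0 subr0 addr0 !mulrN1.
have {}ru : reaches (rotation c s @^-1` Om) (u \o rotation c s) y0 (0, 1) 0.
  by apply: rt; rewrite rE !mulr0 sub0r add0r !mulr1.
have {}rd : reaches (rotation c s @^-1` Om) (u \o rotation c s) y0 (0, -1) 0.
  by apply: rt; rewrite rE !mulr0 sub0r add0r !mulrN1 opprK.
have [b1|b1] := leP 1 b.
  exact: (steep_ridge_false OmB' ou' Ox0 u0 a0 ab b1 (up _ ua) (up _ ub) rl ru).
have {}rr : reaches (rotation c s @^-1` Om) (u \o rotation c s) y0 (1, 0) (- b).
  by apply: rt; rewrite rE !mulr0 subr0 addr0 !mulr1; exact: rr.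
exact: (gentle_ridge_false OmB' ou' Ox0 a0 (ltW ab) b1 rl rr ru rd (up _ ua)).
Qed.

End rotated_body.

(** * Dihedral tangent cones *)

Section dihedral_cone.
Context {R : realType}.
Implicit Types (Om : set (R * R)) (u : R * R -> R) (x y z d : R * R) (n p r : (R * R) * R).

(** A single point of the body realizes the direction approximately at one scale; the segment from
    [x0] to it realizes it at all smaller scales, by convexity of [Om] and concavity of [u]. *)
Lemma tangent_cone_reaches Om u x0 d h : cvx Om -> ccv Om u -> Om x0 ->
  tangent_cone (hypograph Om u) (x0, u x0) ((x0, u x0) + (d, h)) -> reaches Om u x0 d h.
Proof.
move=> cO cu Ox0 cone e e0.
have /cone : nbhs ((x0, u x0) + (d, h)) (ball ((x0, u x0) + (d, h)) e) by exact: nbhsx_ballx.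
move=> [_ [[t [[p z] [t0 [/= Op /andP[z0 zu] ->]]]] [[/= b1 b2] b3]]].
have sc (q q0 w : R) : ball (q0 + w) e (q0 + t * (q - q0)) -> `|t * (q - q0) - w| < e.
  by rewrite /ball /= distrC opprD addrACA subrr add0r.
move: b1 b2 b3 => /sc b1 /sc b2 /sc b3.
exists (1 / (t + 1)) => [|s s0]; first by rewrite divr_gt0//; lra.
rewrite ler_pdivlMr; last lra; move=> st.
have st0 : 0 <= s * t by rewrite mulr_ge0// ltW.
have st1 : s * t <= 1 by lra.
exists (seg x0 p (s * t)); split.
- exact: cO.
- have -> : (seg x0 p (s * t)).1 - x0.1 - s * d.1 = s * (t * (p.1 - x0.1) - d.1).
    by rewrite /seg /mv /=; ring.
  by rewrite normrM gtr0_norm// mulrC ler_wpM2r ?ltW.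
- have -> : (seg x0 p (s * t)).2 - x0.2 - s * d.2 = s * (t * (p.2 - x0.2) - d.2).
    by rewrite /seg /mv /=; ring.
  by rewrite normrM gtr0_norm// mulrC ler_wpM2r ?ltW.
apply: le_trans (cu _ _ _ Ox0 Op st0 st1).
rewrite lerD2l -mulrA ler_pM2l//.
move: b3; rewrite ltr_norml => /andP[b3 _].
by have := ler_wpM2l t0 zu; lra.
Qed.

Section slopes.
Variables (Om : set (R * R)) (B M : R) (u : R * R -> R) (x0 : R * R) (c s : R).
Hypotheses (OmB : planar_body Om B) (ou : optimal Om M u) (Ox0 : Om x0)
  (u0 : 0 < u x0) (uM : u x0 < M) (cs : c ^+ 2 + s ^+ 2 = 1).

(** Across the edge the faces have slopes [a1 / g1 < a2 / g2]; the inequality is cleared of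
    denominators because [g2 = 0] stands for a vertical face. *)
Lemma ordered_slopes_false (a1 g1 a2 g2 : R) : 0 < a1 -> 0 < a2 -> 0 <= g1 -> 0 <= g2 ->
  a1 * g2 < a2 * g1 ->
  (forall x, Om x -> a1 * (c * (x.1 - x0.1) + s * (x.2 - x0.2)) + g1 * (u x - u x0) <= 0) ->
  (forall x, Om x -> a2 * (c * (x.1 - x0.1) + s * (x.2 - x0.2)) + g2 * (u x - u x0) <= 0) ->
  (forall d h, a1 * (c * d.1 + s * d.2) + g1 * h <= 0 ->
    a2 * (c * d.1 + s * d.2) + g2 * h <= 0 -> reaches Om u x0 d h) -> False.
Proof.
move=> a10 a20 g10 g20 lt12 H1 H2 cone; have cs' := cs; rewrite !expr2 in cs'.
have g1p : 0 < g1.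
  rewrite lt_neqAle g10 andbT eq_sym; apply/eqP => g1E.
  by move: lt12; rewrite g1E mulr0 ltNge mulr_ge0// ltW.
have [a aE] : exists a, a = a1 / g1 by eexists.
have a0 : 0 < a by rewrite aE divr_gt0.
have ag : a * g1 = a1 by rewrite aE divfK// gt_eqF.
have ua x : Om x -> u x <= u x0 - a * (c * (x.1 - x0.1) + s * (x.2 - x0.2)).
  move=> /H1; rewrite -ag; move: (c * _ + _) => t h; rewrite -(ler_pM2l g1p); lra.
have wE : c * c + s * s = 1 by [].
have rl : reaches Om u x0 (- c, - s) a.
  have E : c * - c + s * - s = -1 by rewrite -cs'; ring.
  apply: cone; rewrite /= E; first by rewrite -ag; lra.
  have E2 : a * g2 * g1 = a1 * g2 by rewrite mulrAC ag.
  by rewrite -(ler_pM2r g1p); lra.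
have edge (k : R) : c * (k * - s) + s * (k * c) = 0 by ring.
have r1 : reaches Om u x0 (- s, c) 0.
  by have E := edge 1; rewrite !mul1r in E; apply: cone; rewrite /= E; lra.
have r2 : reaches Om u x0 (s, - c) 0.
  by have E := edge (-1); rewrite !mulN1r opprK in E; apply: cone; rewrite /= E; lra.
have [g2E|g2n] := eqVneq g2 0.
  (* A vertical face confines [Om] to one side of the edge, where the bound with slope [a] implies
     the bound with any larger slope; [a + 1] is also at least 1. *)
  have [b [ab b1]] : exists b, a < b /\ 1 <= b.
    by exists (a + 1); split; lra.
  apply: (sloped_ridge_false cs OmB ou Ox0 u0 a0 ab ua _ rl _ r1 r2); last by rewrite ltNge b1.
  move=> x Ox; apply: le_trans (ua _ Ox) _; have := H2 _ Ox; rewrite g2E mul0r addr0.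
  rewrite (pmulr_rle0 _ a20) => t0; rewrite lerD2l lerN2.
  by apply: ler_wnM2r => //; exact: ltW.
have g2p : 0 < g2 by rewrite lt_neqAle eq_sym g2n.
have [b bE] : exists b, b = a2 / g2 by eexists.
have bg : b * g2 = a2 by rewrite bE divfK// gt_eqF.
have ab : a < b by rewrite aE bE ltr_pdivrMr// mulrAC ltr_pdivlMr.
apply: (sloped_ridge_false cs OmB ou Ox0 u0 a0 ab ua _ rl _ r1 r2).
  move=> x /H2; rewrite -bg; move: (c * _ + _) => t h; rewrite -(ler_pM2l g2p); lra.
move=> _; apply: cone; rewrite /= wE -?ag -?bg; last lra.
by have := mulr_ge0 g10 (ltW (_ : 0 < b - a)); rewrite subr_gt0 ab => /(_ isT); lra.
Qed.

Lemma slopes_false (a1 g1 a2 g2 : R) : 0 < a1 -> 0 <= g1 -> 0 <= g2 -> a1 * g2 != a2 * g1 ->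
  (forall x, Om x -> a1 * (c * (x.1 - x0.1) + s * (x.2 - x0.2)) + g1 * (u x - u x0) <= 0) ->
  (forall x, Om x -> a2 * (c * (x.1 - x0.1) + s * (x.2 - x0.2)) + g2 * (u x - u x0) <= 0) ->
  (forall d h, a1 * (c * d.1 + s * d.2) + g1 * h <= 0 ->
    a2 * (c * d.1 + s * d.2) + g2 * h <= 0 -> reaches Om u x0 d h) -> False.
Proof.
move=> a10 g10 g20 ne H1 H2 cone; have [a20|a20] := leP a2 0.
  have k0 : 0 < a1 * g2 - a2 * g1.
    have : a2 * g1 <= 0 by exact: mulr_le0_ge0.
    have : 0 <= a1 * g2 by rewrite mulr_ge0// ltW.
    by move: ne; rewrite neq_lt => /orP[]; lra.
  (* Eliminating the horizontal term between the inequalities of the two faces leaves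
     [u x <= u x0]. *)
  apply: (optimal_reaches_top OmB ou u0 uM) => x Ox.
  have h1 := H1 _ Ox; have h2 := H2 _ Ox.
  have a2N : 0 <= - a2 by lra.
  have := mulr_ge0_le0 a2N h1; have := mulr_ge0_le0 (ltW a10) h2.
  move: (c * _ + _) => t k1 k2; rewrite -subr_le0 -(pmulr_rle0 _ k0); lra.
move: ne; rewrite neq_lt => /orP[lt|lt].
  exact: (ordered_slopes_false a10 a20 g10 g20 lt H1 H2 cone).
apply: (ordered_slopes_false a20 a10 g20 g10 lt H2 H1) => d h h2 h1; exact: cone.
Qed.

End slopes.

Lemma scale_normal (k : R) n : k *: n = ((k * n.1.1, k * n.1.2), k * n.2).
Proof. by case: n => [[]]. Qed.

Lemma ridge_normals (C : set ((R * R) * R)) r E : ridge_point C r E ->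
  exists n1 n2, [/\ n1 != 0 /\ n2 != 0, forall k : R, n2 != k *: n1,
    forall p, C p -> dot n1 (p - r) <= 0 /\ dot n2 (p - r) <= 0,
    forall v, dot n1 v <= 0 -> dot n2 v <= 0 -> tangent_cone C r (r + v)
  & horizontal E -> n1.1.1 * n2.1.2 = n1.1.2 * n2.1.1].
Proof.
case=> Cr _ [n1 [n2 [n0 nk KE EE]]]; exists n1, n2; split => //.
- move=> p Cp; suff : tangent_cone C r p by rewrite KE.
  by apply: subset_closure; exists 1, p; rewrite ler01 scale1r addrC subrK.
- by move=> v h1 h2; rewrite KE; split; rewrite /half_space /= addrC addKr.
(* [w] is the cross product of the normals and directs the edge; horizontality annihilates its third
   coordinate. *)
move=> hE; pose w : (R * R) * R := ((n1.1.2 * n2.2 - n1.2 * n2.1.2, n1.2 * n2.1.1 - n1.1.1 * n2.2),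
  n1.1.1 * n2.1.2 - n1.1.2 * n2.1.1).
have : (r + w).2 = (r + 0).2.
  apply: hE; rewrite EE; split; rewrite /bounding_plane /= addrC addKr /dot /w /=; ring.
by rewrite addr0 /= => /eqP; rewrite -subr_eq0 addrC addKr subr_eq0 => /eqP.
Qed.

Lemma ridge_level_boundary (C : set ((R * R) * R)) r E : ridge_point C r E ->
  plane_boundary r.2 (level_set C r.2) r.
Proof.
move=> Cr; have [n1 [n2 [[n10 n20] nk HC _ _]]] := ridge_normals Cr.
have [C0 _ _] := Cr; case: r C0 HC {Cr} => x0 z0 /= C0 HC.
split => //; split; first by apply: subset_closure.
move=> /plane_interiorP[e e0 He]; have {}He y : `|y.1 - x0.1| < e -> `|y.2 - x0.2| < e ->
    dot n1 ((y, z0) - (x0, z0)) <= 0 /\ dot n2 ((y, z0) - (x0, z0)) <= 0.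
  by move=> y1 y2; apply: HC; have [] := He _ y1 y2.
have e2 : `|e / 2| < e by rewrite gtr0_norm; lra.
have e2N : `|- (e / 2)| < e by rewrite normrN.
have ee (w : R) : w * (e / 2) <= 0 -> w * - (e / 2) <= 0 -> w = 0.
  by move=> h1 h2; apply/eqP; rewrite -(mulIr_eq0 _ (mulIf (_ : e / 2 != 0))); [apply/eqP|apply: lt0r_neq0]; lra.
have H1 := He (x0.1 + e / 2, x0.2); have H2 := He (x0.1 - e / 2, x0.2).
have H3 := He (x0.1, x0.2 + e / 2); have H4 := He (x0.1, x0.2 - e / 2).
have aK (w w' : R) : w + w' - w = w' by rewrite addrC addKr.
move: H1 H2 H3 H4; rewrite /dot /= !aK !subrr normr0 !mulr0 !addr0 !add0r.
move=> /(_ e2 e0)[h1 k1] /(_ e2N e0)[h2 k2] /(_ e0 e2)[h3 k3] /(_ e0 e2N)[h4 k4].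
case: n1 n2 n10 nk h1 h2 h3 h4 k1 k2 k3 k4 {n20 HC He} => [[p1 q1] g1] [[p2 q2] g2] n10 nk /=.
move=> h1 h2 h3 h4 k1 k2 k3 k4.
have E1 := ee _ h1 h2; have E2 := ee _ h3 h4; have E3 := ee _ k1 k2; have E4 := ee _ k3 k4.
have g10 : g1 != 0 by apply: contra_neq n10 => ->; rewrite E1 E2.
have := nk (g2 / g1); rewrite scale_normal /= E1 E2 E3 E4 !mulr0 divfK//.
by rewrite eqxx.
Qed.

(** Since the horizontal parts of the normals are parallel, both are multiples of the unit vector
    [(c, s)] along [n1.1]; the multiple for the second normal may have either sign. *)
Lemma normals_false Om (B M : R) u x0 n1 n2 : planar_body Om B -> optimal Om M u -> Om x0 ->
  0 < u x0 -> u x0 < M -> n1.1 != 0 -> 0 <= n1.2 -> 0 <= n2.2 -> (forall k : R, n2 != k *: n1) ->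
  n1.1.1 * n2.1.2 = n1.1.2 * n2.1.1 ->
  (forall x, Om x -> dot n1 ((x, u x) - (x0, u x0)) <= 0 /\ dot n2 ((x, u x) - (x0, u x0)) <= 0) ->
  (forall d h, dot n1 (d, h) <= 0 -> dot n2 (d, h) <= 0 -> reaches Om u x0 d h) -> False.
Proof.
case: n1 n2 => [[p1 q1] g1] [[p2 q2] g2] /= OmB ou Ox0 u0 uM n0 g10 g20 nk par H cone.
have N2 : 0 < p1 ^+ 2 + q1 ^+ 2.
  rewrite lt_neqAle addr_ge0 ?sqr_ge0// andbT eq_sym; apply: contra_neq n0 => /eqP.
  by rewrite paddr_eq0 ?sqr_ge0// !sqrf_eq0 => /andP[/eqP -> /eqP ->].
have [N NE] : exists N, N = Num.sqrt (p1 ^+ 2 + q1 ^+ 2) by eexists.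
have N0 : 0 < N by rewrite NE sqrtr_gt0.
have NN : N ^+ 2 = p1 ^+ 2 + q1 ^+ 2 by rewrite NE sqr_sqrtr// ltW.
have Nn : N != 0 by rewrite gt_eqF.
have [c cE] : exists c, c = p1 / N by eexists.
have [s sE] : exists s, s = q1 / N by eexists.
have cs : c ^+ 2 + s ^+ 2 = 1.
  by rewrite cE sE !exprMn -mulrDl -NN -exprMn mulfV// expr1n.
have pE : p1 = N * c by rewrite cE mulrC divfK.
have qE : q1 = N * s by rewrite sE mulrC divfK.
have [a aE] : exists a, a = c * p2 + s * q2 by eexists.
have par' : c * q2 = s * p2 by apply: (mulfI Nn); rewrite !mulrA -pE -qE.
have cs' := cs; rewrite !expr2 in cs'.
have p2E : p2 = a * c.
  rewrite aE; have := congr1 (fun w => s * w) par'; have := congr1 (fun w => w * p2) cs'.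
  by lra.
have q2E : q2 = a * s.
  rewrite aE; have := congr1 (fun w => c * w) par'; have := congr1 (fun w => w * q2) cs'.
  by lra.
apply: (slopes_false OmB ou Ox0 u0 uM cs N0 g10 g20 (a2 := a)).
- apply/eqP => E; have := nk (a / N); rewrite scale_normal /=.
  rewrite pE qE !mulrA divfK// -p2E -q2E.
  have -> : a / N * g1 = g2 by rewrite mulrAC -E mulrAC mulfV// mul1r.
  by rewrite eqxx.
- by move=> x /H[+ _]; rewrite /dot /= pE qE; lra.
- by move=> x /H[_ +]; rewrite /dot /= p2E q2E; lra.
by move=> d h h1 h2; apply: cone; rewrite /dot /= ?pE ?qE ?p2E ?q2E; lra.
Qed.

End dihedral_cone.

(** * Passage from compact convex sets and minimizers to the theorem *)

Lemma compact_planar_body (R : realType) (Om : set (R * R)) : compact Om -> cvx Om -> Om° !=set0 ->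
  exists B, planar_body Om B.
Proof.
move=> kO cO iO; have [B [_ /(_ (B + 1))]] := compact_bounded kO.
rewrite ltrDl ltr01 => /(_ isT) bO; exists (B + 1); split => //.
  by apply: compact_closed => //; exact: norm_hausdorff.
move=> x /bO; rewrite /= prod_normE ge_max => /andP[]; done.
Qed.

Lemma minimizer_optimal (R : realType) (Om : set (R * R)) (B M : R) u : planar_body Om B ->
  minimizer Om M u -> optimal Om M u.
Proof.
move=> [cO clO iO bO] [[/concave_functionE cu bu] min]; split=> // v [cv bv].
rewrite -(resistanceE cO cu bO clO iO) -(resistanceE cO cv bO clO iO).
by apply: min; split => //; apply/concave_functionE.
Qed.

Unset Implicit Arguments.

Theorem corollary1 (R : realType) (Omega : set (R * R)) (M : R)
    (u : R * R -> R)
    (compact_Omega : compact Omega)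
    (convex_Omega : convex_set Omega)
    (interior_Omega : interior Omega !=set0)
    (M_gt0 : 0 < M)
    (min_u : minimizer Omega M u)
    (r : (R * R) * R) (E : set ((R * R) * R))
    (ridge_r : ridge_point (hypograph Omega u) r E)
    (horizontal_E : horizontal E) :
  plane_boundary M (level_set (hypograph Omega u) M) r \/
  plane_boundary 0 (level_set (hypograph Omega u) 0) r.

Proof.
have /convex_setE cO := convex_Omega.
have [B OmB] := compact_planar_body compact_Omega cO interior_Omega.
have ou := minimizer_optimal OmB min_u; have [[cu bu] _] := ou.
have lev := ridge_level_boundary ridge_r.
have [Cr _ _] := ridge_r; have [n1 [n2 [[n10 n20] nk HC cone /(_ horizontal_E) par]]] := ridge_normals ridge_r.
case: r ridge_r Cr lev HC cone => x0 z0 _ [/= Ox0 /andP[z0_ge0 z0u]] lev HC cone.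
have /andP[_ uM] := bu _ Ox0.
have [z00|z0n] := eqVneq z0 0; first by right; rewrite z00 in lev *.
have [z0M|z0nM] := eqVneq z0 M; first by left; rewrite z0M in lev *.
have z0_gt0 : 0 < z0 by rewrite lt_neqAle eq_sym z0n.
have z0_ltM : z0 < M by rewrite lt_neqAle z0nM (le_trans z0u).
have dE n : dot n ((x0, 0) - (x0, z0)) = - (n.2 * z0) by rewrite /dot /= !subrr !mulr0 !add0r mulrN.
(* The point of the body at height 0 below [r] shows that neither normal points downwards. *)
have [g1 g2] : 0 <= n1.2 /\ 0 <= n2.2.
  have [|+ +] := HC (x0, 0); first by split => //=; rewrite lexx (le_trans z0_ge0).
  by rewrite !dE !oppr_le0 !pmulr_lge0.
exfalso.
(* Otherwise the body continues upwards from [r], which makes both normals horizontal; with parallel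
   horizontal parts they would be proportional. *)
have zu : z0 = u x0.
  apply/eqP; rewrite eq_le z0u leNgt /=; apply/negP => lt.
  have [|+ +] := HC (x0, u x0); first by split => //=; rewrite lexx (le_trans z0_ge0).
  rewrite /dot /= !subrr !mulr0 !add0r !pmulr_lle0 ?subr_gt0// => g1' g2'.
  have {}g1 : n1.2 = 0 by apply/le_anti/andP.
  have {}g2 : n2.2 = 0 by apply/le_anti/andP.
  case: n1 n2 n10 nk par g1 g2 {n20 HC cone dE g1' g2'} => [[p1 q1] h1] [[p2 q2] h2] /= n10 nk par g1 g2.
  have [p10|p1n] := eqVneq p1 0.
    have q1n : q1 != 0 by apply: contra_neq n10 => ->; rewrite p10 g1.
    have p20 : p2 = 0.
      by apply/eqP; rewrite -(mulrI_eq0 _ (mulfI q1n)) -par p10 mul0r.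
    by have := nk (q2 / q1); rewrite scale_normal /= p10 g1 g2 p20 !mulr0 divfK// eqxx.
  have := nk (p2 / p1); rewrite scale_normal /= g1 g2 mulr0 divfK//.
  by rewrite mulrAC [p2 * q1]mulrC -par mulrAC mulfV// mul1r eqxx.
rewrite zu in z0_gt0 z0_ltM HC cone.
have inC x : Omega x -> dot n1 ((x, u x) - (x0, u x0)) <= 0 /\ dot n2 ((x, u x) - (x0, u x0)) <= 0.
  by move=> Ox; apply: HC; split => //=; rewrite lexx andbT; have /andP[] := bu _ Ox.
have dir d h : dot n1 (d, h) <= 0 -> dot n2 (d, h) <= 0 -> reaches Omega u x0 d h.
  by move=> h1 h2; apply: tangent_cone_reaches => //; exact: cone.
(* One face may be horizontal, but not both; if it is the first, the two normals exchange roles. *)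
have [n1E|n1n] := eqVneq n1.1 0; last first.
  exact: (normals_false OmB ou Ox0 z0_gt0 z0_ltM n1n g1 g2 nk par inC dir).
have n12 : n1.2 != 0 by apply: contra_neq n10 => h; rewrite [n1]surjective_pairing n1E h.
have n2n : n2.1 != 0.
  apply/eqP => n2E; have := nk (n2.2 / n1.2).
  rewrite scale_normal n1E !mulr0 divfK// {1}[n2]surjective_pairing n2E; exact/negP/negPn.
apply: (normals_false OmB ou Ox0 z0_gt0 z0_ltM n2n g2 g1 _ _ _ _).
- move=> k; apply/eqP => nE; move: n2n; have [k0|k0] := eqVneq k 0.
    by move: n10; rewrite nE k0 scale0r eqxx.
  move: n1E; rewrite nE /= => /eqP; rewrite scaler_eq0 (negbTE k0) /= => /eqP ->.
  by rewrite eqxx.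
- by rewrite n1E /= !mulr0.
- by move=> x /inC[].
by move=> d h h1 h2; exact: dir.
Qed.
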